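(* Let $X$ be a compact Riemann surface of genus $g\ge 2$ and let $(E,\bar\partial_E,\Phi)$ be a stable degree-zero $\mathrm{SL}(2,\mathbb{C})$ Higgs bundle over $X$. For $t>0$ let $h_t$ be the harmonic metric of $(E,t\Phi)$, all the $h_t$ inducing the same fixed metric on $\det E$, and let $\Gamma_t:=t\,h_t^{-1}\partial_t h_t$. Then for every $t>0$, $$\|\Gamma_t(x)\|_{\mathrm{op}}\le 1\qquad\text{for every }x\in X,$$ where the operator norm is computed with respect to $h_t$.
   Context: An $\mathrm{SL}(2,\mathbb{C})$ Higgs bundle $(E,\bar\partial_E,\Phi)$ on $X$ is a rank-two holomorphic vector bundle $E$ with trivial determinant together with a holomorphic section $\Phi$ of $\mathrm{End}(E)\otimes K_X$ with $\mathrm{tr}\,\Phi=0$. It is stable if every $\Phi$-invariant holomorphic line subbundle of $E$ has negative degree. A harmonic metric of $(E,t\Phi)$ is a Hermitian metric $h_t$ on $E$ solving $F_{h_t}+[t\Phi,(t\Phi)^{\star_{h_t}}]=0$, where $F_{h_t}$ is the curvature of the Chern connection and $\star_{h_t}$ is the $h_t$-adjoint. It exists and is unique up to a positive scalar; the scalar is fixed by requiring that $h_t$ induce a fixed ($t$-independent, flat) metric on $\det E$. With this normalization $h_t$ depends smoothly on $t\in(0,\infty)$ (a standard fact). Thus $\Gamma_t$ is a smooth endomorphism of $E$, defined by $\frac{d}{d\log t}h_t(u,v)=h_t(\Gamma_t u,v)$; it is trace-free and self-adjoint with respect to $h_t$. *)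

(* Defs.v *)
From HB Require Import structures.
From mathcomp Require Import all_boot all_order all_algebra.
From mathcomp Require Import complex.
From mathcomp Require Import all_classical all_reals all_analysis.

Set Implicit Arguments.
Unset Strict Implicit.
Unset Printing Implicit Defensive.

Import Order.TTheory GRing.Theory Num.Theory.
Import numFieldNormedType.Exports.

Local Open Scope classical_set_scope.
Local Open Scope complex_scope.
Local Open Scope ring_scope.

(* R[i] as a normed space over itself, so that [derivable f z 1] for
   f : R[i] -> R[i] is complex differentiability at z. *)
HB.instance Definition _ (R : realType) := NormedModule.copy R[i] R[i]^o.

(* The real and imaginary parts in R, not the R[i]-valued ones of numfield. *)
Local Notation Re := complex.Re.
Local Notation Im := complex.Im.

Section Calculus.
Variable R : realType.
Local Notation C := R[i].

(* D is meant to be open. *)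
Fixpoint Ck (V W : normedModType R) (n : nat) (D : set V) (f : V -> W) : Prop :=
  (forall x, D x -> {for x, continuous f}) /\
  (if n is m.+1
   then forall v, (forall x, D x -> derivable f x v) /\
                  Ck m D (fun x => 'D_v f x)
   else True).

Definition smooth (V : normedModType R) (D : set V) (f : V -> C) : Prop :=
  forall n, Ck n D (fun x => Re (f x) : R) /\ Ck n D (fun x => Im (f x) : R).

Definition plane (p : R * R) : C := p.1 +i* p.2.

Definition pderive (v : R * R) (f : C -> C) (z : C) : C :=
  ('D_v (fun p : R * R => Re (f (plane p)) : R) (Re z, Im z)) +i*
  ('D_v (fun p : R * R => Im (f (plane p)) : R) (Re z, Im z)).

(* Wirtinger derivatives d/dz and d/d(zbar). *)
Definition dz (f : C -> C) (z : C) : C :=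
  (pderive (1, 0) f z - 'i%C * pderive (0, 1) f z) / 2.
Definition dzbar (f : C -> C) (z : C) : C :=
  (pderive (1, 0) f z + 'i%C * pderive (0, 1) f z) / 2.

Definition adjmx m n (A : 'M[C]_(m, n)) : 'M[C]_(n, m) :=
  (map_mx (@conjc R) A)^T.

(* A Gram matrix H stands for the Hermitian form h(u, v) = v^* H u. *)
Definition hform r (H : 'M[C]_r) (u v : 'cV[C]_r) : C :=
  (adjmx v *m H *m u) 0 0.

Definition posdef r (H : 'M[C]_r) : Prop :=
  adjmx H = H /\ forall u : 'cV[C]_r, u != 0 -> 0 < hform H u u.

(* The adjoint of A for h: h(A u, v) = h(u, hadj H A v). *)
Definition hadj r (H A : 'M[C]_r) : 'M[C]_r := invmx H *m adjmx A *m H.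

Definition hnorm r (H : 'M[C]_r) (u : 'cV[C]_r) : R :=
  Num.sqrt (Re (hform H u u)).

Definition op_norm r (H A : 'M[C]_r) : \bar R :=
  ereal_sup [set (hnorm H (A *m u))%:E | u in [set u | hnorm H u <= 1]].

End Calculus.

(* A Riemann surface given by a holomorphic atlas: [crd i] is the coordinate
   on [dom i] and [inv i] its inverse on [crd i @` dom i]; the values of
   [crd i] and [inv i] elsewhere are irrelevant. *)
Record riemann_surface (R : realType) := RiemannSurface {
  pt :> topologicalType;
  idx : Type;
  dom : idx -> set pt;
  crd : idx -> pt -> R[i];
  inv : idx -> R[i] -> pt;
  surf_hausdorff : hausdorff_space pt;
  surf_connected : connected [set: pt];
  dom_open : forall i, open (dom i);
  dom_cover : forall x, exists i, dom i x;
  img_open : forall i, open (crd i @` dom i);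
  crdK : forall i x, dom i x -> inv i (crd i x) = x;
  crd_continuous : forall i x, dom i x -> {for x, continuous (crd i)};
  inv_continuous : forall i x, dom i x -> {for crd i x, continuous (inv i)};
  crd_holo : forall i k x, dom i x -> dom k x ->
    derivable (fun z : R[i] => crd k (inv i z)) (crd i x) 1
}.

Section Surface.
Variables (R : realType) (X : riemann_surface R).
Local Notation C := R[i].

(* The next two are meant for W open in X. *)
Definition holo_on (W : set X) (f : X -> C) : Prop :=
  forall i x, W x -> dom i x -> derivable (fun z : C => f (inv i z)) (crd i x) 1.

Definition smooth_on (W : set X) (f : X -> C) : Prop :=
  forall i : idx X,
    smooth [set p : R * R | (crd i @` dom i) (plane p) /\ W (inv i (plane p))]
           (fun p : R * R => f (inv i (plane p))).

Definition holo_mx_on m n (W : set X) (A : X -> 'M[C]_(m, n)) : Prop :=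
  forall a b, holo_on W (fun x => A x a b).

Definition smooth_mx_on m n (W : set X) (A : X -> 'M[C]_(m, n)) : Prop :=
  forall a b, smooth_on W (fun x => A x a b).

(* d z_k / d z_i, for the coordinates z_i and z_k. *)
Definition jac (k i : idx X) (x : X) : C :=
  'D_1 (fun z : C => crd k (inv i z)) (crd i x).

(* A 1-form of type (1,0) is given by its coefficients: w i stands for
   w_i dz_i. *)
Definition holo_one_form (w : idx X -> X -> C) : Prop :=
  (forall i, holo_on (dom i) (w i)) /\
  (forall i k x, dom i x -> dom k x -> w i x = jac k i x * w k x).

(* The genus is the dimension of the space of holomorphic 1-forms. *)
Definition has_genus (g : nat) : Prop :=
  exists b : 'I_g -> idx X -> X -> C,
    (forall k, holo_one_form (b k)) /\
    (forall w, holo_one_form w ->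
       exists! c : 'rV[C]_g, forall i x, dom i x ->
         w i x = \sum_(k < g) c 0 k * b k i x).

Definition partition_of_unity n (c : 'I_n -> idx X) (rho : 'I_n -> X -> R) :
    Prop :=
  [/\ forall k, continuous (rho k),
      forall k x, 0 <= rho k x,
      forall k, closure [set x | rho k x != 0] `<=` dom (c k) &
      forall x, \sum_(k < n) rho k x = 1].

Definition chart_integral (i : idx X) (f : X -> C) : C :=
  let D := [set p : R * R | (crd i @` dom i) (plane p)] in
  let mu := (@lebesgue_measure R \x @lebesgue_measure R)%E in
  (\int[mu]_(p in D) Re (f (inv i (plane p)))) +i*
  (\int[mu]_(p in D) Im (f (inv i (plane p)))).

(* A 2-form is given by its coefficients: w i stands for
   w_i dz_i /\ d(zbar_i) = - 2i w_i dx_i /\ dy_i. *)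
Definition has_integral (w : idx X -> X -> C) (I : C) : Prop :=
  exists n (c : 'I_n -> idx X) (rho : 'I_n -> X -> R),
    partition_of_unity c rho /\
    I = \sum_(k < n)
          chart_integral (c k) (fun x => (rho k x)%:C * (- 2 * 'i%C * w (c k) x)).

Definition dz_mx m n (i : idx X) (A : X -> 'M[C]_(m, n)) (x : X) :
    'M[C]_(m, n) :=
  \matrix_(a, b) dz (fun z => A (inv i z) a b) (crd i x).

Definition dzbar_mx m n (i : idx X) (A : X -> 'M[C]_(m, n)) (x : X) :
    'M[C]_(m, n) :=
  \matrix_(a, b) dzbar (fun z => A (inv i z) a b) (crd i x).

(* In a holomorphic frame with Gram matrix H, the Chern connection is
   d + H^-1 (del H) and its curvature is delbar (H^-1 (del H)); this is its
   coefficient with respect to dz_i /\ d(zbar_i). *)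
Definition chern_curvature r (i : idx X) (H : X -> 'M[C]_r) (x : X) : 'M[C]_r :=
  - dzbar_mx i (fun y => invmx (H y) *m dz_mx i H y) x.

(* Bundles are given by transition functions: a vector with coordinates u in
   the frame k has coordinates [trans j k x *m u] in the frame j. *)
Record bundle (r : nat) := Bundle {
  bidx : Type;
  bdom : bidx -> set X;
  trans : bidx -> bidx -> X -> 'M[C]_r
}.

Definition holo_bundle r (E : bundle r) : Prop :=
  [/\ forall j : bidx E, open (bdom j),
      forall x, exists j : bidx E, bdom j x,
      forall j k : bidx E, holo_mx_on (bdom j `&` bdom k) (trans j k),
      forall (j : bidx E) x, bdom j x -> trans j j x = 1%:M &
      forall (j k l : bidx E) x, bdom j x -> bdom k x -> bdom l x ->
        trans j k x *m trans k l x = trans j l x].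

Definition det_bundle r (E : bundle r) : bundle 1 :=
  {| bidx := bidx E;
     bdom := @bdom r E;
     trans := fun j k x => (\det (trans j k x))%:M |}.

(* E has a global holomorphic frame. *)
Definition trivial_bundle r (E : bundle r) : Prop :=
  exists s : bidx E -> X -> 'M[C]_r,
    [/\ forall j, holo_mx_on (bdom j) (s j),
        forall j x, bdom j x -> s j x \in unitmx &
        forall j k x, bdom j x -> bdom k x -> s j x = trans j k x *m s k x].

(* H j x is the Gram matrix of the metric in the frame j. *)
Definition hermitian_metric r (E : bundle r) (H : bidx E -> X -> 'M[C]_r) :
    Prop :=
  [/\ forall j, smooth_mx_on (bdom j) (H j),
      forall j x, bdom j x -> posdef (H j x) &
      forall j k x, bdom j x -> bdom k x ->
        H k x = adjmx (trans j k x) *m H j x *m trans j k x].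

Definition flat_metric r (E : bundle r) (H : bidx E -> X -> 'M[C]_r) : Prop :=
  forall i j x, dom i x -> bdom j x -> chern_curvature i (H j) x = 0.

(* The degree is the integral of (i / 2 pi) tr F for the Chern curvature F of
   a Hermitian metric; it does not depend on the choices made. *)
Definition has_degree r (E : bundle r) (d : R) : Prop :=
  exists (H : bidx E -> X -> 'M[C]_r) (w : idx X -> X -> C) (I : C),
    [/\ hermitian_metric H,
        forall i j x, dom i x -> bdom j x ->
          w i x = \tr (chern_curvature i (H j) x),
        has_integral w I &
        d%:C = 'i%C / (2 * pi)%:C * I].

(* phi i j is the coefficient of Phi with respect to dz_i, in the frame j. *)
Definition higgs_field r (E : bundle r) (phi : idx X -> bidx E -> X -> 'M[C]_r) :
    Prop :=
  (forall i j, holo_mx_on (dom i `&` bdom j) (phi i j)) /\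
  (forall i k j l x, dom i x -> dom k x -> bdom j x -> bdom l x ->
     phi i j x = jac k i x *: (trans j l x *m phi k l x *m trans l j x)).

Definition SL_higgs_bundle (E : bundle 2)
    (phi : idx X -> bidx E -> X -> 'M[C]_2) : Prop :=
  [/\ holo_bundle E,
      trivial_bundle (det_bundle E),
      higgs_field phi &
      forall i j x, dom i x -> bdom j x -> \tr (phi i j x) = 0].

(* iota is a holomorphic bundle map from L to E, injective on each fibre; its
   image is a line subbundle of E, and every line subbundle is of this form. *)
Definition line_subbundle r (E : bundle r) (L : bundle 1)
    (iota : bidx E -> bidx L -> X -> 'cV[C]_r) : Prop :=
  [/\ holo_bundle L,
      forall j a, holo_mx_on (bdom j `&` bdom a) (iota j a),
      forall j a x, bdom j x -> bdom a x -> iota j a x != 0 &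
      forall j k a b x, bdom j x -> bdom k x -> bdom a x -> bdom b x ->
        trans j k x *m iota k a x = iota j b x *m trans b a x].

Definition higgs_invariant r (E : bundle r)
    (phi : idx X -> bidx E -> X -> 'M[C]_r)
    (L : bundle 1) (iota : bidx E -> bidx L -> X -> 'cV[C]_r) : Prop :=
  forall i j a x, dom i x -> bdom j x -> bdom a x ->
    exists c : C, phi i j x *m iota j a x = c *: iota j a x.

Definition stable r (E : bundle r) (phi : idx X -> bidx E -> X -> 'M[C]_r) :
    Prop :=
  forall (L : bundle 1) (iota : bidx E -> bidx L -> X -> 'cV[C]_r),
    line_subbundle iota -> higgs_invariant phi iota ->
    forall d, has_degree L d -> d < 0.

(* F_h + [Phi, Phi^*_h] = 0, where [Phi, Phi^*] =
   (phi phi^* - phi^* phi) dz_i /\ d(zbar_i). *)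
Definition harmonic_metric r (E : bundle r)
    (phi : idx X -> bidx E -> X -> 'M[C]_r) (H : bidx E -> X -> 'M[C]_r) :
    Prop :=
  hermitian_metric H /\
  forall i j x, dom i x -> bdom j x ->
    chern_curvature i (H j) x
    + (phi i j x *m hadj (H j x) (phi i j x)
       - hadj (H j x) (phi i j x) *m phi i j x) = 0.

Definition smooth_family r (E : bundle r) (H : R -> bidx E -> X -> 'M[C]_r) :
    Prop :=
  forall (i : idx X) (j : bidx E) a b,
    smooth [set q : R * (R * R) |
             [/\ 0 < q.1, (crd i @` dom i) (plane q.2) &
                 bdom j (inv i (plane q.2))]]
           (fun q : R * (R * R) => H q.1 j (inv i (plane q.2)) a b).

Definition dt_mx m n (A : R -> 'M[C]_(m, n)) (t : R) : 'M[C]_(m, n) :=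
  \matrix_(a, b) ('D_1 (fun s : R => Re (A s a b) : R) t +i*
                  'D_1 (fun s : R => Im (A s a b) : R) t).

(* Gamma_t = t h_t^-1 d_t h_t in the frame j: with h(u, v) = v^* H u, it is
   the solution of t d_t h_t(u, v) = h_t(Gamma_t u, v). *)
Definition Gamma r (E : bundle r) (H : R -> bidx E -> X -> 'M[C]_r)
    (t : R) (j : bidx E) (x : X) : 'M[C]_r :=
  t%:C *: (invmx (H t j x) *m dt_mx (fun s => H s j x) t).

End Surface.

(* Main.v *)
Require Import Defs.
From HB Require Import structures.
From mathcomp Require Import all_boot all_order all_algebra ring lra.
From mathcomp Require Import complex.
From mathcomp Require Import all_classical all_reals all_analysis.

Set Implicit Arguments.
Unset Strict Implicit.
Unset Printing Implicit Defensive.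

Import Order.TTheory GRing.Theory Num.Theory.
Import numFieldNormedType.Exports.
Local Open Scope classical_set_scope.
Local Open Scope complex_scope.
Local Open Scope ring_scope.

Local Notation Re := complex.Re.
Local Notation Im := complex.Im.

(** Let [g^2 = tr Gamma^2 / 2], so that [Gamma^2 = g^2] and the operator norm of [Gamma]
    is [g].  Differentiating the curvature equation in [t] gives, with
    [psi = [Gamma, phi]] and [D'] the (1,0) part of the Chern connection on End E,
      [dzbar dz (g^2) = |D' Gamma|^2 + t^2 (|psi|^2 + 2 tr (psi phi^* ))].
    Since [2 tr (psi phi^* ) = tr (Gamma psi psi^* ) / g^2 >= - |psi|^2 / g], the right-hand
    side is nonnegative where [g > 1].  If [g] exceeds 1 somewhere, the strong maximum
    principle makes it constant, and then [D' Gamma = 0] and [psi = 0].  The projection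
    [(1 + Gamma / g) / 2] is therefore holomorphic and commutes with [phi]; it is also
    parallel for the metric, and [[phi, phi^* ] = 0], so its image is a [phi]-invariant
    line subbundle on which the induced metric is flat.  It has degree zero, which
    contradicts stability. *)

(** The threshold 1 is a balance of two terms. The derivative of t^2 [phi, phi^*] in log t hits the
    coefficient, which gives 2 [phi, phi^*], a term without sign after pairing with Gamma, and the
    adjoint, which gives |psi|^2. Only the part of phi anticommuting with Gamma enters psi; on it
    [Gamma, .] is multiplication by 2 Gamma, so that part has size |psi| / (2 g), and the unsigned
    term is dominated as soon as g >= 1. The energy g^2 replaces g because it is polynomial in
    Gamma, hence smooth also where Gamma vanishes. As its Laplacian has a sign only where g > 1, the
    maximum principle is applied locally, near a maximum point, and connectedness does the rest.
    Holomorphic means complex differentiable at each point, with no smoothness attached. Hence phi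
    is never differentiated in space, and the holomorphy of the eigenprojection is recovered from
    its vanishing dzbar derivative by the Cauchy-Riemann equations. Local frames of the eigenline
    are cut out of the columns of the projection. *)

(** * Calculus of C^n real functions on an open set *)

Section CkCalculus.
Variables (R : realType) (V : normedModType R).
Implicit Types (D : set V) (f g : V -> R).

Lemma CkW n D f x : Ck n D f -> D x -> {for x, continuous f}.
Proof. by case: n => [|n] [cf _]; exact: cf. Qed.

Lemma Ck_derivable n D f x v : Ck n.+1 D f -> D x -> derivable f x v.
Proof. by move=> [_ /(_ v)[df _]]; exact: df. Qed.

Lemma Ck_derive n D f v : Ck n.+1 D f -> Ck n D (fun x => 'D_v f x).
Proof. by move=> [_ /(_ v)[]]. Qed.

Lemma CkS n D f : Ck n.+1 D f -> Ck n D f.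
Proof.
elim: n f => [|n IH] f [cf df]; split=> // v; split; first by case: (df v).
by apply: IH; case: (df v).
Qed.

Lemma Ck_sub n D D' f : D' `<=` D -> Ck n D f -> Ck n D' f.
Proof.
move=> sD; elim: n f => [|n IH] f [cf df]; split=> //.
- by move=> x /sD; exact: cf.
- by move=> x /sD; exact: cf.
move=> v; have [dv cv] := df v; split; last exact: IH.
by move=> x /sD; exact: dv.
Qed.

Lemma near_open D (P : V -> Prop) x : open D -> D x -> (forall y, D y -> P y) ->
  \near x, P x.
Proof.
by move=> oD Dx DP; apply: filterS DP _; exact: open_nbhs_nbhs.
Qed.

Lemma continuous_near_eq (W : topologicalType) D (f g : V -> W) x :
  {for x, continuous f} -> (forall y, D y -> f y = g y) -> open D -> D x ->
  {for x, continuous g}.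
Proof.
move=> cf fg oD Dx; change (g @ x --> g x); rewrite -(fg _ Dx).
apply: cvg_trans cf; apply: near_eq_cvg; exact: near_open oD Dx fg.
Qed.

Lemma Ck_ext n D f g : open D -> (forall x, D x -> f x = g x) ->
  Ck n D f -> Ck n D g.
Proof.
move=> oD; elim: n f g => [|n IH] f g fg [cf df]; split=> //.
- by move=> x Dx; exact: continuous_near_eq (cf x Dx) fg oD Dx.
- by move=> x Dx; exact: continuous_near_eq (cf x Dx) fg oD Dx.
move=> v; have [dv cv] := df v; split.
  move=> x Dx; apply: near_eq_derivable (dv x Dx).
  exact: (near_open oD Dx fg).
apply: IH cv => x Dx; apply: near_eq_derive; exact: near_open fg.
Qed.

Lemma Ck_cst n D (c : R) : Ck n D (fun _ : V => c).
Proof.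
elim: n c => [|n IH] c; split=> //.
- by move=> x _; exact: cst_continuous.
- by move=> x _; exact: cst_continuous.
move=> v; split=> [x _|]; first exact: derivable_cst.
have -> : (fun x : V => 'D_v (fun _ : V => c) x) = (fun _ => 0).
  by apply/funext => x; exact: derive_cst.
exact: IH.
Qed.

Lemma CkD n D f g : open D -> Ck n D f -> Ck n D g ->
  Ck n D (fun x => f x + g x).
Proof.
move=> oD; elim: n f g => [|n IH] f g [cf df] [cg dg]; split=> //.
- by move=> x Dx; apply: continuousD; [exact: cf|exact: cg].
- by move=> x Dx; apply: continuousD; [exact: cf|exact: cg].
move=> v; have [dfv cfv] := df v; have [dgv cgv] := dg v; split.
  by move=> x Dx; apply: derivableD; [exact: dfv|exact: dgv].
apply: (Ck_ext oD _ (IH _ _ cfv cgv)) => x Dx.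
by rewrite deriveD //; [exact: dfv|exact: dgv].
Qed.

Lemma CkM n D f g : open D -> Ck n D f -> Ck n D g ->
  Ck n D (fun x => f x * g x).
Proof.
move=> oD; elim: n f g => [|n IH] f g Cf Cg.
  by split=> // x Dx; apply: continuousM; [exact: CkW Cf Dx|exact: CkW Cg Dx].
split; first by move=> x Dx; apply: continuousM; [exact: CkW Cf Dx|exact: CkW Cg Dx].
move=> v; split.
  by move=> x Dx; apply: derivableM; [exact: Ck_derivable Cf Dx|exact: Ck_derivable Cg Dx].
have C1 := IH _ _ (CkS Cf) (Ck_derive v Cg).
have C2 := IH _ _ (CkS Cg) (Ck_derive v Cf).
apply: (Ck_ext oD _ (CkD oD C1 C2)) => x Dx.
rewrite (deriveM (f:=f) (g:=g)) //; [exact: Ck_derivable Cf Dx|exact: Ck_derivable Cg Dx].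
Qed.

Lemma CkN n D f : open D -> Ck n D f -> Ck n D (fun x => - f x).
Proof.
move=> oD Cf; apply: (Ck_ext oD _ (CkM oD (Ck_cst n D (-1)) Cf)) => x _.
by rewrite mulN1r.
Qed.

Lemma CkV n D f : open D -> (forall x, D x -> f x != 0) -> Ck n D f ->
  Ck n D (fun x => (f x)^-1).
Proof.
move=> oD f0; elim: n => [|n IH] Cf.
  by split=> // x Dx; apply: continuousV; [exact: f0|exact: CkW Cf Dx].
split; first by move=> x Dx; apply: continuousV; [exact: f0|exact: CkW Cf Dx].
move=> v; split.
  by move=> x Dx; apply: derivableV; [exact: f0|exact: Ck_derivable Cf Dx].
have CV := IH (CkS Cf).
have := CkM oD (CkN oD (CkM oD CV CV)) (Ck_derive v Cf).
apply: (Ck_ext oD) => x Dx.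
rewrite (deriveV (f0 x Dx)) ?exprVn ?expr2 ?invfM//; exact: Ck_derivable Cf Dx.
Qed.

Lemma derivable_mulf f g x v : derivable f x v -> derivable g x v ->
  derivable (fun y => f y * g y) x v.
Proof. by move=> df dg; have := @derivableM _ _ f g x v df dg. Qed.

Lemma derivable_oppf f x v : derivable f x v -> derivable (fun y => - f y) x v.
Proof. by move=> df; have := @derivableN _ _ _ f x v df. Qed.

Lemma derive_addf f g x v : derivable f x v -> derivable g x v ->
  'D_v (fun y => f y + g y) x = 'D_v f x + 'D_v g x.
Proof. by move=> df dg; have := @deriveD _ _ _ f g x v df dg. Qed.

Lemma derive_oppf f x v : derivable f x v ->
  'D_v (fun y => - f y) x = - 'D_v f x.
Proof. by move=> df; have := @deriveN _ _ _ f x v df. Qed.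

Lemma derive_mulf f g x v : derivable f x v -> derivable g x v ->
  'D_v (fun y => f y * g y) x = f x * 'D_v g x + g x * 'D_v f x.
Proof. by move=> df dg; have := @deriveM _ _ f g x v df dg. Qed.

End CkCalculus.

(** * Smooth complex functions and their directional derivatives *)

Section Smooth.
Variables (R : realType) (V : normedModType R).
Local Notation C := R[i].
Implicit Types (D : set V) (f g : V -> C).

Definition cderive (v : V) f (x : V) : C :=
  ('D_v (fun y => Re (f y) : R) x) +i* ('D_v (fun y => Im (f y) : R) x).

Lemma complex_ReIm_eq (a b : C) : Re a = Re b -> Im a = Im b -> a = b.
Proof. by case: a b => [a1 a2] [b1 b2] /= -> ->. Qed.

Lemma Re_mulc (a b : C) : Re (a * b) = Re a * Re b - Im a * Im b.
Proof. by case: a b => [a1 a2] [b1 b2]. Qed.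

Lemma Im_mulc (a b : C) : Im (a * b) = Re a * Im b + Im a * Re b.
Proof. by case: a b => [a1 a2] [b1 b2]. Qed.

Lemma Re_addc (a b : C) : Re (a + b) = Re a + Re b.
Proof. by case: a b => [a1 a2] [b1 b2]. Qed.

Lemma Im_addc (a b : C) : Im (a + b) = Im a + Im b.
Proof. by case: a b => [a1 a2] [b1 b2]. Qed.

Lemma Reconj (a : C) : Re (conjc a) = Re a.
Proof. by case: a. Qed.

Lemma Imconj (a : C) : Im (conjc a) = - Im a.
Proof. by case: a. Qed.

Lemma smooth_sub D D' f : D' `<=` D -> smooth D f -> smooth D' f.
Proof. by move=> sD sf n; have [? ?] := sf n; split; exact: Ck_sub sD _. Qed.

Lemma smooth_ext D f g : open D -> (forall x, D x -> f x = g x) ->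
  smooth D f -> smooth D g.
Proof.
move=> oD fg sf n; have [C1 C2] := sf n.
by split; [apply: (Ck_ext oD _ C1)|apply: (Ck_ext oD _ C2)] => x Dx; rewrite fg.
Qed.

Lemma smooth_cst D (c : C) : smooth D (fun _ => c).
Proof. by move=> n; split; exact: Ck_cst. Qed.

Lemma smoothD D f g : open D -> smooth D f -> smooth D g ->
  smooth D (fun x => f x + g x).
Proof.
move=> oD sf sg n; have [? ?] := sf n; have [? ?] := sg n; split.
  rewrite (_ : (fun x => _) = (fun x => Re (f x) + Re (g x) : R)).
    exact: CkD.
  by apply/funext => x; rewrite Re_addc.
rewrite (_ : (fun x => _) = (fun x => Im (f x) + Im (g x) : R)).
  exact: CkD.
by apply/funext => x; rewrite Im_addc.
Qed.

Lemma smoothM D f g : open D -> smooth D f -> smooth D g ->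
  smooth D (fun x => f x * g x).
Proof.
move=> oD sf sg n; have [? ?] := sf n; have [? ?] := sg n; split.
  rewrite (_ : (fun x => _) = (fun x => Re (f x) * Re (g x) + - (Im (f x) * Im (g x)) : R)).
    by apply: (CkD oD); [exact: CkM|apply: CkN => //; exact: CkM].
  by apply/funext => x; rewrite Re_mulc.
rewrite (_ : (fun x => _) = (fun x => Re (f x) * Im (g x) + Im (f x) * Re (g x) : R)).
  by apply: (CkD oD); exact: CkM.
by apply/funext => x; rewrite Im_mulc.
Qed.

Lemma smoothN D f : open D -> smooth D f -> smooth D (fun x => - f x).
Proof.
move=> oD sf; have := smoothM oD (smooth_cst D (-1)) sf.
by apply: smooth_ext => // x _; rewrite mulN1r.
Qed.

Lemma smooth_conj D f : open D -> smooth D f -> smooth D (fun x => conjc (f x)).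
Proof.
move=> oD sf n; have [C1 C2] := sf n; split.
  by apply: (Ck_ext oD _ C1) => x _; rewrite Reconj.
by apply: (Ck_ext oD _ (CkN oD C2)) => x _; rewrite Imconj.
Qed.

Lemma complexV (a : C) : a^-1 =
  (Re a / (Re a ^+ 2 + Im a ^+ 2)) +i* (- Im a / (Re a ^+ 2 + Im a ^+ 2)).
Proof.
case: a => x y; rewrite /GRing.inv /=.
by apply: complex_ReIm_eq => //=; rewrite mulNr.
Qed.

Lemma complex_sqr_neq0 (a : C) : a != 0 -> Re a ^+ 2 + Im a ^+ 2 != 0.
Proof.
case: a => x y /=; apply: contra => /eqP; move/eqP; rewrite paddr_eq0 ?sqr_ge0//.
by rewrite !sqrf_eq0 => /andP[/eqP-> /eqP->].
Qed.

Lemma smoothV D f : open D -> (forall x, D x -> f x != 0) -> smooth D f ->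
  smooth D (fun x => (f x)^-1).
Proof.
move=> oD f0 sf n; have [C1 C2] := sf n.
have C3 : Ck n D (fun x => (Re (f x) * Re (f x) + Im (f x) * Im (f x))^-1).
  apply: (CkV oD); first by move=> x /f0 /complex_sqr_neq0; rewrite !expr2.
  by apply: (CkD oD); exact: CkM.
split.
  by apply: (Ck_ext oD _ (CkM oD C1 C3)) => x _; rewrite complexV /= !expr2.
by apply: (Ck_ext oD _ (CkM oD (CkN oD C2) C3)) => x _; rewrite complexV /= !expr2.
Qed.

Lemma smooth_derivable_Re D f x v : smooth D f -> D x ->
  derivable (fun y => Re (f y) : R) x v.
Proof. by move=> /(_ 1%N)[C1 _]; exact: Ck_derivable C1. Qed.

Lemma smooth_derivable_Im D f x v : smooth D f -> D x ->
  derivable (fun y => Im (f y) : R) x v.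
Proof. by move=> /(_ 1%N)[_ C1]; exact: Ck_derivable C1. Qed.

Lemma smooth_cderive D f v : smooth D f -> smooth D (cderive v f).
Proof. by move=> sf n; have [C1 C2] := sf n.+1; split; exact: Ck_derive. Qed.

Lemma cderive_ext D f g v x : open D -> (forall y, D y -> f y = g y) -> D x ->
  cderive v f x = cderive v g x.
Proof.
move=> oD fg Dx; congr (_ +i* _); apply: near_eq_derive;
  by apply: near_open oD Dx _ => y Dy; rewrite fg.
Qed.

Lemma cderive_cst v (c : C) x : cderive v (fun _ => c) x = 0.
Proof. by rewrite /cderive !derive_cst. Qed.

Lemma cderiveD D f g v x : smooth D f -> smooth D g -> D x ->
  cderive v (fun y => f y + g y) x = cderive v f x + cderive v g x.
Proof.
move=> sf sg Dx; rewrite /cderive.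
have -> : (fun y => Re (f y + g y) : R) = (fun y => Re (f y) + Re (g y)).
  by apply/funext => y; rewrite Re_addc.
have -> : (fun y => Im (f y + g y) : R) = (fun y => Im (f y) + Im (g y)).
  by apply/funext => y; rewrite Im_addc.
rewrite (derive_addf (smooth_derivable_Re (v := v) sf Dx) (smooth_derivable_Re (v := v) sg Dx)).
by rewrite (derive_addf (smooth_derivable_Im (v := v) sf Dx) (smooth_derivable_Im (v := v) sg Dx)).
Qed.

Lemma cderiveM D f g v x : smooth D f -> smooth D g -> D x ->
  cderive v (fun y => f y * g y) x = cderive v f x * g x + f x * cderive v g x.
Proof.
move=> sf sg Dx; rewrite /cderive.
have dfR := smooth_derivable_Re (v := v) sf Dx.
have dfI := smooth_derivable_Im (v := v) sf Dx.
have dgR := smooth_derivable_Re (v := v) sg Dx.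
have dgI := smooth_derivable_Im (v := v) sg Dx.
have -> : (fun y => Re (f y * g y) : R) =
    (fun y => Re (f y) * Re (g y) + - (Im (f y) * Im (g y))).
  by apply/funext => y; rewrite Re_mulc.
have -> : (fun y => Im (f y * g y) : R) =
    (fun y => Re (f y) * Im (g y) + Im (f y) * Re (g y)).
  by apply/funext => y; rewrite Im_mulc.
rewrite (derive_addf (derivable_mulf dfR dgR) (derivable_oppf (derivable_mulf dfI dgI))).
rewrite (derive_addf (derivable_mulf dfR dgI) (derivable_mulf dfI dgR)).
rewrite (derive_oppf (derivable_mulf dfI dgI)).
rewrite (derive_mulf dfR dgR) (derive_mulf dfI dgI).
rewrite (derive_mulf dfR dgI) (derive_mulf dfI dgR).
by apply: complex_ReIm_eq; rewrite ?Re_addc ?Im_addc ?Re_mulc ?Im_mulc /=; ring.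
Qed.

Lemma cderive_conj D f v x : smooth D f -> D x ->
  cderive v (fun y => conjc (f y)) x = conjc (cderive v f x).
Proof.
move=> sf Dx; rewrite /cderive.
have -> : (fun y => Re (conjc (f y)) : R) = (fun y => Re (f y)).
  by apply/funext => y; rewrite Reconj.
have -> : (fun y => Im (conjc (f y)) : R) = (fun y => - Im (f y)).
  by apply/funext => y; rewrite Imconj.
by rewrite (derive_oppf (smooth_derivable_Im (v := v) sf Dx)).
Qed.

End Smooth.

(** * Mean values: symmetry of second derivatives, second derivative at a maximum *)

Section MeanValue.
Variables (R : realType) (V : normedModType R).
Implicit Types (D : set V) (f g : V -> R).

Lemma derive_line_growth f (x v : V) (s : R) :
  (fun h : R => h^-1 *: ((((fun s => f (x + s *: v)) \o shift s) (h *: 1)) -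
     f (x + s *: v)) : R) =
  (fun h => h^-1 *: ((f \o shift (x + s *: v)) (h *: v) - f (x + s *: v)) : R).
Proof.
apply/funext => h /=; congr (_ *: (f _ - _)).
by rewrite [h *: 1]mulr1 scalerDl addrCA.
Qed.

Lemma is_derive_line f (x v : V) (s : R) : derivable f (x + s *: v) v ->
  is_derive s 1 (fun s => f (x + s *: v)) ('D_v f (x + s *: v)).
Proof.
move=> df; split; rewrite /derivable /derive derive_line_growth //.
Qed.

Lemma MVT_line f (x v : V) (a b : R) : a < b ->
  (forall s, a <= s <= b -> derivable f (x + s *: v) v) ->
  exists2 c, a < c < b &
    f (x + b *: v) - f (x + a *: v) = 'D_v f (x + c *: v) * (b - a).
Proof.
move=> ab df.
have dg s : s \in `]a, b[ -> is_derive s 1 (fun s => f (x + s *: v))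
    ('D_v f (x + s *: v)).
  rewrite in_itv /= => /andP[/ltW s1 /ltW s2].
  by apply/is_derive_line/df; rewrite s1.
have cg : {within `[a, b], continuous (fun s => f (x + s *: v))}.
  apply: derivable_within_continuous => s; rewrite in_itv /= => hs.
  by have [] := is_derive_line (df s hs).
have [c] := MVT ab dg cg.
by move=> hc e; exists c => //; move: hc; rewrite in_itv.
Qed.

Lemma near_parallelogram (P : V -> Prop) (x v w : V) : (\forall y \near x, P y) ->
  exists2 r : R, 0 < r &
    forall s u, `|s| < r -> `|u| < r -> P (x + s *: v + u *: w).
Proof.
move=> /nbhs_ballP[e /= e0 eP].
(* The added 1 keeps the denominator positive when [v] and [w] both vanish. *)
exists (e / (`|v| + `|w| + 1)); first by rewrite divr_gt0// ltr_wpDl// addr_ge0.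
have n0 : 0 < `|v| + `|w| + 1 by rewrite ltr_wpDl// addr_ge0.
move=> s u; rewrite !ltr_pdivlMr// => hs hu; apply: eP.
rewrite -ball_normE /= -addrA opprD addrA subrr sub0r normrN.
apply: (le_lt_trans (ler_normD _ _)); rewrite !normrZ.
have v0 := normr_ge0 v; have w0 := normr_ge0 w.
have s0 := normr_ge0 s; have u0 := normr_ge0 u.
have [su|us] := lerP `|s| `|u|.
  apply: le_lt_trans hu; rewrite !mulrDr mulr1.
  by have := ler_wpM2r v0 su; lra.
apply: le_lt_trans hs; rewrite !mulrDr mulr1.
by have := ler_wpM2r w0 (ltW us); lra.
Qed.

(** The mean value theorem is used twice: in the direction [v], for the difference of [f] along two
    parallel segments, and then in the direction [w], for ['D_v f]. *)
Lemma second_difference D f (x v w : V) (h : R) : Ck 2 D f -> 0 < h ->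
  (forall s u, 0 <= s <= h -> 0 <= u <= h -> D (x + s *: v + u *: w)) ->
  exists s u, [/\ 0 < s < h, 0 < u < h &
    f (x + h *: v + h *: w) - f (x + h *: v) - (f (x + h *: w) - f x) =
    'D_w (fun y => 'D_v f y) (x + s *: v + u *: w) * h * h].
Proof.
move=> Cf h0 hD.
have h0' : 0 <= (0:R) <= h by rewrite lexx ltW.
have hh : 0 <= h <= h by rewrite lexx ltW.
have dfh s : 0 <= s <= h -> derivable f (x + h *: w + s *: v) v.
  by move=> hs; apply: (Ck_derivable Cf); rewrite addrAC; exact: hD.
have df0 s : 0 <= s <= h -> derivable f (x + s *: v) v.
  move=> hs; apply: (Ck_derivable Cf).
  by have := hD s 0 hs h0'; rewrite scale0r addr0.
pose F := (fun s : R => f (x + h *: w + s *: v) - f (x + s *: v)).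
have dF s : 0 <= s <= h -> is_derive s 1 F
    ('D_v f (x + h *: w + s *: v) - 'D_v f (x + s *: v)).
  by move=> hs; apply: is_deriveB; apply: is_derive_line; [exact: dfh|exact: df0].
have dF' s : s \in `]0, h[ -> is_derive s 1 F
    ('D_v f (x + h *: w + s *: v) - 'D_v f (x + s *: v)).
  by rewrite in_itv /= => /andP[/ltW s1 /ltW s2]; apply: dF; rewrite s1.
have cF : {within `[0, h], continuous F}.
  apply: derivable_within_continuous => s; rewrite in_itv /= => hs.
  by have [] := dF s hs.
have [s] := MVT h0 dF' cF.
rewrite in_itv /= => /andP[s0 sh]; rewrite subr0 => eF.
have hs : 0 <= s <= h by rewrite !ltW.
have [u hu eu] := @MVT_line (fun y => 'D_v f y) (x + s *: v) w 0 h h0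
  (fun u hu => Ck_derivable (Ck_derive v Cf) (hD s u hs hu)).
exists s, u; split=> //; first by rewrite s0.
have -> : f (x + h *: v + h *: w) - f (x + h *: v) - (f (x + h *: w) - f x) = F h - F 0.
  by rewrite /F !scale0r !addr0 [x + h *: w + _]addrAC.
rewrite eF; congr (_ * _).
by move: eu; rewrite scale0r addr0 subr0 [x + h *: w + _]addrAC.
Qed.

Lemma exists_between (a b : R) : a < b -> exists2 c, a < c & c < b.
Proof. by move=> ab; exists ((a + b) / 2); lra. Qed.

Lemma difference_swap (a b c d : R) : a - b - (c - d) = a - c - (b - d).
Proof. by ring. Qed.

(** The second difference over a small parallelogram is h^2 times a value of either mixed
    derivative, according to the order of the two directions. If the derivatives differed at [x], a
    number [c] would separate all their values near [x], so the two expressions could not agree. *)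
Lemma derive_comm_nlt D f (x v w : V) : open D -> D x -> Ck 2 D f ->
  ~ 'D_w (fun y => 'D_v f y) x < 'D_v (fun y => 'D_w f y) x.
Proof.
move=> oD Dx Cf lt.
have [c lc rc] := exists_between lt.
have C1 := CkW (Ck_derive w (Ck_derive v Cf)) Dx.
have C2 := CkW (Ck_derive v (Ck_derive w Cf)) Dx.
have n1 : \forall y \near x, 'D_w (fun y => 'D_v f y) y < c by exact: cvgr_lt C1 _ lc.
have n2 : \forall y \near x, c < 'D_v (fun y => 'D_w f y) y by exact: cvgr_gt C2 _ rc.
have n3 : \forall y \near x, D y by exact: open_nbhs_nbhs.
have nP : \forall y \near x, [/\ 'D_w (fun y => 'D_v f y) y < c,
   c < 'D_v (fun y => 'D_w f y) y & D y].
  by apply: filterS3 n1 n2 n3.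
have [r r0 hr] := near_parallelogram v w nP.
have [h h0 hr2] := exists_between r0.
have lth s : 0 <= s <= h -> `|s| < r.
  by move=> /andP[s0 sr]; rewrite ger0_norm// (le_lt_trans sr).
have DD s u : 0 <= s <= h -> 0 <= u <= h -> D (x + s *: v + u *: w).
  by move=> /lth hs /lth hu; have [] := hr s u hs hu.
have [s [u [hs hu e1]]] := second_difference Cf h0 DD.
have DD' s0 u0 : 0 <= s0 <= h -> 0 <= u0 <= h -> D (x + s0 *: w + u0 *: v).
  by move=> ? ?; rewrite addrAC; exact: DD.
have [s' [u' [hs' hu' e2]]] := second_difference Cf h0 DD'.
have lW (z : R) : 0 < z < h -> 0 <= z <= h by move=> /andP[/ltW-> /ltW->].
have [l1 _ _] := hr s u (lth _ (lW _ hs)) (lth _ (lW _ hu)).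
have [_ l2 _] := hr u' s' (lth _ (lW _ hu')) (lth _ (lW _ hs')).
have : 'D_w (fun y => 'D_v f y) (x + s *: v + u *: w) * h * h =
       'D_v (fun y => 'D_w f y) (x + s' *: w + u' *: v) * h * h.
  transitivity (f (x + h *: v + h *: w) - f (x + h *: v) - (f (x + h *: w) - f x)).
    exact: esym e1.
  transitivity (f (x + h *: w + h *: v) - f (x + h *: w) - (f (x + h *: v) - f x)).
    have -> : x + h *: w + h *: v = x + h *: v + h *: w by exact: addrAC.
    exact: difference_swap.
  exact: e2.
move=> /(mulIf (lt0r_neq0 h0)) /(mulIf (lt0r_neq0 h0)) e.
by move: l1; rewrite e addrAC => /(lt_trans l2); rewrite ltxx.
Qed.

Lemma not_lt_eq (a b : R) : ~ a < b -> ~ b < a -> a = b.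
Proof. by case: (ltgtP a b) => // _ ? ?. Qed.

Lemma derive_comm D f (x v w : V) : open D -> D x -> Ck 2 D f ->
  'D_w (fun y => 'D_v f y) x = 'D_v (fun y => 'D_w f y) x.
Proof.
move=> oD Dx Cf; exact (not_lt_eq (@derive_comm_nlt D f x v w oD Dx Cf)
  (@derive_comm_nlt D f x w v oD Dx Cf)).
Qed.

Lemma near_line (P : V -> Prop) (x v : V) : (\forall y \near x, P y) ->
  exists2 r : R, 0 < r & forall s, `|s| < r -> P (x + s *: v).
Proof.
move=> nP; have [r r0 hr] := near_parallelogram v 0 nP; exists r => // s hs.
by have := hr s s hs hs; rewrite scaler0 addr0.
Qed.

(** If it were positive, ['D_v f] would increase strictly along the line near [x]. But mean values
    on the two sides of a maximum give a slope >= 0 at some [s2 < 0] and a slope <= 0 at some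
    [s1 > 0]. *)
Lemma second_derivative_le0 D f (x v : V) : open D -> D x -> Ck 2 D f ->
  (\forall y \near x, f y <= f x) -> 'D_v (fun y => 'D_v f y) x <= 0.
Proof.
move=> oD Dx Cf nf; rewrite leNgt; apply/negP => gt0.
have C1 := CkW (Ck_derive v (Ck_derive v Cf)) Dx.
have n1 : \forall y \near x, 0 < 'D_v (fun y => 'D_v f y) y by exact: cvgr_gt C1 _ gt0.
have n3 : \forall y \near x, D y by exact: open_nbhs_nbhs.
have nP : \forall y \near x, [/\ 0 < 'D_v (fun y => 'D_v f y) y, D y & f y <= f x].
  by apply: filterS3 n1 n3 nf.
have [r r0 hr] := near_line v nP.
have [h h0 hr2] := exists_between r0.
have hN : - h < 0 by rewrite oppr_lt0.
have lth s : - h <= s <= h -> `|s| < r by rewrite -ler_norml => /le_lt_trans; apply.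
have itv1 s : 0 <= s <= h -> - h <= s <= h.
  by move=> /andP[s0 ->]; rewrite (le_trans (ltW hN) s0).
have itv2 s : - h <= s <= 0 -> - h <= s <= h.
  by move=> /andP[-> s0]; rewrite (le_trans s0 (ltW h0)).
have df s : - h <= s <= h -> derivable f (x + s *: v) v.
  by move=> /lth/hr[_ Ds _]; exact: (Ck_derivable Cf).
have df' s : - h <= s <= h -> derivable (fun y => 'D_v f y) (x + s *: v) v.
  by move=> /lth/hr[_ Ds _]; exact: (Ck_derivable (Ck_derive v Cf)).
have hh : - h <= h <= h by rewrite lexx andbT (le_trans (ltW hN) (ltW h0)).
have Nhh : - h <= - h <= h by rewrite lexx (le_trans (ltW hN) (ltW h0)).
have [s1 /andP[s10 s1h] e1] := MVT_line h0 (fun s hs => df s (itv1 s hs)).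
have [s2 /andP[s20 s2h] e2] := MVT_line hN (fun s hs => df s (itv2 s hs)).
have s21 : s2 < s1 by exact: lt_trans s2h s10.
have itv3 s : s2 <= s <= s1 -> - h <= s <= h.
  by move=> /andP[a b]; rewrite (le_trans (ltW s20) a) (le_trans b (ltW s1h)).
have [s3 /andP[s30 s3h] e3] := MVT_line s21 (fun s hs => df' s (itv3 s hs)).
have s3i : s2 <= s3 <= s1 by rewrite !ltW.
have [p3 _ _] := hr _ (lth _ (itv3 _ s3i)).
have [_ _ l1] := hr _ (lth _ hh).
have [_ _ l2] := hr _ (lth _ Nhh).
rewrite scale0r addr0 in e1 e2.
have q1 : 'D_v f (x + s1 *: v) * (h - 0) <= 0 by rewrite -e1 subr_le0.
have q2 : 0 <= 'D_v f (x + s2 *: v) * (0 - - h) by rewrite -e2 subr_ge0.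
rewrite subr0 (pmulr_lle0 _ h0) in q1.
rewrite sub0r opprK (pmulr_lge0 _ h0) in q2.
have s12 : 0 < s1 - s2 by rewrite subr_gt0.
have := mulr_gt0 p3 s12; rewrite -e3 subr_gt0 => /(le_lt_trans q2) /lt_le_trans /(_ q1).
by rewrite ltxx.
Qed.

End MeanValue.

Section CDeriveComm.
Variables (R : realType) (V : normedModType R).

Lemma cderive_comm (D : set V) (f : V -> R[i]) (x v w : V) : open D -> D x ->
  smooth D f -> cderive w (cderive v f) x = cderive v (cderive w f) x.
Proof.
move=> oD Dx sf; have [C1 C2] := sf 2%N.
exact (f_equal2 (@Complex R) (derive_comm v w oD Dx C1) (derive_comm v w oD Dx C2)).
Qed.

End CDeriveComm.

(** * A quadratic barrier for Hopf's boundary argument in the plane *)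

Section Barrier.
Variable R : realType.
Local Notation plane2 := (R * R)%type.
Implicit Types (D : set plane2) (p q z : plane2).

Definition sqdist p z : R := (z.1 - p.1) ^+ 2 + (z.2 - p.2) ^+ 2.

(* Its zero set touches the circle around [p + d] through [p] from the inside,
   and its Laplacian is 2. *)
Definition barrier p (d : plane2) z : R :=
  let l := d.1 * (z.1 - p.1) + d.2 * (z.2 - p.2) in
  l + 3 / (d.1 ^+ 2 + d.2 ^+ 2) * l ^+ 2 - sqdist p z.

Lemma sqdist_ge0 p z : 0 <= sqdist p z.
Proof. by rewrite /sqdist addr_ge0 ?sqr_ge0. Qed.

Lemma sqdist_eq0 p z : sqdist p z = 0 -> z = p.
Proof.
case: p z => [p1 p2] [z1 z2]; rewrite /sqdist /= => /eqP.
rewrite paddr_eq0 ?sqr_ge0// !sqrf_eq0 !subr_eq0 => /andP[/eqP-> /eqP->] //.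
Qed.

(** Write d = q - p, n = |d|^2, l = <d, z - p>, k = 3 l / n and s = |z - p|^2 > 0. The bound on
    [rho] gives |k| < 1, and a nonnegative barrier means s <= l (1 + k). Hence l > 0 and s < 2 l,
    while |z - q|^2 = s - 2 l + n. *)
Lemma barrier_ge0 p q z rho : z != p ->
  `|z.1 - p.1| <= rho -> `|z.2 - p.2| <= rho ->
  3 * (`|q.1 - p.1| + `|q.2 - p.2|) * rho < sqdist p q ->
  0 <= barrier p (q.1 - p.1, q.2 - p.2) z -> sqdist q z < sqdist q p.
Proof.
move=> zp; have s0 : 0 < sqdist p z.
  by rewrite lt0r sqdist_ge0 andbT; apply: contra zp => /eqP/sqdist_eq0->.
move: s0; rewrite /barrier /sqdist /=.
have -> : z.1 - q.1 = (z.1 - p.1) - (q.1 - p.1) by ring.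
have -> : z.2 - q.2 = (z.2 - p.2) - (q.2 - p.2) by ring.
have -> : p.1 - q.1 = - (q.1 - p.1) by ring.
have -> : p.2 - q.2 = - (q.2 - p.2) by ring.
move: (z.1 - p.1) (z.2 - p.2) (q.1 - p.1) (q.2 - p.2) => x y a b s0 hx hy hr.
have n0 : 0 < a ^+ 2 + b ^+ 2.
  apply: le_lt_trans hr; rewrite !mulr_ge0// ?addr_ge0//.
  exact: le_trans (normr_ge0 _) hx.
set n := a ^+ 2 + b ^+ 2 in hr n0 *.
set l := a * x + b * y.
have hl : 3 * `|l| < n.
  apply: le_lt_trans hr; rewrite -mulrA ler_pM2l// (le_trans (ler_normD _ _))//.
  by rewrite !normrM mulrDl lerD// ler_wpM2l.
have hk : `|3 / n * l| < 1.
  by rewrite normrM normf_div (gtr0_norm n0) mulrAC ltr_pdivrMr// mul1r (ger0_norm (ler0n _ _)).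
have -> : 3 / n * l ^+ 2 = l * (3 / n * l) by ring.
have e : (x - a) ^+ 2 + (y - b) ^+ 2 = (x ^+ 2 + y ^+ 2) - 2 * l + n by rewrite /l /n; ring.
have e' : (- a) ^+ 2 + (- b) ^+ 2 = n by rewrite /n; ring.
rewrite e e'; move: hk; move: (3 / n * l) => k; rewrite ltr_norml => /andP[k1 k2].
move: l {hl e} => l; move: (x ^+ 2 + y ^+ 2) s0 => s s0 h.
have l0 : 0 < l.
  have k3 : 0 < 1 + k by lra.
  rewrite -(pmulr_lgt0 _ k3); lra.
by have : 0 < l * (1 - k); [rewrite mulr_gt0//; lra|lra].
Qed.

Lemma barrier0 p d : barrier p d p = 0.
Proof. by rewrite /barrier /sqdist !subrr; ring. Qed.

Lemma is_derive_fst (W : normedModType R) (p v : R * W) :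
  is_derive p v (fun z : R * W => z.1) v.1.
Proof.
have e : \forall h \near 0^', h^-1 *: (((fst : R * W -> R) \o shift p) (h *: v) - p.1) = v.1.
  near=> h; rewrite /= addrK /GRing.scale /= mulKf//.
  by near: h; exact: nbhs_dnbhs_neq.
have c : (fun h => h^-1 *: (((fst : R * W -> R) \o shift p) (h *: v) - p.1)) @ 0^' --> v.1.
  exact: cvg_near_cst e.
by split; [apply/cvg_ex; exists v.1|exact: cvg_lim c].
Unshelve. all: by end_near. Qed.

Lemma is_derive_snd p (v : plane2) : is_derive p v (fun z : plane2 => z.2) v.2.
Proof.
have e : \forall h \near 0^', h^-1 *: (((snd : plane2 -> R) \o shift p) (h *: v) - p.2) = v.2.
  near=> h; rewrite /= addrK /GRing.scale /= mulKf//.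
  by near: h; exact: nbhs_dnbhs_neq.
have c : (fun h => h^-1 *: (((snd : plane2 -> R) \o shift p) (h *: v) - p.2)) @ 0^' --> v.2.
  exact: cvg_near_cst e.
by split; [apply/cvg_ex; exists v.2|exact: cvg_lim c].
Unshelve. all: by end_near. Qed.

Lemma Ck_fst (W : normedModType R) n (D : set (R * W)) : Ck n D (fun z : R * W => z.1).
Proof.
have cf x : {for x, continuous (fun z : R * W => z.1)} by exact: cvg_fst.
case: n => [|n]; first exact (conj (fun x _ => cf x) I).
split=> [x _|v]; first exact (cf x).
split=> [x _|]; first by have [] := is_derive_fst x v.
rewrite (_ : (fun x => _) = fun=> v.1); first exact: Ck_cst.
by apply/funext => x; have [_ ->] := is_derive_fst x v.
Qed.

Lemma Ck_snd n D : Ck n D (fun z : plane2 => z.2).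
Proof.
have cf x : {for x, continuous (fun z : plane2 => z.2)} by exact: cvg_snd.
case: n => [|n]; first exact (conj (fun x _ => cf x) I).
split=> [x _|v]; first exact (cf x).
split=> [x _|]; first by have [] := is_derive_snd x v.
rewrite (_ : (fun x => _) = fun=> v.2); first exact: Ck_cst.
by apply/funext => x; have [_ ->] := is_derive_snd x v.
Qed.

Lemma Ck_barrier n D p d : open D -> Ck n D (barrier p d).
Proof.
move=> oD; rewrite /barrier /sqdist.
have C1 := CkD oD (Ck_fst n D) (Ck_cst n D (- p.1)).
have C2 := CkD oD (Ck_snd n D) (Ck_cst n D (- p.2)).
have Cl := CkD oD (CkM oD (Ck_cst n D d.1) C1) (CkM oD (Ck_cst n D d.2) C2).
have Cs := CkD oD (CkM oD C1 C1) (CkM oD C2 C2).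
exact: CkD oD (CkD oD Cl (CkM oD (Ck_cst n D _) (CkM oD Cl Cl))) (CkN oD Cs).
Qed.

Lemma derive_barrier p d z (v : plane2) : 'D_v (barrier p d) z =
  (d.1 * v.1 + d.2 * v.2) + 3 / (d.1 ^+ 2 + d.2 ^+ 2) *
    (2 * (d.1 * (z.1 - p.1) + d.2 * (z.2 - p.2)) * (d.1 * v.1 + d.2 * v.2))
  - 2 * ((z.1 - p.1) * v.1 + (z.2 - p.2) * v.2).
Proof.
have d1 := is_derive_fst z v; have d2 := is_derive_snd z v.
have d3 := is_deriveB d1 (is_derive_cst p.1 z v).
have d4 := is_deriveB d2 (is_derive_cst p.2 z v).
have d5 := is_deriveD (is_deriveM (is_derive_cst d.1 z v) d3)
                      (is_deriveM (is_derive_cst d.2 z v) d4).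
have d6 := is_deriveM (is_derive_cst (3 / (d.1 ^+ 2 + d.2 ^+ 2)) z v) (is_deriveM d5 d5).
have d7 := is_deriveD (is_deriveM d3 d3) (is_deriveM d4 d4).
have [_ e] := is_deriveB (is_deriveD d5 d6) d7.
apply: (etrans e); rewrite !fctE /GRing.scale /=; ring.
Qed.

(** The square of the linear form contributes 2 * 3 = 6 and [- sqdist] contributes -4. The factor 3
    is the least integer that leaves a positive Laplacian. *)
Lemma laplacian_barrier p (d : plane2) z : 0 < d.1 ^+ 2 + d.2 ^+ 2 ->
  'D_(1, 0) (fun y => 'D_(1, 0) (barrier p d) y) z +
  'D_(0, 1) (fun y => 'D_(0, 1) (barrier p d) y) z = 2.
Proof.
move=> n0.
have dd (v : plane2) : 'D_v (fun y => 'D_v (barrier p d) y) z =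
   3 / (d.1 ^+ 2 + d.2 ^+ 2) * (2 * (d.1 * v.1 + d.2 * v.2) ^+ 2)
   - 2 * (v.1 ^+ 2 + v.2 ^+ 2).
  have -> : (fun y => 'D_v (barrier p d) y) = (fun z => (d.1 * v.1 + d.2 * v.2) + 3 / (d.1 ^+ 2 + d.2 ^+ 2) *
    (2 * (d.1 * (z.1 - p.1) + d.2 * (z.2 - p.2)) * (d.1 * v.1 + d.2 * v.2))
  - 2 * ((z.1 - p.1) * v.1 + (z.2 - p.2) * v.2)).
    by apply/funext => y; exact: derive_barrier.
  have d3 := is_deriveB (is_derive_fst z v) (is_derive_cst p.1 z v).
  have d4 := is_deriveB (is_derive_snd z v) (is_derive_cst p.2 z v).
  have d5 := is_deriveD (is_deriveM (is_derive_cst d.1 z v) d3)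
                        (is_deriveM (is_derive_cst d.2 z v) d4).
  have d6 := is_deriveM (is_derive_cst (3 / (d.1 ^+ 2 + d.2 ^+ 2)) z v)
    (is_deriveM (is_deriveM (is_derive_cst (2 : R) z v) d5) (is_derive_cst (d.1 * v.1 + d.2 * v.2) z v)).
  have d7 := is_deriveM (is_derive_cst (2 : R) z v) (is_deriveD
     (is_deriveM d3 (is_derive_cst v.1 z v)) (is_deriveM d4 (is_derive_cst v.2 z v))).
  have [_ e] := is_deriveB (is_deriveD (is_derive_cst (d.1 * v.1 + d.2 * v.2) z v) d6) d7.
  apply: (etrans e); rewrite !fctE /GRing.scale /=; ring.
rewrite !dd /=; field.
by rewrite lt0r_neq0.
Qed.

End Barrier.

(** * Hopf's boundary argument on a small box *)

Section StrongMaximum.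
Variable R : realType.
Local Notation plane2 := (R * R)%type.
Implicit Types (D : set plane2) (p q z : plane2) (u : plane2 -> R).

Definition box p (r : R) : set plane2 :=
  [set z | `|z.1 - p.1| <= r /\ `|z.2 - p.2| <= r].

Definition open_box p (r : R) : set plane2 :=
  [set z | `|z.1 - p.1| < r /\ `|z.2 - p.2| < r].

Lemma open_boxE p r : open_box p r = ball p r.
Proof.
apply/seteqP; split=> z /= [h1 h2]; split.
- by rewrite /ball /= distrC.
- by rewrite /ball /= distrC.
- by rewrite distrC.
- by rewrite distrC.
Qed.

Lemma near_open_box (P : plane2 -> Prop) p : (\forall z \near p, P z) ->
  exists2 r : R, 0 < r & forall z, open_box p r z -> P z.
Proof.
move=> /nbhs_ballP[e /= e0 eP]; exists e => // z; rewrite open_boxE; exact: eP.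
Qed.

Lemma nbhs_open_box p z r : open_box p r z -> \forall y \near z, open_box p r y.
Proof.
rewrite open_boxE => pz; apply: open_nbhs_nbhs; split=> //.
by apply: ball_open; exact: le_lt_trans (normr_ge0 _) (proj1 pz).
Qed.

Lemma compact_box p r : compact (box p r).
Proof.
have -> : box p r = `[p.1 - r, p.1 + r] `*` `[p.2 - r, p.2 + r].
  by apply/seteqP; split=> z; rewrite /box /= !in_itv /= !ler_distl.
by apply: compact_setX; exact: segment_compact.
Qed.

(** Suppose [u < M] inside the disc around [q] through [p], near [p]. On the boundary of the box
    either the barrier is negative or the point lies in the disc, so [u + e * v] stays below [M]
    there for small [e]. It equals [M] at [p], so its maximum is interior; there its Laplacian is <=
    0, yet it is at least 2 e. *)
Lemma hopf_contradiction D u (M rho : R) p q : open D -> Ck 2 D u ->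
  (forall z, D z -> 0 <= 'D_(1, 0) (fun y => 'D_(1, 0) u y) z +
                         'D_(0, 1) (fun y => 'D_(0, 1) u y) z) ->
  (forall z, D z -> u z <= M) -> u p = M ->
  0 < rho -> box p rho `<=` D -> p != q ->
  3 * (`|q.1 - p.1| + `|q.2 - p.2|) * rho < sqdist p q ->
  ~ (forall z, box p rho z -> sqdist q z < sqdist q p -> u z < M).
Proof.
move=> oD Cu Lu uM upM rho0 bD pq hrho hin.
pose v := barrier p (q.1 - p.1, q.2 - p.2).
have Cv n D' : open D' -> Ck n D' v by exact: Ck_barrier.
have bp r : 0 <= r -> box p r p by move=> r0; rewrite /box /= !subrr normr0.
pose S := box p rho `&` ~` open_box p rho.
have cS : compact S.
  by apply: compact_closedI (@compact_box _ _) _; apply: open_closedC;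
     rewrite open_boxE; exact: ball_open.
have S0 : S !=set0.
  have e1 : `|p.1 + rho - p.1| = rho by rewrite addrAC subrr add0r gtr0_norm.
  exists (p.1 + rho, p.2); split; first by split; rewrite /= ?e1// subrr normr0 ltW.
  by move=> [] /=; rewrite e1 ltxx.
(* At each boundary point one of [v] and [u - M] is negative. Compactness, applied to their minimum,
   makes this uniform: one of them is at most [- k]. *)
pose m := (v : plane2 -> R^o) \min (fun z => u z - M).
have cm : {within S, continuous m}.
  apply: continuous_in_subspaceT => z; rewrite inE => -[/bD Dz _].
  apply: continuous_min.
    exact: (CkW (Cv 0%N _ oD) Dz).
  exact: (CkW (CkD oD Cu (Ck_cst 2 D (- M))) Dz).
have [s /[!inE] Ss ms] := compact_EVT_max S0 cS cm.
have Sneg z : S z -> v z < 0 \/ u z < M.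
  move=> [bz nz]; have [vz|vz] := ltP (v z) 0; [by left|right; apply: hin => //].
  apply: (barrier_ge0 _ (proj1 bz) (proj2 bz) hrho vz).
  apply/eqP => zp; apply: nz; rewrite zp /open_box /= !subrr normr0; split=> //.
have [k k0 hk] : exists2 k, 0 < k & forall z, S z -> v z <= - k \/ u z <= M - k.
  exists (- m s).
    rewrite oppr_gt0 gt_min; apply/orP.
    by case: (Sneg s Ss) => h; [left; exact: h|right; rewrite subr_lt0].
  move=> z Sz; have := ms z; rewrite inE => /(_ Sz); rewrite opprK {1}/m ge_min.
  by move=> /orP[h|h]; [left; exact: h|right; rewrite addrC -lerBlDr; exact: h].
have cv : {within box p rho, continuous v}.
  apply: continuous_in_subspaceT => z _.
  by exact: (CkW (Cv 0%N _ openT) I).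
have b0 : box p rho !=set0 by exists p; apply: bp; exact: ltW.
have [t /[!inE] bt vt] := compact_EVT_max b0 (@compact_box p rho) cv.
have vt0 : 0 <= v t by rewrite -(barrier0 p (q.1 - p.1, q.2 - p.2)) vt// inE; apply: bp; exact: ltW.
(* [e] times the largest value of the barrier on the box stays below the gap [k]. *)
have [e e0 et] : exists2 e : R, 0 < e & e * v t < k.
  have vt1 : 0 < v t + 1 by rewrite ltr_wpDl.
  exists (k / (v t + 1)); first exact: divr_gt0 k0 vt1.
  by rewrite mulrAC ltr_pdivrMr// ltr_pM2l// ltrDl.
pose w z := u z + e * v z.
have Cw : Ck 2 D w by apply: (CkD oD Cu); apply: (CkM oD (Ck_cst 2 D e)); exact: Cv.
have cw : {within box p rho, continuous w}.
  by apply: continuous_in_subspaceT => z; rewrite inE => /bD Dz; exact: (CkW Cw Dz).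
have [x /[!inE] bx wx] := compact_EVT_max b0 (@compact_box p rho) cw.
have wMx : M <= w x.
  have := wx p; rewrite inE => /(_ (bp _ (ltW rho0))).
  by rewrite {1}/w upM /v barrier0 mulr0 addr0.
have xin : open_box p rho x.
  apply: contrapT => nx; have := hk x (conj bx nx) => hx.
  have : w x < M; last by rewrite ltNge wMx.
  case: hx => hx.
    rewrite -[M]addr0 /w ler_ltD ?uM//; first exact: bD.
    by rewrite pmulr_rlt0// (le_lt_trans hx)// oppr_lt0.
  rewrite -[M](subrK k) /w ler_ltD//.
  apply: le_lt_trans et; rewrite ler_pM2l//; apply: vt; rewrite inE//.
have Dx := bD _ bx.
have nmax : \forall y \near x, w y <= w x.
  apply: filterS (nbhs_open_box xin) => y [y1 y2]; apply: wx.
  by rewrite inE; split; exact: ltW.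
have h1 : 'D_((1, 0) : plane2) (fun y => 'D_((1, 0) : plane2) w y) x <= 0.
  exact: (second_derivative_le0 _ oD Dx Cw nmax).
have h2 : 'D_((0, 1) : plane2) (fun y => 'D_((0, 1) : plane2) w y) x <= 0.
  exact: (second_derivative_le0 _ oD Dx Cw nmax).
have dw (a : plane2) z : D z -> 'D_a w z = 'D_a u z + e * 'D_a v z.
  move=> Dz; rewrite (derive_addf (f := u) (g := fun z => e * v z)).
  - congr (_ + _); rewrite (derive_mulf (f := fun=> e) (g := v)).
    + by rewrite derive_cst mulr0 addr0.
    + exact: derivable_cst.
    + exact: Ck_derivable (Cv 1%N _ oD) Dz.
  - exact: Ck_derivable Cu Dz.
  - exact: Ck_derivable (CkM oD (Ck_cst 1 D e) (Cv 1%N _ oD)) Dz.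
have ddw (a : plane2) : 'D_a (fun y => 'D_a w y) x =
    'D_a (fun y => 'D_a u y) x + e * 'D_a (fun y => 'D_a v y) x.
  rewrite (near_eq_derive (g := fun y => 'D_a u y + e * 'D_a v y)); last first.
    by apply: near_open oD Dx _ => y Dy; exact: dw.
  have C1 := Ck_derive a (Cv 2%N _ oD).
  rewrite (derive_addf (f := fun y => 'D_a u y) (g := fun y => e * 'D_a v y)).
  - congr (_ + _); rewrite (derive_mulf (f := fun=> e) (g := fun y => 'D_a v y)).
    + by rewrite derive_cst mulr0 addr0.
    + exact: derivable_cst.
    + exact: Ck_derivable C1 Dx.
  - exact: Ck_derivable (Ck_derive a Cu) Dx.
  - exact: Ck_derivable (CkM oD (Ck_cst 1 D e) C1) Dx.
rewrite ddw in h1; rewrite ddw in h2.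
have := laplacian_barrier p x (_ : 0 < (q.1 - p.1, q.2 - p.2).1 ^+ 2 + (q.1 - p.1, q.2 - p.2).2 ^+ 2).
have n0 : 0 < (q.1 - p.1, q.2 - p.2).1 ^+ 2 + (q.1 - p.1, q.2 - p.2).2 ^+ 2.
  rewrite -/(sqdist p q) lt0r sqdist_ge0 andbT; apply: contra pq => /eqP/sqdist_eq0->//.
move=> /(_ n0); rewrite -/v.
have := Lu x Dx; move: h1 h2.
move: ('D__ _ x) ('D__ _ x) ('D__ _ x) ('D__ _ x) => a b c d h1 h2 h3 h4.
have := lerD h1 h2; rewrite addrACA -mulrDr h4 leNgt => /negP; apply.
rewrite addr0; exact: ltr_wpDl h3 (mulr_gt0 e0 (ltr0n R 2)).
Qed.

End StrongMaximum.

(** * The strong maximum principle for subharmonic functions in the plane *)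

Section StrongMaximumPrinciple.
Variable R : realType.
Local Notation plane2 := (R * R)%type.
Implicit Types (D : set plane2) (p q z : plane2) (u : plane2 -> R).

Lemma normr_lt_sqr (a b : R) : 0 < b -> a ^+ 2 < b ^+ 2 -> `|a| < b.
Proof.
move=> b0; rewrite -[a ^+ 2]real_normK ?num_real// ltr_pXn2r// nnegrE ?ltW//.
Qed.

Lemma sqdist_open_box q z r : 0 < r -> sqdist q z < 2 * r ^+ 2 ->
  open_box q (2 * r) z.
Proof.
move=> r0; rewrite /sqdist => h.
have r2 : 0 < 2 * r by rewrite mulr_gt0.
have r22 : 0 < r ^+ 2 by rewrite exprn_gt0.
have a0 := sqr_ge0 (z.1 - q.1); have b0 := sqr_ge0 (z.2 - q.2).
split; apply: normr_lt_sqr r2 _.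
  rewrite (_ : (2 * r) ^+ 2 = 4 * r ^+ 2); last by ring.
  lra.
rewrite (_ : (2 * r) ^+ 2 = 4 * r ^+ 2); last by ring.
lra.
Qed.

Lemma open_box_sqdist p q r : open_box p r q -> sqdist q p < 2 * r ^+ 2.
Proof.
move=> [h1 h2]; rewrite /sqdist.
have r0 : 0 < r by exact: le_lt_trans (normr_ge0 _) h1.
have sq (a : R) : `|a| < r -> a ^+ 2 < r ^+ 2.
  by move=> ha; rewrite -[a ^+ 2]real_normK ?num_real// ltr_pXn2r// nnegrE ltW.
have := sq _ h1; have := sq _ h2; rewrite -sqrrN opprB -[(q.1 - p.1) ^+ 2]sqrrN opprB.
lra.
Qed.

Lemma open_box_trans p q z (r s : R) : open_box p r q -> open_box q s z ->
  open_box p (r + s) z.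
Proof.
move=> [a1 a2] [b1 b2]; split.
  by rewrite (_ : z.1 - p.1 = (q.1 - p.1) + (z.1 - q.1)); [rewrite (le_lt_trans (ler_normD _ _))// ltrD|ring].
by rewrite (_ : z.2 - p.2 = (q.2 - p.2) + (z.2 - q.2)); [rewrite (le_lt_trans (ler_normD _ _))// ltrD|ring].
Qed.

Lemma small_radius (r n c : R) : 0 < r -> 0 < n -> 0 <= c ->
  exists2 rho, 0 < rho < r & c * rho < n.
Proof.
move=> r0 n0 c0; have c1 : 0 < c + 1 by rewrite ltr_wpDl.
exists (Num.min (r / 2) (n / (c + 1))).
  rewrite lt_min gt_min !divr_gt0//=; apply/orP; left; lra.
have m : Num.min (r / 2) (n / (c + 1)) <= n / (c + 1) by rewrite ge_min lexx orbT.
apply: le_lt_trans (ler_wpM2l c0 m) _.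
by rewrite mulrA ltr_pdivrMr// mulrC ltr_pM2l// ltrDl.
Qed.

Lemma open_lt_level (V : normedModType R) (D : set V) (u : V -> R) (M : R) n :
  open D -> Ck n D u -> open [set z | D z /\ u z < M].
Proof.
move=> oD Cu; rewrite openE => z [Dz uz].
have n1 : \forall y \near z, u y < M by exact: cvgr_lt (CkW Cu Dz) _ uz.
have n2 : \forall y \near z, D y by exact: open_nbhs_nbhs.
by apply: filterS2 n2 n1.
Qed.

(** If [u q < u p] for some [q] close to [p], let [z0] be a point nearest to [q] among those where
    the maximum is attained. The open disc around [q] through [z0] then contains no maximum point,
    which Hopf's argument at [z0] forbids. *)
Lemma strong_maximum D u p : open D -> D p -> Ck 2 D u ->
  (forall z, D z -> 0 <= 'D_((1, 0) : plane2) (fun y => 'D_((1, 0) : plane2) u y) z +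
                         'D_((0, 1) : plane2) (fun y => 'D_((0, 1) : plane2) u y) z) ->
  (forall z, D z -> u z <= u p) -> \forall z \near p, u z = u p.
Proof.
move=> oD Dp Cu Lu uM.
have [r0 r00 r0D] := near_open_box (open_nbhs_nbhs (conj oD Dp)).
(* Radii: [q] lies within [r] of [p]; points as close to [q] as [z0] have coordinates within [2 * r]
   of [q], hence within [3 * r] of [p]; the last [r] leaves room for the Hopf box around [z0]. *)
have [r rp {}r00] : exists2 r : R, 0 < r & r0 = 3 * r + r.
  exists (r0 / 4); first by rewrite divr_gt0.
  by field.
suff claim q : open_box p r q -> u q = u p.
  have pp : open_box p r p by rewrite /open_box /= !subrr normr0.
  by apply: filterS (nbhs_open_box pp).
move=> pq; apply: contrapT => nq.
have Dq : D q.
  apply: r0D; case: pq => h1 h2; rewrite r00; split.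
    by apply: (lt_trans h1); rewrite ltrDr mulr_gt0.
  by apply: (lt_trans h2); rewrite ltrDr mulr_gt0.
have uq : u q < u p by rewrite lt_neqAle uM// andbT; apply/eqP.
pose F := box p (3 * r) `&` ~` [set z | D z /\ u z < u p].
have cF : compact F.
  apply: compact_closedI (@compact_box _ _ _) _; apply: open_closedC.
  exact: open_lt_level Cu.
have Fp : F p.
  split; last by move=> [_]; rewrite ltxx.
  by split; rewrite subrr normr0 mulr_ge0// ltW.
have F0 : F !=set0 by exists p.
have cs : {within F, continuous (sqdist q)}.
  apply: continuous_in_subspaceT => z _; rewrite /sqdist.
  have c1 := CkD openT (Ck_fst 0 [set: plane2]) (Ck_cst 0 [set: plane2] (- q.1)).
  have c2 := CkD openT (Ck_snd 0 [set: plane2]) (Ck_cst 0 [set: plane2] (- q.2)).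
  by apply: (CkW (CkD openT (CkM openT c1 c1) (CkM openT c2 c2)) I).
have [z0 /[!inE] Fz0 min0] := compact_EVT_min F0 cF cs.
have {}min0 z : F z -> sqdist q z0 <= sqdist q z by move=> Fz; apply: min0; rewrite inE.
have close z : sqdist q z <= sqdist q z0 -> open_box p (3 * r) z.
  move=> hz; rewrite (_ : 3 * r = r + 2 * r); last by ring.
  apply: (open_box_trans pq); apply: sqdist_open_box rp _; apply: le_lt_trans hz _.
  apply: le_lt_trans (open_box_sqdist pq); exact: (min0 _ Fp).
have z0in := close z0 (lexx _).
have inD z : open_box p (3 * r) z -> D z.
  move=> [h1 h2]; apply: r0D; rewrite r00; split.
    by apply: (lt_trans h1); rewrite ltrDl.
  by apply: (lt_trans h2); rewrite ltrDl.
have Dz0 := inD _ z0in.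
have uz0 : u z0 = u p.
  apply/eqP; rewrite eq_le uM//= leNgt; apply/negP => h.
  by case: Fz0 => _; apply.
have z0q : z0 != q by apply/eqP => e; apply: nq; rewrite -e.
have n0 : 0 < sqdist z0 q.
  rewrite lt0r sqdist_ge0 andbT; apply: contra z0q => /eqP/sqdist_eq0->//.
have c0 : 0 <= 3 * (`|q.1 - z0.1| + `|q.2 - z0.2|) by rewrite mulr_ge0// addr_ge0.
have [rho /andP[rho0 rhor] hrho] := small_radius rp n0 c0.
have uM' z : D z -> u z <= u p by exact: uM.
apply: (hopf_contradiction oD Cu Lu uM' uz0 rho0 _ z0q hrho) => z.
  move=> [b1 b2]; apply: r0D; rewrite r00; apply: open_box_trans z0in _.
  by split; [exact: le_lt_trans b1 rhor|exact: le_lt_trans b2 rhor].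
move=> bz hz; have hz' := close z (ltW hz).
rewrite ltNge; apply/negP => h.
have : F z.
  split; first by case: hz' => ? ?; split; exact: ltW.
  by move=> [_]; rewrite ltNge h.
by move=> /min0; rewrite leNgt hz.
Qed.

End StrongMaximumPrinciple.

(** * From the Cauchy-Riemann equations to complex differentiability *)

Section ComplexTopology.
Variable R : realType.
Local Notation C := R[i].
Local Notation plane2 := (R * R)%type.

Lemma gt0_complexE (e : C) : 0 < e -> e = (Re e)%:C /\ 0 < Re e.
Proof. by case: e => a b; rewrite ltcE /= => /andP[/eqP-> ->]. Qed.

Lemma ler_normc_Re (z : C) : (`|Re z|)%:C <= `|z|.
Proof.
rewrite normc_def lecR -sqrtr_sqr ler_wsqrtr// lerDl sqr_ge0//.
Qed.

Lemma ler_normc_Im (z : C) : (`|Im z|)%:C <= `|z|.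
Proof.
rewrite normc_def lecR -sqrtr_sqr ler_wsqrtr// lerDr sqr_ge0//.
Qed.

Lemma ler_normc_ReIm (z : C) : `|z| <= (`|Re z| + `|Im z|)%:C.
Proof.
have h : 0 <= `|Re z| + `|Im z| by rewrite addr_ge0.
rewrite normc_def lecR -[leRHS](ger0_norm h) -sqrtr_sqr ler_wsqrtr// sqrrD.
by rewrite !real_normK ?num_real// addrAC lerDl mulrn_wge0// mulr_ge0.
Qed.

Lemma Re_subc (a b : C) : Re (a - b) = Re a - Re b.
Proof. by case: a b => [a1 a2] [b1 b2]. Qed.

Lemma Im_subc (a b : C) : Im (a - b) = Im a - Im b.
Proof. by case: a b => [a1 a2] [b1 b2]. Qed.

Lemma near_normc (z : C) (e : R) : 0 < e -> \forall w \near z, `|z - w| < e%:C.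
Proof.
move=> e0; apply/nbhs_ballP; exists e%:C => [|w]; first by rewrite /= ltcR.
by rewrite -ball_normE.
Qed.

Lemma Re_continuous : continuous (fun z : C => Re z : R).
Proof.
move=> z; apply/(@cvgrPdist_lt _ _ _ (nbhs z) (nbhs_filter z)) => e e0.
near=> w; have : `|z - w| < e%:C by near: w; exact: near_normc.
rewrite -Re_subc => h.
by rewrite -ltcR; exact: le_lt_trans (ler_normc_Re _) h.
Unshelve. all: by end_near. Qed.

Lemma Im_continuous : continuous (fun z : C => Im z : R).
Proof.
move=> z; apply/(@cvgrPdist_lt _ _ _ (nbhs z) (nbhs_filter z)) => e e0.
near=> w; have : `|z - w| < e%:C by near: w; exact: near_normc.
rewrite -Im_subc => h.
by rewrite -ltcR; exact: le_lt_trans (ler_normc_Im _) h.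
Unshelve. all: by end_near. Qed.

Lemma cvg_complex (T : Type) (F : set_system T) (FF : Filter F) (f : T -> C) (l : C) :
  (fun x => Re (f x) : R) @ F --> (Re l : R) ->
  (fun x => Im (f x) : R) @ F --> (Im l : R) -> f @ F --> l.
Proof.
move=> cR cI; apply/cvgrPdist_lt => e /gt0_complexE[-> e0].
have e2 : 0 < Re e / 2 by rewrite divr_gt0.
have n1 : \forall x \near F, `|Re l - Re (f x)| < Re e / 2 by move/cvgrPdist_lt: cR; apply.
have n2 : \forall x \near F, `|Im l - Im (f x)| < Re e / 2 by move/cvgrPdist_lt: cI; apply.
apply: filterS2 n1 n2 => x; rewrite -Re_subc -Im_subc => h1 h2.
apply: le_lt_trans (ler_normc_ReIm _) _; rewrite ltcR [Re e]splitr.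
exact: ltrD.
Qed.

Lemma plane_continuous : continuous (@plane R).
Proof.
by move=> p; apply: cvg_complex; [exact: cvg_fst|exact: cvg_snd].
Qed.

Lemma plane_ReIm (z : C) : plane (Re z, Im z) = z.
Proof. by case: z. Qed.

Lemma ReIm_continuous : continuous (fun z : C => (Re z, Im z) : plane2).
Proof.
move=> z; exact: (@cvg_pair _ _ _ (nbhs z) (nbhs (Re z)) (nbhs (Im z)) (nbhs_filter z)
  (nbhs_filter _) (nbhs_filter _) _ _ (@Re_continuous z) (@Im_continuous z)).
Qed.

Lemma MVT_line_signed (V : normedModType R) (f : V -> R) (x v : V) (a : R) :
  (forall s, `|s| <= `|a| -> derivable f (x + s *: v) v) ->
  exists2 c, `|c| <= `|a| & f (x + a *: v) - f x = 'D_v f (x + c *: v) * a.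
Proof.
move=> df; have [a0|a0|->] := ltgtP a 0; last first.
- by exists 0; rewrite ?lexx// scale0r addr0 subrr mulr0.
- have df' s : 0 <= s <= a -> derivable f (x + s *: v) v.
    by move=> /andP[s0 sa]; apply: df; rewrite !ger0_norm// (le_trans s0).
  have [c /andP[c0 ca]] := MVT_line a0 df'.
  rewrite scale0r addr0 subr0 => ->; exists c => //.
  by rewrite !ger0_norm ?ltW// (lt_trans c0).
have df' s : a <= s <= 0 -> derivable f (x + s *: v) v.
  move=> /andP[s0 sa]; apply: df; rewrite !ler0_norm ?lerN2//.
  exact: ltW.
have [c /andP[c0 ca]] := MVT_line a0 df'.
rewrite scale0r addr0 sub0r => e; exists c.
  by rewrite !ler0_norm ?lerN2// ltW.
by rewrite -[LHS]opprB e mulrN opprK.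
Qed.

(** The increment is split into a vertical and a horizontal leg. The mean value theorem on each
    gives a partial derivative at a nearby point, within [e] of its value at [p] by continuity. *)
Lemma Ck1_taylor (D : set plane2) (u : plane2 -> R) p (e : R) :
  open D -> Ck 1 D u -> D p -> 0 < e ->
  exists2 r, 0 < r & forall a b : R, `|a| < r -> `|b| < r ->
  `|u (p.1 + a, p.2 + b) - u p -
    (a * 'D_((1, 0) : plane2) u p + b * 'D_((0, 1) : plane2) u p)|
    <= e * (`|a| + `|b|).
Proof.
move=> oD Cu Dp e0; set v : plane2 := (1, 0); set w : plane2 := (0, 1).
have n1 : \forall y \near p, `|'D_v u p - 'D_v u y| < e.
  by have /cvgrPdist_lt := CkW (Ck_derive v Cu) Dp; apply.
have n2 : \forall y \near p, `|'D_w u p - 'D_w u y| < e.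
  by have /cvgrPdist_lt := CkW (Ck_derive w Cu) Dp; apply.
have n3 : \forall y \near p, D y by exact: open_nbhs_nbhs.
have nP : \forall y \near p, [/\ D y, `|'D_v u p - 'D_v u y| < e & `|'D_w u p - 'D_w u y| < e].
  by apply: filterS3 n3 n1 n2.
have [r r0 hr] := near_parallelogram v w nP.
exists r => // a b ha hb.
have h1 s : `|s| <= `|a| -> derivable u (p + b *: w + s *: v) v.
  move=> hs; apply: (Ck_derivable Cu); rewrite addrAC.
  by have [] := hr s b (le_lt_trans hs ha) hb.
have h2 s : `|s| <= `|b| -> derivable u (p + s *: w) w.
  move=> hs; apply: (Ck_derivable Cu).
  have z0 : `|0 : R| < r by rewrite normr0.
  by have [] := hr 0 s z0 (le_lt_trans hs hb); rewrite scale0r addr0.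
have [c hc ec] := MVT_line_signed h1.
have [d hd ed] := MVT_line_signed h2.
have -> : (p.1 + a, p.2 + b) = p + b *: w + a *: v.
  by case: p {Dp n1 n2 n3 nP hr h1 h2 ec ed} => x y; congr (_, _);
    rewrite /= /GRing.scale /= ?mulr0 ?mulr1 ?addr0.
have [_ k1 _] := hr c b (le_lt_trans hc ha) hb.
rewrite addrAC in k1.
have z0 : `|0 : R| < r by rewrite normr0.
have [_ _ k2] := hr 0 d z0 (le_lt_trans hd hb).
rewrite scale0r addr0 in k2.
move: ec ed k1 k2.
move: (u (p + b *: w + a *: v)) (u (p + b *: w)) (u p) => A B U.
move: ('D_v u _) ('D_v u _) ('D_w u _) ('D_w u _) => x1 x2 x3 x4.
move=> e1 e2 k1 k2.
have -> : A - U - (a * x1 + b * x3) = a * (x2 - x1) + b * (x4 - x3).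
  by rewrite (_ : A - U = (A - B) + (B - U)); [rewrite e1 e2; ring|ring].
rewrite (le_trans (ler_normD _ _))// !normrM mulrDr; apply: lerD.
  by rewrite mulrC ler_wpM2r// distrC ltW.
by rewrite mulrC ler_wpM2r// distrC ltW.
Qed.

Lemma realCM (a b : R) : (a * b)%:C = a%:C * b%:C.
Proof. by apply: complex_ReIm_eq; rewrite ?Re_mulc ?Im_mulc /= ?mul0r ?mulr0 ?subr0 ?addr0. Qed.

Lemma complex_difference_le (e : R) (l h d : C) : 0 <= e ->
  `|Re (d - l * h)| <= e * (`|Re h| + `|Im h|) ->
  `|Im (d - l * h)| <= e * (`|Re h| + `|Im h|) ->
  h != 0 -> `|l - h^-1 * d| <= (4 * e)%:C.
Proof.
move=> e0 h1 h2 hn0.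
have -> : l - h^-1 * d = - (h^-1 * (d - l * h)).
  by rewrite mulrBr [l * h]mulrC mulKf// opprB.
rewrite normrN normrM normfV ler_pdivrMl ?normr_gt0//.
apply: le_trans (ler_normc_ReIm _) _.
have [n en] : exists n : R, `|h| = n%:C by eexists; exact: normc_def.
have := ler_normc_Re h; have := ler_normc_Im h; rewrite en !lecR => nI nR.
rewrite -realCM lecR; apply: le_trans (lerD h1 h2) _.
have := ler_wpM2l e0 nI; have := ler_wpM2l e0 nR.
rewrite mulrDr; lra.
Qed.

(** The Cauchy-Riemann equations, for partial derivatives [a], [b] in x and [c], [d] in y of the
    real and imaginary parts. *)
Lemma wirtinger_bar_eq0 (a b c d : R) :
  ((a +i* b) + 'i%C * (c +i* d)) / 2 = 0 -> d = a /\ c = - b.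
Proof.
move=> /eqP; rewrite mulf_eq0 invr_eq0 pnatr_eq0 orbF => /eqP h.
have /= := congr1 (@complex.Re R) h; have /= := congr1 (@complex.Im R) h.
move=> h1 h2; split; lra.
Qed.

(** First-order expansions of the real and imaginary parts, combined by the Cauchy-Riemann
    equations, are a complex expansion with derivative u_x + i v_x. This turns the tensor identity
    on the eigenprojection into holomorphy in the sense of [holo_on]. *)
Lemma dzbar0_derivable (D : set plane2) (f : C -> C) (z : C) : open D ->
  smooth D (fun p => f (plane p)) -> D (Re z, Im z) -> dzbar f z = 0 ->
  derivable f z 1.
Proof.
move=> oD sf Dz; rewrite /dzbar /pderive => /wirtinger_bar_eq0[].
have [C1 C2] := sf 1%N.
have T1 e := Ck1_taylor oD C1 Dz (e := e).
have T2 e := Ck1_taylor oD C2 Dz (e := e).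
move: T1 T2.
set ux := 'D__ _ _; set uy := 'D__ _ _; set vx := 'D__ _ _; set vy := 'D__ _ _.
move: ux uy vx vy => ux uy vx vy T1 T2 evy euy; subst vy uy.
have near_h (e : R) : 0 < e -> \forall h \near (0 : C)^',
    `|(ux +i* vx) - h^-1 *: ((f \o shift z) (h *: (1 : C)) - f z)| <= (4 * e)%:C.
  move=> e0; have [r1 r10 hr1] := T1 _ e0; have [r2 r20 hr2] := T2 _ e0.
  have r0 : 0 < Num.min r1 r2 by rewrite lt_min r10.
  near=> h.
  have h0 : h != 0 by near: h; exact: nbhs_dnbhs_neq.
  have hr : `|0 - h| < (Num.min r1 r2)%:C.
    by near: h; apply: nbhs_dnbhs; exact: near_normc.
  rewrite sub0r normrN in hr.
  have := le_lt_trans (ler_normc_Re _) hr; rewrite ltcR lt_min => /andP[a1 a2].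
  have := le_lt_trans (ler_normc_Im _) hr; rewrite ltcR lt_min => /andP[b1 b2].
  have ez : plane (Re z + Re h, Im z + Im h) = h *: (1 : C) + z.
    rewrite [h *: 1]mulr1.
    by apply: complex_ReIm_eq; rewrite ?Re_addc ?Im_addc /= addrC.
  have := hr1 _ _ a1 b1; have := hr2 _ _ a2 b2; rewrite /= ez plane_ReIm => k2 k1.
  apply: complex_difference_le (ltW e0) _ _ h0.
    rewrite !Re_subc Re_mulc /=; apply: le_trans k1; rewrite le_eqVlt; apply/orP; left.
    by apply/eqP; congr (`|_ - _|); ring.
  rewrite !Im_subc Im_mulc /=; apply: le_trans k2; rewrite le_eqVlt; apply/orP; left.
  by apply/eqP; congr (`|_ - _|); ring.
apply/cvg_ex; exists (ux +i* vx); apply/cvgrPdist_le => e /gt0_complexE[-> e0].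
have e4 : 0 < Re e / 4 by rewrite divr_gt0.
have := near_h _ e4; rewrite (_ : 4 * (Re e / 4) = Re e) //; field.
Unshelve. all: by end_near. Qed.

End ComplexTopology.

(** * Adjoints with respect to a Hermitian form *)

Section HermitianForms.
Variable R : realType.
Local Notation C := R[i].

Lemma adjmxE m n (A : 'M[C]_(m, n)) i j : adjmx A i j = conjc (A j i).
Proof. by rewrite !mxE. Qed.

Lemma conjc_sum (I : finType) (F : I -> C) : conjc (\sum_i F i) = \sum_i conjc (F i).
Proof. exact: (rmorph_sum (@conjc R)). Qed.

Lemma conjcM (a b : C) : conjc (a * b) = conjc a * conjc b.
Proof. exact: (rmorphM (@conjc R)). Qed.

Lemma conjcD (a b : C) : conjc (a + b) = conjc a + conjc b.
Proof. exact: (rmorphD (@conjc R)). Qed.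

Lemma conjcN (a : C) : conjc (- a) = - conjc a.
Proof. exact: (rmorphN (@conjc R)). Qed.

Lemma adjmxM m n p (A : 'M[C]_(m, n)) (B : 'M[C]_(n, p)) :
  adjmx (A *m B) = adjmx B *m adjmx A.
Proof.
apply/matrixP => i j; rewrite adjmxE !mxE conjc_sum; apply: eq_bigr => k _.
by rewrite !adjmxE conjcM mulrC.
Qed.

Lemma adjmxD m n (A B : 'M[C]_(m, n)) : adjmx (A + B) = adjmx A + adjmx B.
Proof. by apply/matrixP => i j; rewrite adjmxE !mxE conjcD. Qed.

Lemma adjmxN m n (A : 'M[C]_(m, n)) : adjmx (- A) = - adjmx A.
Proof. by apply/matrixP => i j; rewrite adjmxE !mxE conjcN. Qed.

Lemma adjmxZ m n (a : C) (A : 'M[C]_(m, n)) : adjmx (a *: A) = conjc a *: adjmx A.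
Proof. by apply/matrixP => i j; rewrite adjmxE !mxE conjcM. Qed.

Lemma adjmxK m n (A : 'M[C]_(m, n)) : adjmx (adjmx A) = A.
Proof. by apply/matrixP => i j; rewrite !adjmxE conjcK. Qed.

Lemma adjmx1 n : adjmx (1%:M : 'M[C]_n) = 1%:M.
Proof.
by apply/matrixP => i j; rewrite adjmxE !mxE eq_sym; exact: (rmorph_nat (@conjc R)).
Qed.

Lemma hform_ge0 r (H : 'M[C]_r) u : posdef H -> 0 <= hform H u u.
Proof.
move=> [_ pH]; have [->|/pH/ltW//] := eqVneq u 0.
by rewrite /hform mulmx0 mxE.
Qed.

Lemma hform_eq0 r (H : 'M[C]_r) u : posdef H -> hform H u u = 0 -> u = 0.
Proof.
by move=> [_ pH] h; apply/eqP; apply: contraT => /pH; rewrite h ltxx.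
Qed.

Lemma posdef_unitmx r (H : 'M[C]_r) : posdef H -> H \in unitmx.
Proof.
move=> [hH pH]; rewrite -unitmx_tr -row_free_unit -kermx_eq0.
apply: contraT => /rowV0Pn[v /sub_kermxP vH v0].
have u0 : v^T != 0 by rewrite trmx_eq0.
have := pH _ u0; rewrite /hform -mulmxA -(trmxK (H *m v^T)) trmx_mul trmxK vH trmx0.
by rewrite mulmx0 mxE ltxx.
Qed.

Section Adjoint.
Variables (r : nat) (H : 'M[C]_r).
Hypothesis pH : posdef H.
Local Notation star := (hadj H).
Let uH : H \in unitmx := posdef_unitmx pH.

Lemma adjmx_invmx : adjmx (invmx H) = invmx H.
Proof.
have e : adjmx (invmx H) *m H = 1%:M.
  by rewrite -[X in _ *m X](proj1 pH) -adjmxM mulmxV ?adjmx1.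
by rewrite -[LHS]mulmx1 -(mulmxV uH) mulmxA e mul1mx.
Qed.

Lemma hadjM A B : star (A *m B) = star B *m star A.
Proof. by rewrite /hadj adjmxM !mulmxA mulmxK. Qed.

Lemma hadjD A B : star (A + B) = star A + star B.
Proof. by rewrite /hadj adjmxD mulmxDr mulmxDl. Qed.

Lemma hadjN A : star (- A) = - star A.
Proof. by rewrite /hadj adjmxN mulmxN mulNmx. Qed.

Lemma hadjZ a A : star (a *: A) = conjc a *: star A.
Proof. by rewrite /hadj adjmxZ -scalemxAr -scalemxAl. Qed.

Lemma hadj1 : star 1%:M = 1%:M.
Proof. by rewrite /hadj adjmx1 mulmx1 mulVmx. Qed.

Lemma hadj_self A : star A = A <-> adjmx (H *m A) = H *m A.
Proof.
rewrite adjmxM (proj1 pH) /hadj; split=> e.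
  by rewrite -[in RHS]e !mulmxA mulmxV// mul1mx.
by rewrite -mulmxA e mulKmx.
Qed.

End Adjoint.
End HermitianForms.

(** * Linear algebra of 2 x 2 matrices with a Hermitian form *)

Section RankTwo.
Variable R : realType.
Local Notation C := R[i].
Implicit Types A B X H : 'M[C]_2.

Lemma ord2P (P : 'I_2 -> Prop) : P 0 -> P 1 -> forall i, P i.
Proof.
by move=> P0 P1 [[|[|//]] ?]; [apply: eq_ind P0 _ _|apply: eq_ind P1 _ _]; apply: val_inj.
Qed.

Lemma mx2P m (A B : 'M[C]_(2, m)) : (forall j, A 0 j = B 0 j) ->
  (forall j, A 1 j = B 1 j) -> A = B.
Proof. by move=> h0 h1; apply/matrixP => i j; move: i; apply: ord2P. Qed.

Lemma mx22P A B : A 0 0 = B 0 0 -> A 0 1 = B 0 1 -> A 1 0 = B 1 0 ->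
  A 1 1 = B 1 1 -> A = B.
Proof. by move=> *; apply: mx2P; apply: ord2P. Qed.

Lemma big_ord2 (F : 'I_2 -> C) : \sum_i F i = F 0 + F 1.
Proof. by rewrite big_ord_recl big_ord1; congr (_ + F _); apply: val_inj. Qed.

Lemma mulmx2E m n (A : 'M[C]_(m, 2)) (B : 'M[C]_(2, n)) i j :
  (A *m B) i j = A i 0 * B 0 j + A i 1 * B 1 j.
Proof. by rewrite mxE big_ord2. Qed.

Lemma mxtrace2 A : \tr A = A 0 0 + A 1 1.
Proof. by rewrite /mxtrace big_ord2. Qed.

Lemma det2 A : \det A = A 0 0 * A 1 1 - A 0 1 * A 1 0.
Proof.
rewrite (expand_det_row A 0) big_ord2 /cofactor !det_mx11 !mxE /=.
have -> : lift 0 0 = 1 :> 'I_2 by apply: val_inj.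
have -> : lift 1 0 = 0 :> 'I_2 by apply: val_inj.
by rewrite expr0 expr1 mul1r mulN1r mulrN.
Qed.

Lemma posdef2 H : posdef H ->
  [/\ 0 < H 0 0, 0 < \det H & forall i j, conjc (H j i) = H i j].
Proof.
move=> [hH pH].
have h i j : conjc (H j i) = H i j by rewrite -adjmxE hH.
pose e : 'cV[C]_2 := delta_mx 0 0.
have e0 : e != 0.
  by apply/eqP => /matrixP/(_ 0 0); rewrite !mxE /= => /eqP; rewrite oner_eq0.
have a0 : 0 < H 0 0.
  have e00 : e 0 0 = 1 by rewrite mxE.
  have e10 : e 1 0 = 0 by rewrite mxE.
  have := pH e e0; rewrite /hform !mulmx2E !adjmxE e00 e10.
  by rewrite (rmorph1 (@conjc R)) (rmorph0 (@conjc R)) !(mul0r, mulr0, addr0, mul1r, mulr1).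
(* [w] is orthogonal to [e] for [H], and h(w, w) = H_00 det H. *)
pose w : 'cV[C]_2 := \col_i (if i == 0 then - H 0 1 else H 0 0).
have w0 : w != 0.
  by apply/eqP => /matrixP/(_ 1 0); rewrite !mxE /= => e1; rewrite e1 ltxx in a0.
have w00 : w 0 0 = - H 0 1 by rewrite mxE.
have w10 : w 1 0 = H 0 0 by rewrite mxE.
have := pH w w0; rewrite /hform !mulmx2E !adjmxE w00 w10 conjcN !h.
have -> : (- H 1 0 * H 0 0 + H 0 0 * H 1 0) * - H 0 1 +
   (- H 1 0 * H 0 1 + H 0 0 * H 1 1) * H 0 0 = H 0 0 * \det H by rewrite det2; ring.
by move=> d; split=> //; rewrite -(pmulr_rgt0 _ a0).
Qed.

(** For an orthogonal basis u, v, tr (X X^* ) is |X u|^2 / |u|^2 + |X v|^2 / |v|^2. The basis is the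
    first coordinate vector and its Gram-Schmidt complement, whose square norms are H_00 and H_00
    det H; [a], [b], [c] come from clearing denominators. Positivity of the trace form follows
    without diagonalizing [H]. *)
Lemma mxtrace_hadj2 H X : posdef H -> exists u v : 'cV[C]_2, exists a b c : C,
  [/\ 0 < a, 0 < b, 0 < c,
   a * \tr (X *m hadj H X) = b * hform H (X *m u) (X *m u) + c * hform H (X *m v) (X *m v) &
   X *m u = 0 -> X *m v = 0 -> X = 0].
Proof.
move=> pH; have [a0 d0 hH] := posdef2 pH.
pose e : 'cV[C]_2 := delta_mx 0 0.
pose w : 'cV[C]_2 := \col_i (if i == 0 then - H 0 1 else H 0 0).
exists e, w, (H 0 0 * \det H), (\det H), 1; split=> //; first exact: mulr_gt0.
- have uH := posdef_unitmx pH.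
  have inv : (H 0 0 * \det H) *: invmx H = (\det H) *: (e *m adjmx e) + w *m adjmx w.
    rewrite -[RHS](mulmxK uH) -[in LHS](mul1mx (invmx H)) scalemxAl; congr (_ *m _).
    have e00 : e 0 0 = 1 by rewrite mxE.
    have e10 : e 1 0 = 0 by rewrite mxE.
    have w00 : w 0 0 = - H 0 1 by rewrite mxE.
    have w10 : w 1 0 = H 0 0 by rewrite mxE.
    have outer (u : 'cV[C]_2) i j : (u *m adjmx u) i j = u i 0 * conjc (u j 0).
      by rewrite mxE big_ord1 adjmxE.
    have ME i j : (\det H *: (e *m adjmx e) + w *m adjmx w) i j =
       \det H * (e i 0 * conjc (e j 0)) + w i 0 * conjc (w j 0).
      by rewrite mxE [in X in X + _]mxE !outer.
    have SE i j : ((H 0 0 * \det H) *: (1%:M : 'M[C]_2)) i j = (H 0 0 * \det H) * (i == j)%:R.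
      by rewrite mxE mxE.
    apply: mx22P; rewrite mulmx2E !ME SE e00 e10 w00 w10 conjcN !hH
      (rmorph1 (@conjc R)) (rmorph0 (@conjc R)) det2 /=; ring.
  have tu (u : 'cV[C]_2) : hform H (X *m u) (X *m u) = \tr (X *m (u *m adjmx u) *m adjmx X *m H).
    rewrite /hform -trace_mx11 adjmxM -!mulmxA mxtrace_mulC -!mulmxA.
    rewrite mxtrace_mulC -!mulmxA.
    by rewrite [LHS]mxtrace_mulC -!mulmxA.
  transitivity (\tr (X *m ((H 0 0 * \det H) *: invmx H) *m adjmx X *m H)).
    by rewrite -scalemxAr -!scalemxAl mxtraceZ /hadj !mulmxA.
  by rewrite inv mulmxDr !mulmxDl linearD /= -scalemxAr -!scalemxAl mxtraceZ mul1r !tu.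
- move=> /matrixP Xe /matrixP Xw.
  have h0 i : X i 0 = 0.
    by have := Xe i 0; rewrite mulmx2E !mxE mulr1 mulr0 addr0.
  have h1 i : X i 1 = 0.
    have := Xw i 0; rewrite mulmx2E h0 mul0r add0r !mxE /= => /eqP.
    by rewrite mulf_eq0 (gt_eqF a0) orbF => /eqP.
  by apply: mx22P; rewrite ?h0 ?h1 mxE.
Qed.

Lemma mxtrace_hadj_ge0 H X : posdef H -> 0 <= \tr (X *m hadj H X).
Proof.
move=> pH; have [u [v [a [b [c [a0 b0 c0 e _]]]]]] := mxtrace_hadj2 X pH.
rewrite -(pmulr_rge0 _ a0) e.
by apply: addr_ge0; apply: mulr_ge0; [exact: ltW|exact: hform_ge0|exact: ltW|exact: hform_ge0].
Qed.

Lemma mxtrace_hadj_eq0 H X : posdef H -> \tr (X *m hadj H X) = 0 -> X = 0.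
Proof.
move=> pH t0; have [u [v [a [b [c [a0 b0 c0 e h]]]]]] := mxtrace_hadj2 X pH.
move: e; rewrite t0 mulr0 => /esym/eqP.
rewrite paddr_eq0; last first.
- by apply: mulr_ge0; [exact: ltW|exact: hform_ge0].
- by apply: mulr_ge0; [exact: ltW|exact: hform_ge0].
rewrite !mulf_eq0 (gt_eqF b0) (gt_eqF c0) /= => /andP[/eqP h1 /eqP h2].
by apply: h; exact: hform_eq0 pH _.
Qed.

(** Cayley-Hamilton makes the square of a trace-free matrix scalar; the trace identifies the
    scalar. *)
Lemma tracefree_sqr A : \tr A = 0 -> A *m A = (\tr (A *m A) / 2)%:M.
Proof.
rewrite mxtrace2 => /eqP; rewrite addr_eq0 => /eqP h.
have SE (a : C) i j : (a%:M : 'M[C]_2) i j = a *+ (i == j) by rewrite mxE.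
apply: mx22P; rewrite SE !mxtrace2 !mulmx2E h /= ?mulr1n ?mulr0n; by field.

Qed.

Lemma mxtrace_selfadjoint_sqr H A : posdef H -> hadj H A = A ->
  \tr (A *m A) = (Re (\tr (A *m A)))%:C /\ 0 <= Re (\tr (A *m A)).
Proof.
move=> pH hA; have := mxtrace_hadj_ge0 A pH; rewrite hA.
by case: (\tr _) => x y; rewrite lecE /= => /andP[/eqP-> ->].
Qed.

Lemma realC_half (a : R) : a%:C / 2 = (a / 2)%:C.
Proof.
have n2 : (2 : C) != 0 by rewrite pnatr_eq0.
apply: (mulIf n2); rewrite divfK// mulr_natr mulr2n.
by apply: complex_ReIm_eq; rewrite ?Re_addc ?Im_addc /= ?addr0// -splitr.
Qed.

(** By self-adjointness h(A u, A u) = h(A^2 u, u), and A^2 is the scalar tr (A^2) / 2, so [A] scales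
    every norm by the same factor. *)
Lemma op_norm_tracefree_le1 H A : posdef H -> hadj H A = A -> \tr A = 0 ->
  Re (\tr (A *m A)) / 2 <= 1 -> (op_norm H A <= 1)%E.
Proof.
move=> pH hA tA U1; have [eU U0] := mxtrace_selfadjoint_sqr pH hA.
apply: ge_ereal_sup => _ [u /= hu <-]; rewrite lee_fin.
apply: le_trans hu; rewrite /hnorm.
have : A *m A = (Re (\tr (A *m A)) / 2)%:C%:M.
  by rewrite {1}(tracefree_sqr tA) {1}eU realC_half.
move: U1; move: (Re _ / 2) => q q1 eA.
have -> : hform H (A *m u) (A *m u) = q%:C * hform H u u.
  have /(hadj_self pH) hHA : hadj H A = A := hA.
  rewrite /hform adjmxM.
  have e : adjmx A *m H = H *m A by rewrite -hHA adjmxM (proj1 pH).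
  rewrite -!mulmxA [adjmx A *m _]mulmxA e -!mulmxA (mulmxA A A) eA.
  by rewrite mul_scalar_mx -!scalemxAr mxE.
have := hform_ge0 u pH; case: (hform H u u) => x y; rewrite lecE /= => /andP[/eqP-> x0].
by rewrite mul0r subr0 ler_wsqrtr// ler_piMl.
Qed.

Section EigenProjection.

(** [A] anticommutes with [psi] because A^2 is central. For [F] the adjoint of [B] and [A]
    self-adjoint, [F *m A - A *m F] is the adjoint of [psi], so the unsigned term of the source
    becomes a quadratic form in [psi]. *)
Lemma mxtrace_commutator_identity A B F (U : C) : \tr A = 0 -> A *m A = U%:M ->
  let psi := A *m B - B *m A in
  \tr (A *m psi *m (F *m A - A *m F)) = 2 * U * \tr (psi *m F).
Proof.
move=> tA AU psi.
have pA : A *m psi = - (psi *m A).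
  rewrite /psi mulmxBr mulmxBl !mulmxA AU -[B *m A *m A]mulmxA AU.
  by rewrite mul_scalar_mx mul_mx_scalar opprB.
rewrite mulmxBr linearB /= !mulmxA.
have -> : \tr (A *m psi *m F *m A) = U * \tr (psi *m F).
  by rewrite mxtrace_mulC !mulmxA AU mul_scalar_mx -scalemxAl mxtraceZ.
have -> : A *m psi *m A *m F = - (U *: (psi *m F)).
  by rewrite pA mulNmx -mulmxA AU mul_mx_scalar mulNmx -scalemxAl.
by rewrite linearN /= mxtraceZ opprK -mulrDl -mulrA mulr_natl mulr2n mulrDl.
Qed.

End EigenProjection.
End RankTwo.

(** * Positivity of the source term where g > 1 *)

Section HiggsSource.
Variable R : realType.
Local Notation C := R[i].
Implicit Types A B X H : 'M[C]_2.

(** Invariance of the trace form: tr (A [B, Y]) = tr ([A, B] Y). With [F] the adjoint of [B], the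
    left side is what the varied curvature equation produces and [X] is the adjoint of [psi]. *)
Lemma mxtrace_double_commutator A B F :
  let psi := A *m B - B *m A in let X := F *m A - A *m F in
  \tr (A *m (2 *: (B *m F - F *m B) + (B *m X - X *m B))) =
  2 * \tr (psi *m F) + \tr (psi *m X).
Proof.
move=> psi X.
have h Y : \tr (A *m (B *m Y - Y *m B)) = \tr (psi *m Y).
  rewrite /psi mulmxBr mulmxBl !linearB /= !mulmxA; congr (_ - _).
  by rewrite mxtrace_mulC mulmxA.
by rewrite mulmxDr -scalemxAr linearD /= mxtraceZ !h.
Qed.

(** A^2 = g^2 gives (A + g)^2 = 2 g^2 + 2 g A. *)
Lemma mxtrace_shift_sqr A X Y (g : C) : A *m A = (g ^+ 2)%:M ->
  \tr ((A + g%:M) *m (A + g%:M) *m X *m Y) =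
  2 * g ^+ 2 * \tr (X *m Y) + 2 * g * \tr (A *m X *m Y).
Proof.
move=> AU.
have -> : (A + g%:M) *m (A + g%:M) = (2 * g ^+ 2) *: 1%:M + (2 * g) *: A.
  rewrite mulmxDl !mulmxDr AU mul_scalar_mx mul_mx_scalar -scalar_mxM -expr2.
  rewrite scalemx1 -scale_scalar_mx -[(2 * g) *: A]scalerA.
  by rewrite !scaler_nat [g *: A + _]addrC addrACA.
have t1 (a : C) Z : \tr ((a *: Z) *m X *m Y) = a * \tr (Z *m X *m Y).
  by rewrite -(scalemxAl a Z X) -(scalemxAl a _ Y) mxtraceZ.
rewrite (mulmxDl _ _ X) (mulmxDl _ _ Y) raddfD /=.
by congr (_ + _); rewrite t1 ?mul1mx.
Qed.

(** Here c = g, x = |psi|^2, y is the pairing of [psi] with the Higgs field, z = tr (A psi psi^* )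
    and w = |(A + g) psi|^2. Completing the square exposes the factor c - 1. *)
Lemma higgs_source_key (c x y z w : C) : w = 2 * c ^+ 2 * x + 2 * c * z ->
  z = 2 * c ^+ 2 * y -> 2 * c ^+ 3 * (x + 2 * y) = 2 * c ^+ 2 * (c - 1) * x + w.
Proof. by move=> -> ->; ring. Qed.

(* With [A^2 = g^2], twice [g^3] times the source is
   [2 g^2 (g - 1) |psi|^2 + |(A + g) psi|^2]. *)
Lemma higgs_source_ge0 H A B (g : R) : posdef H -> hadj H A = A -> \tr A = 0 ->
  A *m A = (g%:C ^+ 2)%:M -> 1 < g ->
  let psi := A *m B - B *m A in
  let q := \tr (psi *m hadj H psi) + 2 * \tr (psi *m hadj H B) in
  0 <= q /\ (q = 0 -> psi = 0).
Proof.
move=> pH hA tA AU g1 psi q.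
have star_psi : hadj H psi = hadj H B *m A - A *m hadj H B.
  by rewrite /psi hadjD// hadjN// !hadjM// hA.
have id1 := mxtrace_commutator_identity B (hadj H B) tA AU.
rewrite /= -/psi -star_psi in id1.
pose W := (A + g%:C%:M) *m psi.
have id2 : \tr (W *m hadj H W) = 2 * g%:C ^+ 2 * \tr (psi *m hadj H psi) +
    2 * g%:C * \tr (A *m psi *m hadj H psi).
  have sg : hadj H (A + g%:C%:M) = A + g%:C%:M.
    rewrite hadjD// hA; congr (_ + _).
    rewrite -[g%:C%:M]mul1mx -[_ *m _]/(_ *m _) mul_mx_scalar hadjZ// hadj1//.
    by congr (_ *: _); apply: complex_ReIm_eq; rewrite //= oppr0.
  rewrite /W hadjM// sg; move: (hadj H psi) => Y.
  rewrite mulmxA mxtrace_mulC !mulmxA; exact: (mxtrace_shift_sqr _ _ AU).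
have g0 : 0 < g by exact: lt_trans ltr01 g1.
have gC0 : 0 < g%:C :> C by rewrite ltcR.
have key := higgs_source_key id2 id1; rewrite -/q in key.
have gC1 : 0 < g%:C - 1 :> C by rewrite subr_gt0 ltcR.
have g3 : 0 < 2 * g%:C ^+ 3 :> C by rewrite mulr_gt0// exprn_gt0.
have g2 : 0 < 2 * g%:C ^+ 2 * (g%:C - 1) :> C.
  by rewrite !mulr_gt0// exprn_gt0.
have p1 := mxtrace_hadj_ge0 psi pH; have p2 := mxtrace_hadj_ge0 W pH.
have p3 : 0 <= 2 * g%:C ^+ 2 * (g%:C - 1) * \tr (psi *m hadj H psi).
  by apply: mulr_ge0 p1; exact: ltW.
split; first by rewrite -(pmulr_rge0 _ g3) key addr_ge0.
move=> q0; apply: (mxtrace_hadj_eq0 pH).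
move: key; rewrite q0 mulr0 => /esym/eqP; rewrite paddr_eq0// => /andP[+ _].
by rewrite mulf_eq0 (gt_eqF g2) /= => /eqP.
Qed.

End HiggsSource.

(** * The spectral projection of a trace-free matrix with scalar square *)

Section EigenProjection.
Variable R : realType.
Local Notation C := R[i].
Implicit Types A B P H : 'M[C]_2.

Definition eigenproj (g : C) A : 'M[C]_2 := 2^-1 *: (1%:M + g^-1 *: A).

Section Facts.
Variables (g : C) (A : 'M[C]_2).
Hypotheses (g0 : g != 0) (tA : \tr A = 0) (AA : A *m A = (g ^+ 2)%:M).
Local Notation P := (eigenproj g A).
Let n2 : (2 : C) != 0. Proof. by rewrite pnatr_eq0. Qed.

Lemma eigenproj_trace : \tr P = 1.
Proof.
by rewrite mxtraceZ linearD /= mxtraceZ tA mulr0 addr0 mxtrace1 mulVf.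
Qed.

Lemma eigenproj_idem : P *m P = P.
Proof.
have SS : (g^-1 *: A) *m (g^-1 *: A) = 1%:M.
  rewrite -scalemxAl -scalemxAr AA !scale_scalar_mx; congr (_%:M); by field.
rewrite /eigenproj; move: (g^-1 *: A) SS => S SS.
rewrite -scalemxAl -scalemxAr mulmxDl !mulmxDr mul1mx mulmx1 SS mul1mx.
rewrite [S + _]addrC -mulr2n; congr (_ *: _).
by rewrite -[(1%:M + S) *+ 2]scaler_nat scalerA mulVf// scale1r.
Qed.

Lemma eigenproj_det : \det P = 0.
Proof.
have e : A 0 0 ^+ 2 + A 0 1 * A 1 0 = g ^+ 2.
  by have := congr1 (fun M : 'M[C]_2 => M 0 0) AA; rewrite mulmx2E !mxE /= mulr1n -expr2.
move: tA; rewrite mxtrace2 => /eqP; rewrite addr_eq0 => /eqP h.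
have PE i j : P i j = 2^-1 * ((i == j)%:R + g^-1 * A i j) by rewrite !mxE.
rewrite det2 !PE /= h; rewrite h in e.
have -> : 2^-1 * (1 + g^-1 * - A 1 1) * (2^-1 * (1 + g^-1 * A 1 1)) -
   2^-1 * (0 + g^-1 * A 0 1) * (2^-1 * (0 + g^-1 * A 1 0)) =
   4^-1 * (1 - g ^- 2 * ((- A 1 1) ^+ 2 + A 0 1 * A 1 0)) by field; rewrite g0.
by rewrite e mulVf ?expf_neq0// subrr mulr0.
Qed.

Lemma eigenproj_commute B : A *m B = B *m A -> P *m B = B *m P.
Proof.
move=> h; rewrite /eigenproj -scalemxAl -scalemxAr mulmxDl mulmxDr mul1mx mulmx1.
by rewrite -scalemxAl -scalemxAr h.
Qed.

End Facts.

Lemma det0_minors P : \det P = 0 -> forall i j k l, P i j * P k l = P i l * P k j.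
Proof.
rewrite det2 => /eqP; rewrite subr_eq0 => /eqP h.
have h' : P 1 0 * P 0 1 = P 1 1 * P 0 0 by rewrite mulrC -h mulrC.
by do 4 (apply: ord2P); first [exact: mulrC | exact: h | exact: h' | exact: esym h | exact: esym h' | by []].
Qed.

(** A singular 2 x 2 matrix has proportional columns, so a column with nonzero diagonal entry spans
    the image; the coefficient is read off in row [b]. *)
Lemma det0_range P (b : 'I_2) (v : 'cV[C]_2) : \det P = 0 -> P b b != 0 ->
  P *m v = ((P *m v) b 0 / P b b) *: col b P.
Proof.
move=> /det0_minors h pb; apply/matrixP => i j; rewrite (ord1 j) !mxE !big_ord2.
apply: (mulIf pb); rewrite [RHS]mulrAC divfK// !mulrDl.
have e k : P i k * v k j * P b b = P b k * v k j * P i b.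
  by rewrite mulrAC h [RHS]mulrAC; congr (_ * _); rewrite mulrC.
by rewrite (ord1 j) in e *; rewrite !e.
Qed.

End EigenProjection.

(** * Derivations of smooth functions and their action on matrices *)

Section Derivations.
Variables (R : realType) (V : normedModType R) (D : set V).
Hypothesis oD : open D.
Local Notation C := R[i].
Implicit Types (f g : V -> C) (d : (V -> C) -> V -> C).

(** The rules shared by d/dz, d/dzbar and d/dt, so that matrix calculus is done once for all three.
    [derivation_ext] expresses locality: only values on [D] count. *)
Record derivation d : Prop := Derivation {
  derivation_smooth : forall f, smooth D f -> smooth D (d f);
  derivation_ext : forall f g x, (forall y, D y -> f y = g y) -> D x -> d f x = d g x;
  derivation_cst : forall c x, D x -> d (fun=> c) x = 0;
  derivationD : forall f g x, smooth D f -> smooth D g -> D x ->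
    d (fun y => f y + g y) x = d f x + d g x;
  derivationM : forall f g x, smooth D f -> smooth D g -> D x ->
    d (fun y => f y * g y) x = d f x * g x + f x * d g x
}.

(** Constant complex coefficients on two real directions cover both Wirtinger operators and, with
    [b = 0], the time derivative; any two such operators commute on smooth functions. *)
Definition lin_derive (a : C) (v : V) (b : C) (w : V) f (x : V) : C :=
  a * cderive v f x + b * cderive w f x.

Lemma lin_derive_derivation a v b w : derivation (lin_derive a v b w).
Proof.
split=> [f sf|f g x fg Dx|c x Dx|f g x sf sg Dx|f g x sf sg Dx]; rewrite /lin_derive.
- have s1 := smooth_cderive v sf; have s2 := smooth_cderive w sf.
  exact: smoothD oD (smoothM oD (smooth_cst D a) s1) (smoothM oD (smooth_cst D b) s2).
- by rewrite (cderive_ext v oD fg Dx) (cderive_ext w oD fg Dx).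
- by rewrite !cderive_cst !mulr0 addr0.
- rewrite (cderiveD v sf sg Dx) (cderiveD w sf sg Dx).
  by rewrite !mulrDr addrACA.
rewrite (cderiveM v sf sg Dx) (cderiveM w sf sg Dx).
by move: (cderive v f x) (cderive w f x) (cderive v g x) (cderive w g x) (f x) (g x) => *; ring.
Qed.

Lemma derivationN d f x : derivation d -> smooth D f -> D x ->
  d (fun y => - f y) x = - d f x.
Proof.
move=> dd sf Dx; rewrite (derivation_ext dd (g := fun y => -1 * f y)) //.
  by rewrite (derivationM dd (smooth_cst D (-1)) sf Dx) (derivation_cst dd) // mul0r add0r mulN1r.
by move=> y _; rewrite mulN1r.
Qed.

Lemma derivationZ d f c x : derivation d -> smooth D f -> D x ->
  d (fun y => c * f y) x = c * d f x.
Proof.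
move=> dd sf Dx.
by rewrite (derivationM dd (smooth_cst D c) sf Dx) (derivation_cst dd) // mul0r add0r.
Qed.

Lemma cderive_lin_derive a0 v0 b0 w0 u f x : smooth D f -> D x ->
  cderive u (lin_derive a0 v0 b0 w0 f) x =
  a0 * cderive u (cderive v0 f) x + b0 * cderive u (cderive w0 f) x.
Proof.
move=> sf Dx.
have s1 := smooth_cderive v0 sf; have s2 := smooth_cderive w0 sf.
have t1 := smoothM oD (smooth_cst D a0) s1; have t2 := smoothM oD (smooth_cst D b0) s2.
apply: (etrans (cderiveD u t1 t2 Dx)).
apply: (f_equal2 +%R).
  apply: (etrans (cderiveM u (smooth_cst D a0) s1 Dx)).
  by rewrite cderive_cst mul0r add0r.
apply: (etrans (cderiveM u (smooth_cst D b0) s2 Dx)).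
by rewrite cderive_cst mul0r add0r.
Qed.

Lemma lin_derive_comm a v b w a' v' b' w' f x : smooth D f -> D x ->
  lin_derive a v b w (lin_derive a' v' b' w' f) x =
  lin_derive a' v' b' w' (lin_derive a v b w f) x.
Proof.
move=> sf Dx.
have E a0 v0 b0 w0 u := cderive_lin_derive a0 v0 b0 w0 u sf Dx.
rewrite [LHS]/lin_derive [RHS]/lin_derive !E.
have cm u u' : cderive u (cderive u' f) x = cderive u' (cderive u f) x.
  exact: (cderive_comm _ _ oD Dx sf).
rewrite (cm v v') (cm v w') (cm w v') (cm w w').
move: (cderive v' (cderive v f) x) (cderive w' (cderive v f) x)
  (cderive v' (cderive w f) x) (cderive w' (cderive w f) x) => p q r s.
by ring.
Qed.

Lemma lin_derive_conj a v b w f x : smooth D f -> D x ->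
  lin_derive a v b w (fun y => conjc (f y)) x =
  conjc (lin_derive (conjc a) v (conjc b) w f x).
Proof.
move=> sf Dx; rewrite /lin_derive (cderive_conj v sf Dx) (cderive_conj w sf Dx).
by rewrite conjcD !conjcM !conjcK.
Qed.

Definition smooth_mx m n (A : V -> 'M[C]_(m, n)) :=
  forall i j, smooth D (fun x => A x i j).

Definition mxderive d m n (A : V -> 'M[C]_(m, n)) (x : V) : 'M[C]_(m, n) :=
  \matrix_(i, j) d (fun y => A y i j) x.

Lemma mxderiveE d m n (A : V -> 'M[C]_(m, n)) x i j :
  mxderive d A x i j = d (fun y => A y i j) x.
Proof. by rewrite mxE. Qed.

Section Rules.
Variable d : (V -> C) -> V -> C.
Hypothesis dd : derivation d.
Local Notation dm := (mxderive d).

Lemma smooth_mxderive m n (A : V -> 'M[C]_(m, n)) : smooth_mx A -> smooth_mx (dm A).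
Proof.
move=> sA i j; apply: (smooth_ext oD _ (derivation_smooth dd (sA i j))) => x _.
by rewrite mxE.
Qed.

Lemma smooth_mx_ext m n (A B : V -> 'M[C]_(m, n)) : (forall x, D x -> A x = B x) ->
  smooth_mx A -> smooth_mx B.
Proof. by move=> AB sA i j; apply: (smooth_ext oD _ (sA i j)) => x Dx; rewrite AB. Qed.

Lemma mxderive_ext m n (A B : V -> 'M[C]_(m, n)) x : (forall y, D y -> A y = B y) ->
  D x -> dm A x = dm B x.
Proof.
move=> AB Dx; apply/matrixP => i j; rewrite !mxE.
by apply: (derivation_ext dd) => // y Dy; rewrite AB.
Qed.

Lemma smooth_mxD m n (A B : V -> 'M[C]_(m, n)) : smooth_mx A -> smooth_mx B ->
  smooth_mx (fun x => A x + B x).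
Proof.
move=> sA sB i j; apply: (smooth_ext oD _ (smoothD oD (sA i j) (sB i j))) => x _.
by rewrite mxE.
Qed.

Lemma smooth_mxN m n (A : V -> 'M[C]_(m, n)) : smooth_mx A -> smooth_mx (fun x => - A x).
Proof.
move=> sA i j; apply: (smooth_ext oD _ (smoothN oD (sA i j))) => x _.
by rewrite mxE.
Qed.

Lemma smooth_mxZ m n (f : V -> C) (A : V -> 'M[C]_(m, n)) : smooth D f -> smooth_mx A ->
  smooth_mx (fun x => f x *: A x).
Proof.
move=> sf sA i j; apply: (smooth_ext oD _ (smoothM oD sf (sA i j))) => x _.
by rewrite mxE.
Qed.

Lemma smooth_mx_cst m n (A : 'M[C]_(m, n)) : smooth_mx (fun=> A).
Proof. by move=> i j; exact: smooth_cst. Qed.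

Lemma smooth_mxM m n (A : V -> 'M[C]_(m, 2)) (B : V -> 'M[C]_(2, n)) :
  smooth_mx A -> smooth_mx B -> smooth_mx (fun x => A x *m B x).
Proof.
move=> sA sB i j.
apply: (smooth_ext oD _ (smoothD oD (smoothM oD (sA i 0) (sB 0 j)) (smoothM oD (sA i 1) (sB 1 j)))).
by move=> x _; rewrite mulmx2E.
Qed.

Lemma smooth_mx_adj m n (A : V -> 'M[C]_(m, n)) : smooth_mx A ->
  smooth_mx (fun x => adjmx (A x)).
Proof.
move=> sA i j; apply: (smooth_ext oD _ (smooth_conj oD (sA j i))) => x _.
by rewrite adjmxE.
Qed.

Lemma smooth_mxtrace (A : V -> 'M[C]_2) : smooth_mx A -> smooth D (fun x => \tr (A x)).
Proof.
move=> sA; apply: (smooth_ext oD _ (smoothD oD (sA 0 0) (sA 1 1))) => x _.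
by rewrite mxtrace2.
Qed.

(** The adjugate formula, which reduces smoothness of the inverse to that of the entries; in ['I_2]
    the map [i |-> 1 - i] exchanges the two indices. *)
Lemma invmx2E (A : 'M[C]_2) : A \in unitmx -> invmx A =
  (\det A)^-1 *: (\matrix_(i, j) (if i == j then A (1 - i) (1 - j) else - A i j)).
Proof.
move=> uA; rewrite -[RHS](mulmxK uA) -[LHS]mul1mx; congr (_ *m _).
have d0 : \det A != 0 by rewrite unitmxE unitfE in uA.
have o1 : (1 - 1 : 'I_2) = 0 by apply: val_inj.
have o2 : (1 - 0 : 'I_2) = 1 by apply: val_inj.
rewrite -scalemxAl (_ : _ *m A = (\det A)%:M) ?scale_scalar_mx ?mulVf//.
rewrite det2; apply: mx22P; rewrite mulmx2E !mxE /= ?o1 ?o2 ?mulr1n ?mulr0n; ring.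
Qed.

Lemma smooth_invmx (A : V -> 'M[C]_2) : smooth_mx A -> (forall x, D x -> A x \in unitmx) ->
  smooth_mx (fun x => invmx (A x)).
Proof.
move=> sA uA.
have sd : smooth D (fun x => (\det (A x))^-1).
  apply: smoothV oD _ _; first by move=> x /uA; rewrite unitmxE unitfE.
  apply: (smooth_ext oD _ (smoothD oD (smoothM oD (sA 0 0) (sA 1 1))
    (smoothN oD (smoothM oD (sA 0 1) (sA 1 0))))) => x _.
  by rewrite det2.
apply: (smooth_mx_ext (A := fun x => (\det (A x))^-1 *:
   (\matrix_(i, j) (if i == j then A x (1 - i) (1 - j) else - A x i j)))).
  by move=> x Dx; rewrite invmx2E// uA.
apply: smooth_mxZ => // i j; case: (boolP (i == j)) => ij.
  by apply: (smooth_ext oD _ (sA (1 - i) (1 - j))) => x _; rewrite mxE ij.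
by apply: (smooth_ext oD _ (smoothN oD (sA i j))) => x _; rewrite mxE (negPf ij).
Qed.

Lemma mxderiveD m n (A B : V -> 'M[C]_(m, n)) x : smooth_mx A -> smooth_mx B -> D x ->
  dm (fun y => A y + B y) x = dm A x + dm B x.
Proof.
move=> sA sB Dx; apply/matrixP => i j; rewrite !mxE.
rewrite -(derivationD dd (sA i j) (sB i j) Dx).
by apply: (derivation_ext dd) => // y _; rewrite mxE.
Qed.

Lemma mxderiveN m n (A : V -> 'M[C]_(m, n)) x : smooth_mx A -> D x ->
  dm (fun y => - A y) x = - dm A x.
Proof.
move=> sA Dx; apply/matrixP => i j; rewrite !mxE -(derivationN dd (sA i j) Dx).
by apply: (derivation_ext dd) => // y _; rewrite mxE.
Qed.

Lemma mxderiveZ m n (f : V -> C) (A : V -> 'M[C]_(m, n)) x : smooth D f ->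
  smooth_mx A -> D x -> dm (fun y => f y *: A y) x = d f x *: A x + f x *: dm A x.
Proof.
move=> sf sA Dx; apply/matrixP => i j; rewrite !mxE -(derivationM dd sf (sA i j) Dx).
by apply: (derivation_ext dd) => // y _; rewrite mxE.
Qed.

Lemma mxderive_cst m n (A : 'M[C]_(m, n)) x : D x -> dm (fun=> A) x = 0.
Proof. by move=> Dx; apply/matrixP => i j; rewrite !mxE (derivation_cst dd). Qed.

Lemma mxderiveM m n (A : V -> 'M[C]_(m, 2)) (B : V -> 'M[C]_(2, n)) x :
  smooth_mx A -> smooth_mx B -> D x ->
  dm (fun y => A y *m B y) x = dm A x *m B x + A x *m dm B x.
Proof.
move=> sA sB Dx; apply/matrixP => i j; rewrite mxE [RHS]mxE !mulmx2E !mxE.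
rewrite (derivation_ext dd (g := fun y => A y i 0 * B y 0 j + A y i 1 * B y 1 j)) //; last first.
  by move=> y _; rewrite mulmx2E.
rewrite (derivationD dd (smoothM oD (sA i 0) (sB 0 j)) (smoothM oD (sA i 1) (sB 1 j)) Dx).
by rewrite (derivationM dd (sA i 0) (sB 0 j) Dx) (derivationM dd (sA i 1) (sB 1 j) Dx) addrACA.
Qed.

Lemma mxderive_trace (A : V -> 'M[C]_2) x : smooth_mx A -> D x ->
  d (fun y => \tr (A y)) x = \tr (dm A x).
Proof.
move=> sA Dx; rewrite mxtrace2 !mxE -(derivationD dd (sA 0 0) (sA 1 1) Dx).
by apply: (derivation_ext dd) => // y _; rewrite mxtrace2.
Qed.

(** Differentiate A A^-1 = 1. *)
Lemma derive_invmx (A : V -> 'M[C]_2) x : smooth_mx A ->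
  (forall x, D x -> A x \in unitmx) -> D x ->
  dm (fun y => invmx (A y)) x = - (invmx (A x) *m dm A x *m invmx (A x)).
Proof.
move=> sA uA Dx; have sV := smooth_invmx sA uA.
have : dm (fun y => A y *m invmx (A y)) x = 0.
  rewrite -[RHS](mxderive_cst (1%:M : 'M[C]_2) Dx); apply: mxderive_ext => // y Dy.
  by rewrite mulmxV// uA.
rewrite (mxderiveM sA sV Dx) => /eqP; rewrite addrC addr_eq0 => /eqP e.
by rewrite -[LHS](mulKmx (uA _ Dx)) e mulmxN !mulmxA.
Qed.

End Rules.

Lemma mxderive_comm a v b w a' v' b' w' m n (A : V -> 'M[C]_(m, n)) x :
  smooth_mx A -> D x ->
  mxderive (lin_derive a v b w) (mxderive (lin_derive a' v' b' w') A) x =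
  mxderive (lin_derive a' v' b' w') (mxderive (lin_derive a v b w) A) x.
Proof.
move=> sA Dx; apply/matrixP => i j.
apply: (etrans (mxderiveE _ _ _ _ _)); apply: (etrans _ (esym (mxderiveE _ _ _ _ _))).
have e d0 d1 : derivation d1 -> d1 (fun y => mxderive d0 A y i j) x = d1 (d0 (fun y => A y i j)) x.
  by move=> dd1; apply: (derivation_ext dd1) => // y _; rewrite mxderiveE.
apply: (etrans (e _ _ (lin_derive_derivation a v b w))).
apply: (etrans _ (esym (e _ _ (lin_derive_derivation a' v' b' w')))).
exact (lin_derive_comm a v b w a' v' b' w' (sA i j) Dx).
Qed.

Lemma mxderive_adj a v b w m n (A : V -> 'M[C]_(m, n)) x : smooth_mx A -> D x ->
  mxderive (lin_derive a v b w) (fun y => adjmx (A y)) x =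
  adjmx (mxderive (lin_derive (conjc a) v (conjc b) w) A x).
Proof.
move=> sA Dx; apply/matrixP => i j; rewrite adjmxE !mxderiveE.
apply: (etrans _ (lin_derive_conj a v b w (sA j i) Dx)).
by apply: (derivation_ext (lin_derive_derivation a v b w)) => // y _; rewrite adjmxE.
Qed.

End Derivations.

(* Variation of the Chern connection and a Bochner formula for the metric variation *)
Local Opaque mxderive lin_derive.

(** A commutator with [T] is orthogonal to [T] for the trace form, so the covariant derivative may
    replace the plain one when differentiating tr T^2. *)
Lemma mxtrace_commutator_sqr (F : fieldType) (T K A : 'M[F]_2) :
  \tr ((K + (T *m A - A *m T)) *m T + T *m (K + (T *m A - A *m T))) = 2 * \tr (T *m K).
Proof.
have e : \tr (T *m (K + (T *m A - A *m T))) = \tr (T *m K).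
  rewrite mulmxDr mxtraceD mulmxBr raddfB /= !mulmxA.
  by rewrite [\tr (T *m A *m T)]mxtrace_mulC mulmxA subrr addr0.
by rewrite mxtraceD [\tr (_ *m T)]mxtrace_mulC e; ring.
Qed.

Section ChernVariation.
Variables (R : realType) (V : normedModType R) (D : set V).
Hypothesis oD : open D.
Local Notation C := R[i].
Variables (a b : C) (v w u : V) (H : V -> 'M[C]_2).
Hypothesis sH : smooth_mx D H.
Hypothesis pH : forall x, D x -> posdef (H x).

Local Notation dz := (lin_derive a v b w).
Local Notation db := (lin_derive (conjc a) v (conjc b) w).
Local Notation dt := (lin_derive 1 u 0 u).

Let uH x : D x -> H x \in unitmx. Proof. by move=> /pH/posdef_unitmx. Qed.
Let Dz : derivation D dz := lin_derive_derivation oD a v b w.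
Let Db : derivation D db := lin_derive_derivation oD (conjc a) v (conjc b) w.
Let Dt : derivation D dt := lin_derive_derivation oD 1 u 0 u.

Lemma smooth_invmx_derive d : derivation D d ->
  smooth_mx D (fun y => invmx (H y) *m mxderive d H y).
Proof.
by move=> dd; exact (smooth_mxM oD (smooth_invmx oD sH uH) (smooth_mxderive oD dd sH)).
Qed.

Lemma derive_invmx_derive d1 d2 x : derivation D d1 -> derivation D d2 -> D x ->
  mxderive d1 (fun y => invmx (H y) *m mxderive d2 H y) x =
  invmx (H x) *m (mxderive d1 (mxderive d2 H) x -
                  mxderive d1 H x *m invmx (H x) *m mxderive d2 H x).
Proof.
move=> dd1 dd2 Dx.
rewrite (mxderiveM oD dd1 (smooth_invmx oD sH uH) (smooth_mxderive oD dd2 sH) Dx).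
rewrite (derive_invmx oD dd1 sH uH Dx) mulmxBr addrC; congr (_ + _).
by rewrite mulNmx !mulmxA.
Qed.

Definition connection y : 'M[C]_2 := invmx (H y) *m mxderive dz H y.
Definition metric_variation y : 'M[C]_2 := invmx (H y) *m mxderive dt H y.
(** With theta the metric variation and A the connection form, this is also the covariant derivative
    D' theta = dz theta + [A, theta]; in the application Gamma = t theta. *)
Definition dconnection y : 'M[C]_2 := mxderive dt connection y.

Lemma smooth_connection : smooth_mx D connection.
Proof. exact (smooth_invmx_derive Dz). Qed.

Lemma smooth_variation : smooth_mx D metric_variation.
Proof. exact (smooth_invmx_derive Dt). Qed.

Lemma smooth_dconnection : smooth_mx D dconnection.
Proof. exact (smooth_mxderive oD Dt smooth_connection). Qed.

Lemma adjmx_derive (a' b' : C) (v' w' : V) x : D x ->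
  adjmx (mxderive (lin_derive a' v' b' w') H x) =
  mxderive (lin_derive (conjc a') v' (conjc b') w') H x.
Proof.
move=> Dx; have := mxderive_adj oD (conjc a') v' (conjc b') w' sH Dx.
rewrite !conjcK => <-.
by apply: (mxderive_ext (lin_derive_derivation oD _ _ _ _)) => // y /pH[].
Qed.

Lemma conjc01 : conjc (1 : C) = 1 /\ conjc (0 : C) = 0.
Proof. by split; [exact: (rmorph1 (@conjc R))|exact: (rmorph0 (@conjc R))]. Qed.

Lemma adjmx_dtH x : D x -> adjmx (mxderive dt H x) = mxderive dt H x.
Proof. by move=> Dx; rewrite adjmx_derive//; have [-> ->] := conjc01. Qed.

Lemma hadj_variation x : D x -> hadj (H x) (metric_variation x) = metric_variation x.
Proof.
move=> Dx; apply/(hadj_self (pH Dx)).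
by rewrite /metric_variation mulKVmx ?uH// adjmx_dtH.
Qed.

(** theta is self-adjoint, and taking adjoints exchanges D' with dzbar. Concretely, [H] is
    Hermitian, so the adjoint of d_t dz H is dzbar d_t H, and the quadratic terms match as well. *)
Lemma derive_db_variation x : D x ->
  mxderive db metric_variation x = hadj (H x) (dconnection x).
Proof.
move=> Dx; rewrite /metric_variation /dconnection /connection.
rewrite (derive_invmx_derive Db Dt Dx) (derive_invmx_derive Dt Dz Dx).
rewrite /hadj adjmxM (adjmx_invmx (pH Dx)) -!mulmxA mulVmx ?uH// mulmx1.
have e1 := adjmx_derive a b v w Dx; have e2 := adjmx_dtH Dx.
have e3 : adjmx (mxderive dt (mxderive dz H) x) = mxderive db (mxderive dt H) x.
  apply: (etrans _ (mxderive_comm oD 1 u 0 u (conjc a) v (conjc b) w sH Dx)).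
  have := mxderive_adj oD 1 u 0 u (smooth_mxderive oD Dz sH) Dx.
  have [-> ->] := conjc01 => <-.
  by apply: (mxderive_ext Dt) => // y Dy; exact (adjmx_derive a b v w Dy).
move: e1 e2 e3.
move: (mxderive dt (mxderive dz H) x) (mxderive db (mxderive dt H) x) => P Q.
move: (mxderive dz H x) (mxderive db H x) (mxderive dt H x) => Hz Hb Ht e1 e2 e3.
by rewrite adjmxD adjmxN !adjmxM (adjmx_invmx (pH Dx)) e1 e2 e3 mulmxA.
Qed.

(** The mixed derivatives of [H] agree; the quadratic terms differ by the order of their factors,
    which leaves the commutator of theta with the connection form. *)
Lemma derive_dz_variation x : D x -> mxderive dz metric_variation x =
  dconnection x + (metric_variation x *m connection x - connection x *m metric_variation x).
Proof.
move=> Dx.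
have e1 := derive_invmx_derive Dz Dt Dx; have e2 := derive_invmx_derive Dt Dz Dx.
have e3 := mxderive_comm oD a v b w 1 u 0 u sH Dx.
rewrite -/(dconnection x) in e2.
apply: (etrans e1); rewrite {}e2 /connection /metric_variation; move: e3.
move: (mxderive dt (mxderive dz H) x) (mxderive dz (mxderive dt H) x) => P Q ->.
move: (mxderive dz H x) (mxderive dt H x) => Hz Ht.
by rewrite !mulmxBr !mulmxA addrA subrK.
Qed.

Lemma derive_db_dconnection x : D x ->
  mxderive db dconnection x = mxderive dt (mxderive db connection) x.
Proof. by move=> Dx; exact: (mxderive_comm oD _ _ _ _ _ _ _ _ smooth_connection Dx). Qed.

(** dz tr theta^2 = 2 tr (theta K), since the connection form drops out. Applying dzbar, the factor
    theta gives the adjoint of K and hence |K|^2; the factor K gives the t-derivative of the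
    curvature, which the equation controls. *)
Lemma laplacian_mxtrace_sqr x : D x ->
  db (dz (fun y => \tr (metric_variation y *m metric_variation y))) x =
  2 * \tr (dconnection x *m hadj (H x) (dconnection x)) +
  2 * \tr (metric_variation x *m mxderive db dconnection x).
Proof.
move=> Dx; have sV := smooth_variation; have sK := smooth_dconnection.
have step y : D y -> dz (fun y => \tr (metric_variation y *m metric_variation y)) y =
    2 * \tr (metric_variation y *m dconnection y).
  move=> Dy; rewrite (mxderive_trace Dz (smooth_mxM oD sV sV) Dy).
  rewrite (mxderiveM oD Dz sV sV Dy) (derive_dz_variation Dy).
  exact: mxtrace_commutator_sqr.
rewrite (derivation_ext Db step Dx).
have sP := smooth_mxM oD sV sK.
rewrite (derivationZ 2 Db (smooth_mxtrace oD sP) Dx).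
rewrite (mxderive_trace Db sP Dx) (mxderiveM oD Db sV sK Dx).
by rewrite mxtraceD mulrDr (derive_db_variation Dx) [\tr (hadj _ _ *m _)]mxtrace_mulC.
Qed.

(** Jacobi's formula: the trace of H^-1 H' is the logarithmic derivative of det H. *)
Lemma mxtrace_variation x : D x -> dt (fun y => \det (H y)) x = 0 ->
  \tr (metric_variation x) = 0.
Proof.
move=> Dx e0; have s i j := sH i j.
have E i j : dt (fun y => H y i j) x = mxderive dt H x i j by exact (esym (mxderiveE dt H x i j)).
have e1 : dt (fun y => \det (H y)) x =
    dt (fun y => H y 0 0 * H y 1 1 + - (H y 0 1 * H y 1 0)) x.
  by apply: (derivation_ext Dt) => // y _; rewrite det2.
have e2 := derivationD Dt (smoothM oD (s 0 0) (s 1 1)) (smoothN oD (smoothM oD (s 0 1) (s 1 0))) Dx.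
have e3 := derivationN Dt (smoothM oD (s 0 1) (s 1 0)) Dx.
have e4 := derivationM Dt (s 0 0) (s 1 1) Dx.
have e5 := derivationM Dt (s 0 1) (s 1 0) Dx.
rewrite !E in e4 e5; have := etrans (esym e0) (etrans e1 e2).
rewrite {}e3 {}e4 {}e5 /metric_variation invmx2E ?uH// -scalemxAl mxtraceZ mxtrace2 !mulmx2E.
move: (mxderive dt H x) => M e.
have o1 : (1 - 1 : 'I_2) = 0 by apply: val_inj.
have o2 : (1 - 0 : 'I_2) = 1 by apply: val_inj.
rewrite !mxE /= o1 o2; apply/eqP; rewrite mulf_eq0; apply/orP; right; apply/eqP.
by rewrite e; ring.
Qed.

(** For a fixed matrix only the two copies of the metric in H^-1 B^* H vary; together they give a
    commutator with theta. *)
Lemma derive_hadj (B : 'M[C]_2) x : D x -> mxderive dt (fun y => hadj (H y) B) x =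
  hadj (H x) B *m metric_variation x - metric_variation x *m hadj (H x) B.
Proof.
move=> Dx; rewrite /hadj.
have sV := smooth_invmx oD sH uH.
have sB := smooth_mx_cst D (adjmx B).
rewrite (mxderiveM oD Dt (smooth_mxM oD sV sB) sH Dx).
rewrite (mxderiveM oD Dt sV sB Dx) (mxderive_cst Dt _ Dx) mulmx0 addr0.
rewrite (derive_invmx oD Dt sH uH Dx) /metric_variation addrC.
by congr (_ + _); rewrite ?mulNmx !mulmxA ?mulmxKV ?mulmxK ?uH//.
Qed.

Lemma smooth_hadj (B : 'M[C]_2) : smooth_mx D (fun y => hadj (H y) B).
Proof.
apply: (smooth_mxM oD (smooth_mxM oD (smooth_invmx oD sH uH) (smooth_mx_cst D (adjmx B))) sH).
Qed.

(** [B] is a constant matrix, since the point of the surface is fixed while t varies; [f] will be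
    t^2. *)
Lemma derive_higgs_curvature (f : V -> C) (B : 'M[C]_2) x : smooth D f -> D x ->
  let S := hadj (H x) B in let X := S *m metric_variation x - metric_variation x *m S in
  mxderive dt (fun y => f y *: (B *m hadj (H y) B - hadj (H y) B *m B)) x =
  dt f x *: (B *m S - S *m B) + f x *: (B *m X - X *m B).
Proof.
move=> sf Dx S X; have sS := smooth_hadj B; have sB := smooth_mx_cst D B.
have sSB := smooth_mxM oD sS sB.
have s1 := smooth_mxD oD (smooth_mxM oD sB sS) (smooth_mxN oD sSB).
rewrite (mxderiveZ Dt sf s1 Dx); congr (_ + _ *: _).
rewrite (mxderiveD Dt (smooth_mxM oD sB sS) (smooth_mxN oD sSB) Dx).
rewrite (mxderiveN Dt sSB Dx) (mxderiveM oD Dt sB sS Dx) (mxderiveM oD Dt sS sB Dx).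
by rewrite (mxderive_cst Dt _ Dx) mul0mx mulmx0 add0r addr0 derive_hadj.
Qed.

End ChernVariation.

Local Transparent mxderive lin_derive.


(** * Functions of (t, x, y), restricted to a fixed time or to a time line *)

Section Slices.
Variable R : realType.
Local Notation C := R[i].
Local Notation plane2 := (R * R)%type.
Local Notation T := (R * (R * R))%type.

Definition dir_t : T := (1, (0, 0)).
Definition dir_x : T := (0, (1, 0)).
Definition dir_y : T := (0, (0, 1)).

Lemma derive_slice_growth (F : T -> R) t (p v : plane2) :
  (fun h : R => h^-1 *: (((fun p => F (t, p)) \o shift p) (h *: v) - F (t, p)) : R) =
  (fun h => h^-1 *: ((F \o shift (t, p)) (h *: ((0, v) : T)) - F (t, p))).
Proof.
apply/funext => h /=; congr (_ *: (F _ - _)).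
by congr (_, _); rewrite /= scaler0 add0r.
Qed.

Lemma derive_slice (F : T -> R) t (p v : plane2) :
  'D_v (fun p => F (t, p)) p = 'D_((0, v) : T) F (t, p).
Proof. by rewrite /derive derive_slice_growth. Qed.

Lemma derivable_slice (F : T -> R) t (p v : plane2) :
  derivable F (t, p) ((0, v) : T) -> derivable (fun p => F (t, p)) p v.
Proof. by rewrite /derivable derive_slice_growth. Qed.

Lemma derive_time (F : T -> R) t (p : plane2) :
  'D_1 (fun s => F (s, p)) t = 'D_dir_t F (t, p).
Proof.
have e : (fun h : R => h^-1 *: (((fun s => F (s, p)) \o shift t) (h *: 1) - F (t, p)) : R) =
    (fun h => h^-1 *: ((F \o shift (t, p)) (h *: dir_t) - F (t, p))).
  apply/funext => h /=; congr (_ *: (F _ - _)); congr (_, _).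
  by change (p = h *: (0 : plane2) + p); rewrite scaler0 add0r.
by rewrite /derive e.
Qed.

Lemma slice_continuous t : continuous (fun p : plane2 => (t, p) : T).
Proof.
move=> p; exact: (@cvg_pair _ _ _ (nbhs p) (nbhs t) (nbhs p) (nbhs_filter p)
  (nbhs_filter t) (nbhs_filter p) (fun=> t) id (cvg_cst t) (@cvg_id _ (nbhs p))).
Qed.

Lemma open_slice (D : set T) t : open D -> open [set p | D (t, p)].
Proof. by move=> oD; apply: (open_comp _ oD) => p _; exact: slice_continuous. Qed.

Lemma Ck_slice n (D : set T) (F : T -> R) t : Ck n D F ->
  Ck n [set p | D (t, p)] (fun p => F (t, p)).
Proof.
have cF (F' : T -> R) m p : Ck m D F' -> D (t, p) ->
    {for p, continuous (fun p => F' (t, p))}.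
  by move=> CF Dp; apply: continuous_comp; [exact: slice_continuous|exact: (CkW CF Dp)].
elim: n F => [|n IH] F CF; first exact (conj (fun p Dp => cF F _ p CF Dp) I).
split=> [p Dp|v]; first exact: cF CF Dp.
split=> [p Dp|]; first exact: derivable_slice (Ck_derivable CF Dp).
have -> : (fun p => 'D_v (fun p => F (t, p)) p) = (fun p => 'D_((0, v) : T) F (t, p)).
  by apply/funext => p; exact: derive_slice.
exact: (IH _ (Ck_derive ((0, v) : T) CF)).
Qed.

Lemma smooth_slice (D : set T) (F : T -> C) t : smooth D F ->
  smooth [set p | D (t, p)] (fun p => F (t, p)).
Proof. by move=> sF n; have [C1 C2] := sF n; split; [exact: Ck_slice C1|exact: Ck_slice C2]. Qed.

Lemma pderive_slice (D : set T) (F : T -> C) (f : C -> C) t p (v : plane2) : open D ->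
  (forall p, D (t, p) -> f (plane p) = F (t, p)) -> D (t, p) ->
  pderive v f (plane p) = cderive ((0, v) : T) F (t, p).
Proof.
move=> oD fF Dp; rewrite /pderive.
have nD : \forall y \near p, D (t, y).
  by apply: open_nbhs_nbhs; split; [exact: open_slice|exact: Dp].
have -> : (Re (plane p), Im (plane p)) = p by case: (p).
apply: (f_equal2 (@Complex R)).
  apply: (etrans _ (derive_slice (fun q => Re (F q)) t p v)); apply: near_eq_derive.
  by apply: filterS nD => y Dy; rewrite fF.
apply: (etrans _ (derive_slice (fun q => Im (F q)) t p v)); apply: near_eq_derive.
by apply: filterS nD => y Dy; rewrite fF.
Qed.

Definition dz3 : (T -> C) -> T -> C := lin_derive (1 / 2) dir_x (- 'i%C / 2) dir_y.
(** The coefficients are kept as conjugates of those of [dz3], so that the two operators form the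
    pair to which the variation formulas apply. *)
Definition dzb3 : (T -> C) -> T -> C :=
  lin_derive (conjc (1 / 2)) dir_x (conjc (- 'i%C / 2)) dir_y.
Definition dt3 : (T -> C) -> T -> C := lin_derive 1 dir_t 0 dir_t.

Lemma wirtinger_conj : conjc (1 / 2 : C) = 1 / 2 /\ conjc (- 'i%C / 2 : C) = 'i%C / 2.
Proof.
have e2 : conjc (2^-1 : C) = 2^-1 by rewrite (fmorphV (@conjc R)) (rmorph_nat (@conjc R)).
have ei : conjc (- 'i%C : C) = 'i%C by apply: complex_ReIm_eq; rewrite /= ?oppr0 ?opprK.
by rewrite !conjcM ei e2 (rmorph1 (@conjc R)).
Qed.

Lemma dz_slice (D : set T) (F : T -> C) (f : C -> C) t p : open D ->
  (forall p, D (t, p) -> f (plane p) = F (t, p)) -> D (t, p) ->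
  dz f (plane p) = dz3 F (t, p).
Proof.
move=> oD fF Dp; rewrite /dz /dz3 /lin_derive.
rewrite (pderive_slice (1, 0) oD fF Dp) (pderive_slice (0, 1) oD fF Dp).
by rewrite mulrBl mul1r mulrC; congr (_ + _); rewrite mulrAC !mulNr.
Qed.

Lemma dzbar_slice (D : set T) (F : T -> C) (f : C -> C) t p : open D ->
  (forall p, D (t, p) -> f (plane p) = F (t, p)) -> D (t, p) ->
  dzbar f (plane p) = dzb3 F (t, p).
Proof.
move=> oD fF Dp; rewrite /dzbar /dzb3; have [-> ->] := wirtinger_conj.
rewrite /lin_derive (pderive_slice (1, 0) oD fF Dp) (pderive_slice (0, 1) oD fF Dp).
by rewrite mulrDl mul1r mulrC; congr (_ + _); rewrite mulrAC.
Qed.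

Lemma dt3E (F : T -> C) q : dt3 F q = cderive dir_t F q.
Proof. by rewrite /dt3 /lin_derive mul1r mul0r addr0. Qed.

Lemma dt3_time (F : T -> C) (t : R) (p : plane2) :
  dt3 F (t, p) = ('D_1 (fun s => Re (F (s, p)) : R) t) +i*
                 ('D_1 (fun s => Im (F (s, p)) : R) t).
Proof.
rewrite dt3E; apply: (f_equal2 (@Complex R)).
  exact (esym (derive_time (fun q => Re (F q)) t p)).
exact (esym (derive_time (fun q => Im (F q)) t p)).
Qed.

(** Only values on the time line through the point count, so an identity may be differentiated in t
    even if one side is not known to be smooth in space. *)
Lemma dt3_line (F G : T -> C) (t : R) (p : plane2) :
  (\forall s \near t, F (s, p) = G (s, p)) -> dt3 F (t, p) = dt3 G (t, p).
Proof.
move=> FG; rewrite !dt3_time; apply: (f_equal2 (@Complex R)); apply: near_eq_derive;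
  by apply: filterS FG => s ->.
Qed.

Lemma wirtinger_algebra (A B M M' : C) : M' = M ->
  1 / 2 * (1 / 2 * A + - 'i%C / 2 * M) + 'i%C / 2 * (1 / 2 * M' + - 'i%C / 2 * B) =
  4^-1 * (A + B).
Proof.
move=> ->; have i2 : 'i%C * 'i%C = -1 :> C by rewrite -expr2 sqr_i.
transitivity (4^-1 * (A - ('i%C * 'i%C) * B)); first by field.
by rewrite i2 mulN1r opprK.
Qed.

Local Opaque cderive dir_x dir_y.

Lemma dzb3_dz3 (D : set T) (F : T -> C) q : open D -> smooth D F -> D q ->
  dzb3 (dz3 F) q = 4^-1 *
    (cderive dir_x (cderive dir_x F) q + cderive dir_y (cderive dir_y F) q).
Proof.
move=> oD sF Dq; rewrite /dzb3 /dz3; have [-> ->] := wirtinger_conj.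
rewrite [LHS]/lin_derive.
rewrite !(cderive_lin_derive oD _ _ _ _ _ sF Dq).
exact (wirtinger_algebra (cderive dir_x (cderive dir_x F) q)
  (cderive dir_y (cderive dir_y F) q) (cderive_comm dir_x dir_y oD Dq sF)).
Qed.

Local Transparent cderive dir_x dir_y.

Lemma laplacian_wirtinger (D : set T) (F : T -> C) q : open D -> smooth D F -> D q ->
  'D_dir_x (fun y => 'D_dir_x (fun z => Re (F z) : R) y) q +
  'D_dir_y (fun y => 'D_dir_y (fun z => Re (F z) : R) y) q = 4 * Re (dzb3 (dz3 F) q).
Proof.
move=> oD sF Dq; have e := dzb3_dz3 oD sF Dq.
have h (z w : C) : z = 4^-1 * w -> 4 * Re z = Re w.
  move=> ez; have n4 : (4 : C) != 0 by rewrite pnatr_eq0.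
  have -> : w = 4 * z by rewrite ez mulVKf.
  rewrite Re_mulc; case: (z) => x y /=; ring.
by rewrite (h _ _ e) Re_addc.
Qed.

Lemma laplacian_slice (F : T -> R) t p :
  'D_((1, 0) : plane2) (fun y => 'D_((1, 0) : plane2) (fun p => F (t, p)) y) p +
  'D_((0, 1) : plane2) (fun y => 'D_((0, 1) : plane2) (fun p => F (t, p)) y) p =
  'D_dir_x (fun y => 'D_dir_x F y) (t, p) + 'D_dir_y (fun y => 'D_dir_y F y) (t, p).
Proof.
have e (v : plane2) : (fun y => 'D_v (fun p => F (t, p)) y) =
    (fun y => (fun q => 'D_((0, v) : T) F q) (t, y)).
  by apply/funext => y; exact: derive_slice.
by rewrite !e; apply: (f_equal2 +%R); exact: (derive_slice (fun q => 'D__ F q)).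
Qed.

Lemma smooth_time (D : set T) : smooth D (fun q => (q.1)%:C).
Proof. by move=> n; split; [exact: Ck_fst|exact: Ck_cst]. Qed.

End Slices.
Arguments dz3 {R}.
Arguments dzb3 {R}.
Arguments dt3 {R}.
Arguments dir_t {R}.
Arguments dir_x {R}.
Arguments dir_y {R}.

(** * The family of harmonic metrics in a chart and a frame *)

Section LocalFamily.
Variables (R : realType) (X : riemann_surface R) (E : bundle X 2).
Variables (phi : idx X -> bidx E -> X -> 'M[R[i]]_2) (H : R -> bidx E -> X -> 'M[R[i]]_2).
Hypothesis bdom_open : forall j : bidx E, open (bdom j).
Hypothesis H_harmonic : forall t : R, 0 < t ->
  harmonic_metric (fun i j x => t%:C *: phi i j x) (H t).
Hypothesis H_smooth : smooth_family H.
Variables (i : idx X) (j : bidx E).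
Local Notation C := R[i].
Local Notation plane2 := (R * R)%type.
Local Notation T := (R * (R * R))%type.

Definition chart_pt (p : plane2) : X := Defs.inv i (plane p).
Definition pt_chart (x : X) : plane2 := (Re (crd i x), Im (crd i x)).

Definition family_dom : set T :=
  [set q | [/\ 0 < q.1, (crd i @` dom i) (plane q.2) & bdom j (chart_pt q.2)]].

Definition metric_family (q : T) : 'M[C]_2 := H q.1 j (chart_pt q.2).

Lemma pt_chartK x : dom i x -> chart_pt (pt_chart x) = x.
Proof. by move=> ix; rewrite /chart_pt plane_ReIm crdK. Qed.

Lemma chart_ptK p : (crd i @` dom i) (plane p) ->
  dom i (chart_pt p) /\ crd i (chart_pt p) = plane p.
Proof. by rewrite /chart_pt => -[x ix <-]; rewrite crdK. Qed.

Lemma family_dom_pt t x : 0 < t -> dom i x -> bdom j x -> family_dom (t, pt_chart x).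
Proof.
move=> t0 ix jx; split=> //=; last by rewrite pt_chartK.
by rewrite plane_ReIm; exists x.
Qed.

Lemma chart_pt_continuous p : (crd i @` dom i) (plane p) -> {for p, continuous chart_pt}.
Proof.
move=> ip; apply: continuous_comp; first exact: plane_continuous.
have [ix e] := chart_ptK ip.
by have := Defs.inv_continuous ix; rewrite e.
Qed.

Lemma family_dom_open : open family_dom.
Proof.
rewrite openE => -[t p] [t0 ip jp].
have n1 : \forall q \near (t, p), 0 < q.1.
  have c : (fun q : T => q.1) @ (t, p) --> t by exact: cvg_fst.
  by move/cvgr_gt: c; apply.
have c2 : (fun q : T => q.2) @ (t, p) --> p by exact: cvg_snd.
have n2 : \forall q \near (t, p), (crd i @` dom i) (plane q.2).
  have n : \forall p' \near p, (crd i @` dom i) (plane p').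
    apply: (@plane_continuous R p); apply: open_nbhs_nbhs; split=> //; exact: img_open.
  exact: (c2 _ n).
have n3 : \forall q \near (t, p), bdom j (chart_pt q.2).
  have n : \forall p' \near p, bdom j (chart_pt p').
    apply: (chart_pt_continuous ip); apply: open_nbhs_nbhs; split=> //; exact: bdom_open.
  exact: (c2 _ n).
by apply: filterS3 n1 n2 n3.
Qed.

Lemma family_smooth : smooth_mx family_dom metric_family.
Proof. by move=> a b; exact: (H_smooth i j a b). Qed.

Lemma family_posdef q : family_dom q -> posdef (metric_family q).
Proof. by move=> [t0 _ jq]; have [[_ pH _] _] := H_harmonic t0; exact: pH. Qed.

Definition fconnection : T -> 'M[C]_2 :=
  connection (1 / 2) (- 'i%C / 2) dir_x dir_y metric_family.
Definition fvariation : T -> 'M[C]_2 := metric_variation dir_t metric_family.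
Definition fdconnection : T -> 'M[C]_2 :=
  dconnection (1 / 2) (- 'i%C / 2) dir_x dir_y dir_t metric_family.

Section DomainSlice.
Variables (D : set T) (m n : nat) (A : X -> 'M[C]_(m, n)) (F : T -> 'M[C]_(m, n)).
Hypotheses (oD : open D) (sD : D `<=` family_dom).
Variables (t : R) (p : plane2).
Hypothesis AF : forall p, D (t, p) -> A (chart_pt p) = F (t, p).
Hypothesis Dp : D (t, p).

Lemma dz_mx_slice : dz_mx i A (chart_pt p) = mxderive dz3 F (t, p).
Proof.
have [_ ip _] := sD Dp; have [_ e] := chart_ptK ip.
apply/matrixP => a b; rewrite mxderiveE mxE e.
apply: (dz_slice (F := fun q => F q a b) oD _ Dp) => p' Dp'.
by rewrite -AF.
Qed.

Lemma dzbar_mx_slice : dzbar_mx i A (chart_pt p) = mxderive dzb3 F (t, p).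
Proof.
have [_ ip _] := sD Dp; have [_ e] := chart_ptK ip.
apply/matrixP => a b; rewrite mxderiveE mxE e.
apply: (dzbar_slice (F := fun q => F q a b) oD _ Dp) => p' Dp'.
by rewrite -AF.
Qed.

End DomainSlice.

Lemma dz_mx_family t p : family_dom (t, p) ->
  dz_mx i (H t j) (chart_pt p) = mxderive dz3 metric_family (t, p).
Proof. by move=> Dp; exact: (dz_mx_slice family_dom_open (@subset_refl _ _) _ Dp). Qed.

Lemma chern_connectionE t p : family_dom (t, p) ->
  invmx (H t j (chart_pt p)) *m dz_mx i (H t j) (chart_pt p) = fconnection (t, p).
Proof. by move=> Dp; rewrite dz_mx_family. Qed.

(** The curvature is minus dzbar of the connection form, and t is real, so t phi and its adjoint
    together contribute t^2. *)
Lemma derive_dzb_fconnection t p : family_dom (t, p) ->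
  mxderive dzb3 fconnection (t, p) = (t%:C ^+ 2) *:
   (phi i j (chart_pt p) *m hadj (metric_family (t, p)) (phi i j (chart_pt p)) -
    hadj (metric_family (t, p)) (phi i j (chart_pt p)) *m phi i j (chart_pt p)).
Proof.
move=> Dp; have [t0 ip jp] := Dp; have [ix _] := chart_ptK ip.
have [_ /(_ i j _ ix jp)] := H_harmonic t0; rewrite /chern_curvature.
have -> := dzbar_mx_slice (A := fun y => invmx (H t j y) *m dz_mx i (H t j) y)
  family_dom_open (@subset_refl _ _) (fun p Dp => @chern_connectionE t p Dp) Dp.
rewrite addrC => /eqP; rewrite subr_eq0 => /eqP <-.
have pH := family_posdef Dp; rewrite /metric_family /= in pH.
have cR : conjc (t%:C) = t%:C by apply: complex_ReIm_eq; rewrite /= ?oppr0.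
by rewrite hadjZ// cR -!scalemxAl -!scalemxAr !scalerA -expr2 -scalerBr.
Qed.

Lemma Gamma_family t p : Gamma H t j (chart_pt p) = t%:C *: fvariation (t, p).
Proof.
rewrite /Gamma /fvariation /metric_variation; congr (_ *: (_ *m _)).
apply/matrixP => a b; rewrite mxderiveE mxE.
exact (esym (dt3_time (fun q => metric_family q a b) t p)).
Qed.

(* [phi] is only known to be complex differentiable at each point, so the curvature
   equation is differentiated in [t] along a line, on which [phi] is constant. *)
Lemma derive_dzb_fdconnection t p : family_dom (t, p) ->
  let B := phi i j (chart_pt p) in let S := hadj (metric_family (t, p)) B in
  let Y := S *m fvariation (t, p) - fvariation (t, p) *m S in
  mxderive dzb3 fdconnection (t, p) =
  (2 * t%:C) *: (B *m S - S *m B) + (t%:C ^+ 2) *: (B *m Y - Y *m B).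
Proof.
move=> Dp B S Y.
have oD := family_dom_open.
apply: (etrans (derive_db_dconnection oD _ _ _ _ _ family_smooth family_posdef Dp)).
pose f (q : T) : C := q.1%:C ^+ 2.
have sf : smooth family_dom f by apply: (smoothM oD); exact: smooth_time.
have dtf : dt3 f (t, p) = 2 * t%:C.
  have s := @smooth_time R family_dom.
  apply: (etrans (derivationM (lin_derive_derivation oD 1 dir_t 0 dir_t) s s Dp)).
  rewrite -/dt3 dt3_time /=.
  have -> : 'D_1 (fun s : R => s) t = 1 :> R by exact: derive_id.
  rewrite derive_cst /= mul1r mulr1; ring.
have <- : mxderive dt3 (fun q => f q *: (B *m hadj (metric_family q) B - hadj (metric_family q) B *m B)) (t, p) =
   (2 * t%:C) *: (B *m S - S *m B) + (t%:C ^+ 2) *: (B *m Y - Y *m B).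
  rewrite -dtf.
  exact (derive_higgs_curvature oD dir_t family_smooth family_posdef B sf Dp).
apply/matrixP => a b; rewrite !mxderiveE; apply: dt3_line.
have [t0 ip jp] := Dp.
have n : \forall s \near t, 0 < s by have /cvgr_gt := @cvg_id _ (nbhs t); apply.
apply: filterS n => s s0; have Ds : family_dom (s, p) by split.
exact (f_equal (fun M : 'M[C]_2 => M a b) (derive_dzb_fconnection Ds)).
Qed.

End LocalFamily.

Lemma realCX (R : realType) (a : R) n : (a ^+ n)%:C = a%:C ^+ n :> R[i].
Proof. exact: (rmorphXn (real_complex R)). Qed.

Lemma exists_sqrt_gt1 (R : realType) (x : R) : 1 < x -> exists2 g, 1 < g & g ^+ 2 = x.
Proof.
move=> x1; have x0 : 0 < x by exact: lt_trans ltr01 x1.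
exists (Num.sqrt x); last by rewrite sqr_sqrtr// ltW.
by rewrite -[X in X < _](sqrtr1 R) ltr_sqrt.
Qed.

Lemma hadjZ_real (R : realType) r (H A : 'M[R[i]]_r) (t : R) : hadj H A = A ->
  hadj H (t%:C *: A) = t%:C *: A.
Proof.
move=> hA; rewrite hadjZ hA; congr (_ *: _).
by apply: complex_ReIm_eq; rewrite //= oppr0.
Qed.

Lemma hadj_commutator (R : realType) r (H A B : 'M[R[i]]_r) : posdef H -> hadj H A = A ->
  hadj H (A *m B - B *m A) = hadj H B *m A - A *m hadj H B.
Proof. by move=> pH hA; rewrite hadjD hadjN !hadjM// hA. Qed.

Lemma tracefree_sqr_gt1 (R : realType) (H A : 'M[R[i]]_2) : posdef H -> hadj H A = A ->
  \tr A = 0 -> 1 < Re (\tr (A *m A)) / 2 ->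
  exists2 g : R, 1 < g & A *m A = (g%:C ^+ 2)%:M.
Proof.
move=> pH hA tA gt1; have [g g1 eg] := exists_sqrt_gt1 gt1; exists g => //.
have [eU _] := mxtrace_selfadjoint_sqr pH hA.
by rewrite {1}(tracefree_sqr tA) {1}eU realC_half -realCX eg.
Qed.

Lemma laplacian_sign (R : realType) (t l : R) (k q : R[i]) : 0 < t ->
  l = 4 * Re ((t ^+ 2)%:C * (k + q)) -> 0 <= k -> 0 <= q ->
  0 <= l /\ (l = 0 -> k = 0 /\ q = 0).
Proof.
move=> t0 -> k0 q0; have kq : 0 <= k + q by exact: addr_ge0.
have t4 : 0 < 4 * t ^+ 2 by rewrite mulr_gt0// exprn_gt0.
have -> : 4 * Re ((t ^+ 2)%:C * (k + q)) = 4 * t ^+ 2 * Re (k + q).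
  by move: (k + q) => [x y]; rewrite Re_mulc /=; ring.
move: (kq); rewrite lecE => /andP[/eqP iz rz].
split; first by rewrite pmulr_rge0.
move=> /eqP; rewrite mulf_eq0 (gt_eqF t4) /= => /eqP r0.
have /eqP : k + q = 0 by exact: complex_ReIm_eq.
by rewrite paddr_eq0// => /andP[/eqP -> /eqP ->].
Qed.

(** The passage from theta to Gamma = t theta: every power of t on the left is absorbed by the
    rescaled matrix. *)
Lemma mxtrace_scale_commutator (F : fieldType) (c : F) (T B S Z : 'M[F]_2) :
  \tr (T *m ((2 * c) *: Z + c ^+ 2 *: (B *m (S *m T - T *m S) - (S *m T - T *m S) *m B))) =
  \tr ((c *: T) *m (2 *: Z + (B *m (S *m (c *: T) - (c *: T) *m S) -
                              (S *m (c *: T) - (c *: T) *m S) *m B))).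
Proof.
have -> : S *m (c *: T) - (c *: T) *m S = c *: (S *m T - T *m S).
  by rewrite -scalemxAr -scalemxAl scalerBr.
move: (S *m T - T *m S) => Y.
have -> : B *m (c *: Y) - (c *: Y) *m B = c *: (B *m Y - Y *m B).
  by rewrite -scalemxAr -scalemxAl scalerBr.
move: (B *m Y - Y *m B) => W.
have -> : (c *: T) *m (2 *: Z + c *: W) = T *m (c *: (2 *: Z + c *: W)).
  by rewrite -scalemxAr -scalemxAl.
by congr (\tr (T *m _)); rewrite scalerDr !scalerA -expr2 mulrC.
Qed.

(** * The energy g^2 in a chart and its Laplacian *)

Section ChartEnergy.
Variables (R : realType) (X : riemann_surface R) (E : bundle X 2).
Variables (phi : idx X -> bidx E -> X -> 'M[R[i]]_2) (H : R -> bidx E -> X -> 'M[R[i]]_2).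
Variable m : bidx E -> X -> 'M[R[i]]_1.
Hypothesis bdom_open : forall j : bidx E, open (bdom j).
Hypothesis H_harmonic : forall t : R, 0 < t ->
  harmonic_metric (fun i j x => t%:C *: phi i j x) (H t).
Hypothesis H_det : forall (t : R) (j : bidx E) (x : X), 0 < t -> bdom j x ->
  (\det (H t j x))%:M = m j x.
Hypothesis H_smooth : smooth_family H.
Local Notation C := R[i].
Local Notation plane2 := (R * R)%type.

Definition energy (t : R) (j : bidx E) (x : X) : R :=
  Re (\tr (Gamma H t j x *m Gamma H t j x)) / 2.

Section Chart.
Variables (i : idx X) (j : bidx E) (t : R).
Local Notation Dom := (family_dom i j).
Local Notation F := (metric_family H i j).
Local Notation Th := (fvariation H i j).
Local Notation K := (fdconnection H i j).
Let oD : open Dom.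
Proof. exact (@family_dom_open R X E bdom_open i j). Qed.
Let sF : smooth_mx Dom F.
Proof. exact (family_smooth H_smooth i j). Qed.
Let pF q : Dom q -> posdef (F q).
Proof. exact: (family_posdef H_harmonic). Qed.

Lemma fvariation_selfadjoint q : Dom q -> hadj (F q) (Th q) = Th q.
Proof. by move=> Dq; exact (hadj_variation oD dir_t sF pF Dq). Qed.

(** det H_t does not depend on t, so its logarithmic derivative, the trace of theta, vanishes. *)
Lemma fvariation_trace q : Dom q -> \tr (Th q) = 0.
Proof.
case: q => s p Dq; have [s0 ip jp] := Dq.
apply: (mxtrace_variation oD (u := dir_t) sF pF Dq).
have : dt3 (fun q => \det (F q)) (s, p) = dt3 (fun=> \det (F (s, p))) (s, p).
  apply: dt3_line.
  have n : \forall r \near s, 0 < r by have /cvgr_gt := @cvg_id _ (nbhs s); apply.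
  apply: filterS n => r r0.
  have := H_det r0 jp; rewrite -(H_det s0 jp) => /matrixP/(_ 0 0).
  by rewrite !mxE !mulr1n.
move=> e; apply: (etrans e).
exact (derivation_cst (lin_derive_derivation oD 1 dir_t 0 dir_t) _ Dq).
Qed.

Definition chart_energy (p : plane2) : R := energy t j (chart_pt i p).

Lemma chart_energyE : chart_energy =
  (fun p => Re ((t ^+ 2 / 2)%:C * \tr (Th (t, p) *m Th (t, p)))).
Proof.
apply/funext => p; rewrite /chart_energy /energy Gamma_family.
rewrite -scalemxAl -scalemxAr scalerA mxtraceZ.
by move: (\tr _) => [x y]; rewrite !Re_mulc /=; field.
Qed.

Let G (q : R * (R * R)) : C := (t ^+ 2 / 2)%:C * \tr (Th q *m Th q).
Let sTh : smooth_mx Dom Th.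
Proof. exact (smooth_variation oD dir_t sF pF). Qed.
Let sG : smooth Dom G.
Proof.
apply: (smoothM oD (smooth_cst Dom _)).
exact (smooth_mxtrace oD (smooth_mxM oD sTh sTh)).
Qed.

Lemma chart_energy_Ck n : Ck n [set p | Dom (t, p)] chart_energy.
Proof. by rewrite chart_energyE; have [C1 _] := sG n; exact (Ck_slice t C1). Qed.

(** The factor 4 relates the Laplacian to dzbar dz. Since K = D' theta = D' Gamma / t, the term t^2
    |K|^2 is |D' Gamma|^2. *)
Lemma chart_energy_laplacian p : Dom (t, p) ->
  let B := phi i j (chart_pt i p) in let A := Gamma H t j (chart_pt i p) in
  let psi := A *m B - B *m A in
  'D_((1, 0) : plane2) (fun y => 'D_((1, 0) : plane2) chart_energy y) p +
  'D_((0, 1) : plane2) (fun y => 'D_((0, 1) : plane2) chart_energy y) p =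
  4 * Re ((t ^+ 2)%:C * (\tr (K (t, p) *m hadj (F (t, p)) (K (t, p))) +
    (\tr (psi *m hadj (F (t, p)) psi) + 2 * \tr (psi *m hadj (F (t, p)) B)))).
Proof.
move=> Dp B A psi.
rewrite chart_energyE; apply: (etrans (laplacian_slice (fun q => Re (G q)) t p)).
rewrite (laplacian_wirtinger oD sG Dp); congr (4 * Re _).
have dZ := lin_derive_derivation oD (1 / 2) dir_x (- 'i%C / 2) dir_y.
have dB := lin_derive_derivation oD (conjc (1 / 2)) dir_x (conjc (- 'i%C / 2)) dir_y.
have sT := smooth_mxtrace oD (smooth_mxM oD sTh sTh).
have e1 : dzb3 (dz3 G) (t, p) = (t ^+ 2 / 2)%:C * dzb3 (dz3 (fun q => \tr (Th q *m Th q))) (t, p).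
  apply: (etrans _ (derivationZ (t ^+ 2 / 2)%:C dB (derivation_smooth dZ sT) Dp)).
  apply: (derivation_ext dB) => // y Dy.
  exact (derivationZ (t ^+ 2 / 2)%:C dZ sT Dy).
have e2 := laplacian_mxtrace_sqr oD (1 / 2) (- 'i%C / 2) dir_x dir_y dir_t sF pF Dp.
have e3 := derive_dzb_fdconnection bdom_open H_harmonic H_smooth Dp.
rewrite e1; apply: (etrans (f_equal _ e2)).
have eA : A = t%:C *: Th (t, p) by exact: Gamma_family.
have sA : hadj (F (t, p)) A = A.
  rewrite eA; exact (hadjZ_real t (fvariation_selfadjoint Dp)).
have pFp := pF Dp.
have spsi : hadj (F (t, p)) psi = hadj (F (t, p)) B *m A - A *m hadj (F (t, p)) B.
  exact (hadj_commutator B pFp sA).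
have e4 := mxtrace_double_commutator A B (hadj (F (t, p)) B).
rewrite /= -/psi -spsi in e4.
have e5 : \tr (Th (t, p) *m mxderive dzb3 K (t, p)) =
    \tr (psi *m hadj (F (t, p)) psi) + 2 * \tr (psi *m hadj (F (t, p)) B).
  rewrite e3 -[RHS]addrC -e4 spsi eA.
  exact: mxtrace_scale_commutator.
have e6 (x y : C) : (t ^+ 2 / 2)%:C * (2 * x + 2 * y) = (t ^+ 2)%:C * (x + y).
  by rewrite -realC_half; field.
apply: (etrans (e6 _ _)); congr (_ * (_ + _)); exact e5.
Qed.

Hypothesis t_gt0 : 0 < t.

(** Both |K|^2 and the source are nonnegative, so a vanishing Laplacian kills them separately; the
    source vanishes only with [psi], as g > 1 is strict. *)
Lemma chart_energy_subharmonic p : Dom (t, p) -> 1 < chart_energy p ->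
  let lap := 'D_((1, 0) : plane2) (fun y => 'D_((1, 0) : plane2) chart_energy y) p +
    'D_((0, 1) : plane2) (fun y => 'D_((0, 1) : plane2) chart_energy y) p in
  let A := Gamma H t j (chart_pt i p) in
  0 <= lap /\ (lap = 0 -> K (t, p) = 0 /\
     A *m phi i j (chart_pt i p) = phi i j (chart_pt i p) *m A).
Proof.
move=> Dp gt1 lap A.
have eA : A = t%:C *: Th (t, p) by exact: Gamma_family.
have pFp := pF Dp.
have sA : hadj (F (t, p)) A = A.
  rewrite eA; exact (hadjZ_real t (fvariation_selfadjoint Dp)).
have tA : \tr A = 0 by rewrite eA mxtraceZ (fvariation_trace Dp) mulr0.
have [g g1 gE] := tracefree_sqr_gt1 pFp sA tA gt1.
have [q0 qz] := higgs_source_ge0 (phi i j (chart_pt i p)) pFp sA tA gE g1.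
have k0 := mxtrace_hadj_ge0 (K (t, p)) pFp.
have [l0 lz] := laplacian_sign t_gt0 (chart_energy_laplacian Dp) k0 q0.
apply: (conj l0) => /lz[kz qz0]; apply: (conj (mxtrace_hadj_eq0 pFp kz)).
exact (subr0_eq (qz qz0)).
Qed.

End Chart.
End ChartEnergy.

(** * The energy as a global function and the equality case of the maximum principle *)

Section Rigidity.
Variables (R : realType) (X : riemann_surface R) (E : bundle X 2).
Variables (phi : idx X -> bidx E -> X -> 'M[R[i]]_2) (H : R -> bidx E -> X -> 'M[R[i]]_2).
Variable m : bidx E -> X -> 'M[R[i]]_1.
Hypothesis E_holo : holo_bundle E.
Hypothesis H_harmonic : forall t : R, 0 < t ->
  harmonic_metric (fun i j x => t%:C *: phi i j x) (H t).
Hypothesis H_det : forall (t : R) (j : bidx E) (x : X), 0 < t -> bdom j x ->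
  (\det (H t j x))%:M = m j x.
Hypothesis H_smooth : smooth_family H.
Variable t : R.
Hypothesis t_gt0 : 0 < t.
Local Notation C := R[i].
Local Notation plane2 := (R * R)%type.

Let bdom_open (j : bidx E) : open (bdom j).
Proof. by have [Eo _ _ _ _] := E_holo; exact: Eo. Qed.

Lemma trans_unit (j k : bidx E) (x : X) : bdom j x -> bdom k x ->
  trans j k x *m trans k j x = 1%:M.
Proof.
move=> jx kx; have [_ _ _ t1 tM] := E_holo.
by rewrite tM// t1.
Qed.

(** Transition matrices do not depend on t, so d_t H transforms by the same congruence as [H], and
    H^-1 d_t H by conjugation. *)
Lemma fvariation_trans i (j k : bidx E) (x : X) : dom i x -> bdom j x -> bdom k x ->
  fvariation H i k (t, pt_chart i x) =
  trans k j x *m fvariation H i j (t, pt_chart i x) *m trans j k x.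
Proof.
move=> ix jx kx.
have oD := @family_dom_open R X E bdom_open i j.
have sF := family_smooth H_smooth i j.
have Dj := family_dom_pt t_gt0 ix jx.
pose g := trans j k x.
have dF : mxderive dt3 (metric_family H i k) (t, pt_chart i x) =
    adjmx g *m mxderive dt3 (metric_family H i j) (t, pt_chart i x) *m g.
  have dt := lin_derive_derivation oD 1 dir_t 0 dir_t.
  have sg := smooth_mx_cst (family_dom i j) g.
  have sa := smooth_mx_cst (family_dom i j) (adjmx g).
  have : mxderive dt3 (fun q => adjmx g *m metric_family H i j q *m g) (t, pt_chart i x) =
      adjmx g *m mxderive dt3 (metric_family H i j) (t, pt_chart i x) *m g.
    apply: (etrans (mxderiveM oD dt (smooth_mxM oD sa sF) sg Dj)).
    rewrite (mxderive_cst dt _ Dj) mulmx0 addr0; congr (_ *m _).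
    apply: (etrans (mxderiveM oD dt sa sF Dj)).
    by rewrite (mxderive_cst dt _ Dj) mul0mx add0r.
  move=> <-; apply/matrixP => a b; rewrite !mxderiveE; apply: dt3_line.
  have n : \forall s \near t, 0 < s by have /cvgr_gt := @cvg_id _ (nbhs t); apply.
  apply: filterS n => s s0; apply: (f_equal (fun M : 'M[C]_2 => M a b)).
  have [[_ _ tr] _] := H_harmonic s0.
  rewrite /metric_family /= pt_chartK//. exact (tr j k x jx kx).
have [[_ pH tr] _] := H_harmonic t_gt0.
have Hk : H t k x = adjmx g *m H t j x *m g by exact (tr j k x jx kx).
rewrite /fvariation /metric_variation.
rewrite (_ : metric_family H i k (t, pt_chart i x) = adjmx g *m H t j x *m g); last first.
  by rewrite /metric_family /= pt_chartK.
rewrite (_ : metric_family H i j (t, pt_chart i x) = H t j x); last first.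
  by rewrite /metric_family /= pt_chartK.
apply: (etrans (f_equal _ dF)).
move: (mxderive dt3 (metric_family H i j) (t, pt_chart i x)) => M.
have uj := posdef_unitmx (pH _ _ jx); have uk := posdef_unitmx (pH _ _ kx).
have gg := trans_unit kx jx; rewrite -/g in gg.
have ggr := trans_unit jx kx; rewrite -/g in ggr.
have e1 : invmx (adjmx g *m H t j x *m g) *m adjmx g = trans k j x *m invmx (H t j x).
  rewrite -Hk; apply: (can_inj (mulKmx uk)); rewrite mulKVmx// Hk.
  by rewrite -!mulmxA (mulmxA g) ggr mul1mx mulmxV// mulmx1.
by rewrite !mulmxA e1.
Qed.

Lemma Gamma_trans (j k : bidx E) (x : X) : bdom j x -> bdom k x ->
  Gamma H t k x = trans k j x *m Gamma H t j x *m trans j k x.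
Proof.
move=> jx kx; have [i ix] := dom_cover x.
have eG l : Gamma H t l x = t%:C *: fvariation H i l (t, pt_chart i x).
  by rewrite -[in LHS](pt_chartK ix) Gamma_family.
by rewrite !eG (fvariation_trans ix jx kx) -scalemxAr -scalemxAl.
Qed.

Lemma Gamma_selfadjoint (j : bidx E) (x : X) : bdom j x ->
  hadj (H t j x) (Gamma H t j x) = Gamma H t j x.
Proof.
move=> jx; have [i ix] := dom_cover x.
have Dp := family_dom_pt t_gt0 ix jx.
have eG : Gamma H t j x = t%:C *: fvariation H i j (t, pt_chart i x).
  by rewrite -[in LHS](pt_chartK ix) Gamma_family.
have eH : metric_family H i j (t, pt_chart i x) = H t j x by rewrite /metric_family /= pt_chartK.
rewrite eG -eH; apply: hadjZ_real.
exact: (fvariation_selfadjoint bdom_open H_harmonic H_smooth Dp).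
Qed.

Lemma Gamma_trace (j : bidx E) (x : X) : bdom j x -> \tr (Gamma H t j x) = 0.
Proof.
move=> jx; have [i ix] := dom_cover x.
have Dp := family_dom_pt t_gt0 ix jx.
have eG : Gamma H t j x = t%:C *: fvariation H i j (t, pt_chart i x).
  by rewrite -[in LHS](pt_chartK ix) Gamma_family.
by rewrite eG mxtraceZ (fvariation_trace bdom_open H_harmonic H_det H_smooth Dp) mulr0.
Qed.

Lemma energy_trans (j k : bidx E) (x : X) : bdom j x -> bdom k x ->
  energy H t k x = energy H t j x.
Proof.
move=> jx kx; rewrite /energy (Gamma_trans jx kx).
have ggr := trans_unit jx kx.
move: (Gamma H t j x) => M; congr (Re _ / 2).
rewrite -!mulmxA mxtrace_mulC -!mulmxA ggr mulmx1.
by rewrite (mulmxA (trans j k x)) ggr mul1mx.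
Qed.

(** An arbitrary choice of frame at each point, with no continuity in [x]; it is harmless because
    the energy is invariant under conjugation. *)
Definition frame (x : X) : bidx E :=
  projT1 (cid (let: And5 _ c _ _ _ := E_holo in c x)).

Lemma frameP x : bdom (frame x) x.
Proof. by rewrite /frame; case: cid. Qed.

Definition global_energy (x : X) : R := energy H t (frame x) x.

Lemma global_energyE (j : bidx E) x : bdom j x -> global_energy x = energy H t j x.
Proof. by move=> jx; exact: energy_trans (frameP x). Qed.

Lemma pt_chart_continuous i (x : X) : dom i x -> {for x, continuous (pt_chart i)}.
Proof.
move=> ix; have c := crd_continuous ix.
exact: (continuous_comp c (@ReIm_continuous R (crd i x))).
Qed.

Lemma near_chart i (j : bidx E) (x : X) : dom i x -> bdom j x ->
  \forall y \near x, dom i y /\ bdom j y.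
Proof.
move=> ix jx; have n1 : \forall y \near x, dom i y.
  by apply: open_nbhs_nbhs; split=> //; exact: dom_open.
have n2 : \forall y \near x, bdom j y.
  by apply: open_nbhs_nbhs; split=> //; exact: bdom_open.
by apply: filterS2 n1 n2.
Qed.

Lemma chart_energy_pt i (j : bidx E) x : dom i x -> bdom j x ->
  chart_energy H i j t (pt_chart i x) = global_energy x.
Proof.
move=> ix jx.
exact (etrans (f_equal (energy H t j) (pt_chartK ix)) (esym (global_energyE jx))).
Qed.

Lemma global_energy_continuous : continuous global_energy.
Proof.
move=> x; have [i ix] := dom_cover x; have jx := frameP x; set j := frame x in jx.
have C0 := @chart_energy_Ck R X E phi H bdom_open H_harmonic H_smooth i j t 0.
have Dp := family_dom_pt t_gt0 ix jx.
have c : {for x, continuous (fun y => chart_energy H i j t (pt_chart i y))}.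
  exact: (continuous_comp (pt_chart_continuous ix) (CkW C0 Dp)).
change (global_energy @ x --> global_energy x).
rewrite -(chart_energy_pt ix jx); apply: cvg_trans c; apply: near_eq_cvg.
apply: filterS (near_chart ix jx) => y [iy jy].
by rewrite chart_energy_pt.
Qed.

(** Because [M] exceeds 1, continuity keeps the energy above 1 near a maximum point, which places
    the strong maximum principle in the region where subharmonicity holds. *)
Lemma energy_max_open (M : R) (x : X) : 1 < M -> (forall y, global_energy y <= M) ->
  global_energy x = M -> \forall y \near x, global_energy y = M.
Proof.
move=> M1 leM xM; have [i ix] := dom_cover x; have jx := frameP x.
set j := frame x in jx.
have Ck n := @chart_energy_Ck R X E phi H bdom_open H_harmonic H_smooth i j t n.
have Dp := family_dom_pt t_gt0 ix jx.
set p := pt_chart i x in Dp.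
set u := chart_energy H i j t.
have oD0 : open (family_dom i j) := @family_dom_open R X E bdom_open i j.
have oD : open [set p | family_dom i j (t, p)] by exact (@open_slice R _ t oD0).
have up : u p = M by rewrite /u /p chart_energy_pt.
(* The region where the energy exceeds 1, written with signs reversed to be a strict sublevel
   set. *)
pose D1 := [set p | family_dom i j (t, p) /\ - u p < - 1].
have oD1 : open D1.
  exact (@open_lt_level R _ _ _ (- 1) 0 oD (CkN oD (Ck 0%N))).
have sD1 : D1 `<=` [set p | family_dom i j (t, p)] by move=> q [].
have leu q : D1 q -> u q <= u p.
  move=> [Dq _]; rewrite up /u /chart_energy.
  by have [_ _ jq] := Dq; rewrite -(global_energyE jq).
have lap q : D1 q -> 0 <= 'D_((1, 0) : plane2) (fun y => 'D_((1, 0) : plane2) u y) q +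
                         'D_((0, 1) : plane2) (fun y => 'D_((0, 1) : plane2) u y) q.
  move=> [Dq u1]; rewrite ltrN2 in u1.
  by have [] := chart_energy_subharmonic bdom_open H_harmonic H_det H_smooth t_gt0 Dq u1.
have D1p : D1 p by split=> //; rewrite ltrN2 up.
have n := strong_maximum oD1 D1p (Ck_sub sD1 (Ck 2%N)) lap leu.
have n1 : \forall y \near x, u (pt_chart i y) = u p.
  exact: (pt_chart_continuous ix n).
apply: filterS2 n1 (near_chart ix jx) => y uy [iy jy].
by rewrite -(chart_energy_pt iy jy) -/u uy.
Qed.

Hypothesis X_compact : compact [set: X].

(** Compactness provides a maximum, which is above 1. The set where it is attained is closed by
    continuity and open by the local maximum principle, hence all of the connected surface. *)
Lemma energy_constant (x0 : X) : 1 < global_energy x0 ->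
  exists2 M : R, 1 < M & forall x, global_energy x = M.
Proof.
move=> gt1.
have ne : [set: X] !=set0 by exists x0.
have cw : {within [set: X], continuous global_energy}.
  by apply: continuous_subspaceT; exact: global_energy_continuous.
have [c _ maxc] := compact_EVT_max ne X_compact cw.
have {}maxc y : global_energy y <= global_energy c by apply: maxc; rewrite inE.
have M1 : 1 < global_energy c by exact: lt_le_trans gt1 (maxc x0).
exists (global_energy c); first exact M1.
pose Z := [set x | global_energy x = global_energy c].
have oZ : open Z.
  by rewrite openE => x Zx; exact: energy_max_open M1 maxc Zx.
have cZ : closed Z.
  apply: (closed_comp (f := global_energy) (D := [set y | y = global_energy c])).
    by move=> y _; exact: global_energy_continuous.
  exact: closed_eq.
have := @surf_connected R X Z (ex_intro _ c erefl).
move=> /(_ (ex_intro2 _ _ Z oZ (esym (setTI Z))) (ex_intro2 _ _ Z cZ (esym (setTI Z)))) ZT x.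
by have : Z x by rewrite ZT.
Qed.

Lemma rigidity (x0 : X) : 1 < global_energy x0 -> exists2 g : R, 1 < g &
  forall i j x, dom i x -> bdom j x ->
  [/\ Gamma H t j x *m Gamma H t j x = (g%:C ^+ 2)%:M,
      fdconnection H i j (t, pt_chart i x) = 0 &
      Gamma H t j x *m phi i j x = phi i j x *m Gamma H t j x].
Proof.
move=> /energy_constant[M M1 eM]; have [g g1 gM] := exists_sqrt_gt1 M1.
exists g => // i j x ix jx.
have Dp := family_dom_pt t_gt0 ix jx.
have u1 : 1 < chart_energy H i j t (pt_chart i x) by rewrite (chart_energy_pt ix jx) eM.
have [_ h] := chart_energy_subharmonic bdom_open H_harmonic H_det H_smooth t_gt0 Dp u1.
have oD0 : open (family_dom i j) := @family_dom_open R X E bdom_open i j.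
have oD : open [set p | family_dom i j (t, p)] by exact (@open_slice R _ t oD0).
have uM p : family_dom i j (t, p) -> M = chart_energy H i j t p.
  by move=> [_ _ jq]; rewrite /chart_energy -(global_energyE jq) eM.
(* Constancy of the energy makes its Laplacian vanish, which is the equality case of
   subharmonicity. *)
have z (v : plane2) : 'D_v (fun y => 'D_v (chart_energy H i j t) y) (pt_chart i x) = 0.
  have e p : family_dom i j (t, p) -> 0 = 'D_v (chart_energy H i j t) p.
    move=> D'; rewrite -(near_eq_derive v (f := fun=> M)) ?derive_cst//.
    exact: (near_open oD D' uM).
  rewrite -(near_eq_derive v (f := fun=> 0)) ?derive_cst//.
  exact: (near_open oD Dp e).
have [k0] := h (etrans (f_equal2 +%R (z _) (z _)) (addr0 0)).
rewrite (pt_chartK ix) => comm.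
split; [|exact k0|exact comm].
have [[_ pH _] _] := H_harmonic t_gt0.
have sA := Gamma_selfadjoint jx.
have tA := Gamma_trace jx.
have [eU _] := mxtrace_selfadjoint_sqr (pH _ _ jx) sA.
have e2 : Re (\tr (Gamma H t j x *m Gamma H t j x)) / 2 = M.
  by rewrite -(eM x) (global_energyE jx).
by rewrite (tracefree_sqr tA) eU realC_half e2 -realCX gM.
Qed.

End Rigidity.

(** * Matrices commuting with a trace-free matrix whose square is a nonzero scalar *)

Section CommutingEigenprojection.
Variable R : realType.
Local Notation C := R[i].
Implicit Types A B P H : 'M[C]_2.

(** With P = u w^T of rank at most one, P B P = u (w^T B u) w^T, and the inner scalar is tr (B
    P). *)
Lemma det0_compress P B : \det P = 0 -> P *m B *m P = \tr (B *m P) *: P.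
Proof.
move=> /det0_minors h; apply/matrixP => i j.
rewrite [RHS]mxE mxtrace2 !mulmx2E.
have e k l : P i k * B k l * P l j = B k l * P l k * P i j.
  by rewrite mulrAC h mulrC mulrA mulrAC.
rewrite !mulrDl !e; ring.
Qed.

(* [B] and [S] act as scalars on the two eigenlines of [A]. *)
Lemma commute_centralizer A B S (g : C) : g != 0 -> \tr A = 0 -> A *m A = (g ^+ 2)%:M ->
  A *m B = B *m A -> A *m S = S *m A -> B *m S = S *m B.
Proof.
move=> g0 tA AA AB AS.
have gN0 : - g != 0 by rewrite oppr_eq0.
have AA' : A *m A = ((- g) ^+ 2)%:M by rewrite sqrrN.
have d1 := eigenproj_det g0 tA AA; have d2 := eigenproj_det gN0 tA AA'.
have i1 := eigenproj_idem g0 AA; have i2 := eigenproj_idem gN0 AA'.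
have eB1 := eigenproj_commute g AB; have eS1 := eigenproj_commute g AS.
have eB2 := eigenproj_commute (- g) AB; have eS2 := eigenproj_commute (- g) AS.
have sum1 : eigenproj g A + eigenproj (- g) A = 1%:M.
  rewrite /eigenproj -scalerDr invrN scaleNr addrACA subrr addr0.
  by rewrite -mulr2n -[1%:M *+ 2]scaler_nat scalerA mulVf ?scale1r// pnatr_eq0.
move: (eigenproj g A) (eigenproj (- g) A) d1 d2 i1 i2 eB1 eS1 eB2 eS2 sum1.
move=> P Q d1 d2 i1 i2 PB PS QB QS PQ.
have sP P' B' : \det P' = 0 -> P' *m P' = P' -> P' *m B' = B' *m P' ->
    exists c : C, B' *m P' = c *: P'.
  move=> d i c; exists (\tr (B' *m P')); rewrite -(det0_compress _ d) c -mulmxA i //.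
have [b1 hb1] := sP P B d1 i1 PB; have [b2 hb2] := sP Q B d2 i2 QB.
have [s1 hs1] := sP P S d1 i1 PS; have [s2 hs2] := sP Q S d2 i2 QS.
rewrite -[LHS]mulmx1 -[RHS]mulmx1 -PQ !mulmxDr -!mulmxA hb1 hb2 hs1 hs2.
by rewrite -!scalemxAr hb1 hb2 hs1 hs2 !scalerA [s1 * b1]mulrC [s2 * b2]mulrC.
Qed.

(** Taking adjoints in A B = B A shows that the adjoint of [B] commutes with [A] too, and the
    centralizer of [A] is commutative. This is what makes the Higgs term of the curvature vanish. *)
Lemma commute_hadj H A B (g : C) : posdef H -> hadj H A = A -> g != 0 -> \tr A = 0 ->
  A *m A = (g ^+ 2)%:M -> A *m B = B *m A -> B *m hadj H B = hadj H B *m B.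
Proof.
move=> pH hA g0 tA AA AB; apply: (commute_centralizer g0 tA AA AB).
by rewrite -{1}hA -hadjM// -AB hadjM// hA.
Qed.

End CommutingEigenprojection.

(** * Algebra of holomorphic functions and matrices on the surface *)

Section Holomorphic.
Variables (R : realType) (X : riemann_surface R).
Local Notation C := R[i].
Implicit Types (W : set X) (f h : X -> C).

Lemma holo_on_sub W W' f : W' `<=` W -> holo_on W f -> holo_on W' f.
Proof. by move=> s hf i x /s Wx ix; exact: hf. Qed.

Lemma holo_onD W f h : holo_on W f -> holo_on W h -> holo_on W (fun x => f x + h x).
Proof.
move=> hf hh i x Wx ix.
exact (@derivableD _ _ _ (fun z : C => f (Defs.inv i z)) (fun z => h (Defs.inv i z)) _ _
  (hf i x Wx ix) (hh i x Wx ix)).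
Qed.

Lemma holo_onM W f h : holo_on W f -> holo_on W h -> holo_on W (fun x => f x * h x).
Proof.
move=> hf hh i x Wx ix.
exact (@derivableM _ _ (fun z : C => f (Defs.inv i z)) (fun z => h (Defs.inv i z)) _ _
  (hf i x Wx ix) (hh i x Wx ix)).
Qed.

Lemma holo_onV W f : (forall x, W x -> f x != 0) -> holo_on W f ->
  holo_on W (fun x => (f x)^-1).
Proof.
move=> f0 hf i x Wx ix.
have n0 : (fun z : C => f (Defs.inv i z)) (crd i x) != 0 by rewrite /= crdK// f0.
exact (@derivableV _ _ (fun z : C => f (Defs.inv i z)) _ _ n0 (hf i x Wx ix)).
Qed.

Lemma holo_mx_onM W m n (A : X -> 'M[C]_(m, 2)) (B : X -> 'M[C]_(2, n)) :
  holo_mx_on W A -> holo_mx_on W B -> holo_mx_on W (fun x => A x *m B x).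
Proof.
move=> hA hB a b.
have -> : (fun x => (A x *m B x) a b) = (fun x => A x a 0 * B x 0 b + A x a 1 * B x 1 b).
  by apply/funext => x; rewrite mulmx2E.
exact: holo_onD (holo_onM (hA a 0) (hB 0 b)) (holo_onM (hA a 1) (hB 1 b)).
Qed.

End Holomorphic.

(** * Differential properties of the eigenprojection in the rigid case *)

Section EigenLine.
Variables (R : realType) (X : riemann_surface R) (E : bundle X 2).
Variables (phi : idx X -> bidx E -> X -> 'M[R[i]]_2) (H : R -> bidx E -> X -> 'M[R[i]]_2).
Variable m : bidx E -> X -> 'M[R[i]]_1.
Hypothesis E_holo : holo_bundle E.
Hypothesis H_harmonic : forall t : R, 0 < t ->
  harmonic_metric (fun i j x => t%:C *: phi i j x) (H t).
Hypothesis H_det : forall (t : R) (j : bidx E) (x : X), 0 < t -> bdom j x ->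
  (\det (H t j x))%:M = m j x.
Hypothesis H_smooth : smooth_family H.
Variables t g : R.
Hypotheses (t_gt0 : 0 < t) (g_gt1 : 1 < g).
Hypothesis rigid : forall i j x, dom i x -> bdom j x ->
  [/\ Gamma H t j x *m Gamma H t j x = (g%:C ^+ 2)%:M,
      fdconnection H i j (t, pt_chart i x) = 0 &
      Gamma H t j x *m phi i j x = phi i j x *m Gamma H t j x].
Local Notation C := R[i].
Local Notation plane2 := (R * R)%type.
Local Notation T := (R * (R * R))%type.

Let bdom_open (j : bidx E) : open (bdom j).
Proof. by have [Eo _ _ _ _] := E_holo; exact: Eo. Qed.

Let g_neq0 : (g%:C : C) != 0.
Proof. by rewrite eq_complex /= eqxx andbT gt_eqF// (lt_trans ltr01). Qed.

Definition eproj (j : bidx E) (x : X) : 'M[C]_2 := eigenproj g%:C (Gamma H t j x).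

Section Pointwise.
Variables (j : bidx E) (x : X).
Hypothesis jx : bdom j x.

Let GG : Gamma H t j x *m Gamma H t j x = (g%:C ^+ 2)%:M.
Proof. by have [i ix] := dom_cover x; have [] := rigid ix jx. Qed.

Lemma eproj_det : \det (eproj j x) = 0.
Proof.
exact (eigenproj_det g_neq0 (Gamma_trace E_holo H_harmonic H_det H_smooth t_gt0 jx) GG).
Qed.

Lemma eproj_trace : \tr (eproj j x) = 1.
Proof. exact (eigenproj_trace _ (Gamma_trace E_holo H_harmonic H_det H_smooth t_gt0 jx)). Qed.

Lemma eproj_higgs i : dom i x -> eproj j x *m phi i j x = phi i j x *m eproj j x.
Proof. by move=> ix; have [_ _ c] := rigid ix jx; exact (eigenproj_commute g%:C c). Qed.

Lemma higgs_curvature0 i : dom i x ->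
  phi i j x *m hadj (H t j x) (phi i j x) = hadj (H t j x) (phi i j x) *m phi i j x.
Proof.
move=> ix; have [_ _ c] := rigid ix jx; have [[_ pH _] _] := H_harmonic t_gt0.
exact (commute_hadj (pH _ _ jx) (Gamma_selfadjoint E_holo H_harmonic H_smooth t_gt0 jx)
  g_neq0 (Gamma_trace E_holo H_harmonic H_det H_smooth t_gt0 jx) GG c).
Qed.

End Pointwise.

Lemma eproj_trans (j k : bidx E) (x : X) : bdom j x -> bdom k x ->
  trans j k x *m eproj k x = eproj j x *m trans j k x.
Proof.
move=> jx kx; have gg := trans_unit E_holo jx kx.
rewrite /eproj /eigenproj (Gamma_trans E_holo H_harmonic H_smooth t_gt0 jx kx).
rewrite -scalemxAr -scalemxAl mulmxDr mulmxDl mulmx1 mul1mx -scalemxAr -scalemxAl.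
by rewrite !mulmxA gg mul1mx.
Qed.

Section Chart.
Variables (i : idx X) (j : bidx E).
Local Notation Dom := (family_dom i j).
Let oD : open Dom := @family_dom_open R X E bdom_open i j.
Let sF : smooth_mx Dom (metric_family H i j).
Proof. exact (family_smooth H_smooth i j). Qed.
Let pF q : Dom q -> posdef (metric_family H i j q).
Proof. exact: (family_posdef H_harmonic). Qed.

(** The factor in front of the variation is the fixed [t], not the time coordinate of [q]. The map
    is thus affine in theta with constant coefficients and is the spectral projection on the slice
    of time [t]. *)
Definition fproj (q : T) : 'M[C]_2 := eigenproj g%:C (t%:C *: fvariation H i j q).

Lemma fprojE p : eproj j (chart_pt i p) = fproj (t, p).
Proof. by rewrite /eproj Gamma_family. Qed.

Let c : C := 2^-1 * (g%:C)^-1 * t%:C.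

Let fproj_affine q : fproj q = 2^-1 *: 1%:M + c *: fvariation H i j q.
Proof. by rewrite /fproj /eigenproj scalerDr !scalerA. Qed.

Let sTh : smooth_mx Dom (fvariation H i j).
Proof. exact (smooth_variation oD dir_t sF pF). Qed.

Let smooth_affine : smooth_mx Dom (fun q => 2^-1 *: 1%:M + c *: fvariation H i j q).
Proof.
exact (smooth_mxD oD (smooth_mx_cst Dom (2^-1 *: 1%:M)) (smooth_mxZ oD (smooth_cst Dom c) sTh)).
Qed.

Lemma smooth_fproj : smooth_mx Dom fproj.
Proof.
by apply: (smooth_mx_ext oD _ smooth_affine) => q _; rewrite fproj_affine.
Qed.

Lemma derive_fproj d q : derivation Dom d -> Dom q ->
  mxderive d fproj q = c *: mxderive d (fvariation H i j) q.
Proof.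
move=> dd Dq.
apply: (etrans (mxderive_ext dd (fun y _ => fproj_affine y) Dq)).
have sZ := smooth_mxZ oD (smooth_cst Dom c) sTh.
apply: (etrans (mxderiveD dd (smooth_mx_cst Dom (2^-1 *: 1%:M)) sZ Dq)).
apply: (etrans (f_equal2 +%R (mxderive_cst dd (2^-1 *: 1%:M) Dq)
  (mxderiveZ dd (smooth_cst Dom c) sTh Dq))).
by rewrite (derivation_cst dd _ Dq) scale0r !add0r.
Qed.

Variable p : plane2.
Hypothesis Dp : Dom (t, p).

Let K0 : fdconnection H i j (t, p) = 0.
Proof.
have [_ ip jp] := Dp; have [ix e] := chart_ptK ip.
have [_ + _] := rigid ix jp; rewrite /pt_chart e.
by rewrite (_ : (Re (plane p), Im (plane p)) = p)//; case: (p).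
Qed.

(** dzbar theta is the adjoint of K, and K vanishes in the rigid case. *)
Lemma derive_dzb_fproj : mxderive dzb3 fproj (t, p) = 0.
Proof.
have dB := lin_derive_derivation oD (conjc (1 / 2)) dir_x (conjc (- 'i%C / 2)) dir_y.
apply: (etrans (derive_fproj dB Dp)).
have e : mxderive dzb3 (fvariation H i j) (t, p) =
    hadj (metric_family H i j (t, p)) (fdconnection H i j (t, p)).
  exact (derive_db_variation oD (1 / 2) (- 'i%C / 2) dir_x dir_y dir_t sF pF Dp).
apply: (etrans (f_equal (fun M => c *: M) e)).
by rewrite K0 /hadj -[X in adjmx X](scale0r 0) adjmxZ (rmorph0 (@conjc R)) scale0r mulmx0 mul0mx scaler0.
Qed.

(** K = 0 also says that theta, hence the projection, is parallel for the Chern connection; in a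
    frame this reads dz P = [P, A]. *)
Lemma derive_dz_fproj : mxderive dz3 fproj (t, p) =
  fproj (t, p) *m fconnection H i j (t, p) - fconnection H i j (t, p) *m fproj (t, p).
Proof.
have dZ := lin_derive_derivation oD (1 / 2) dir_x (- 'i%C / 2) dir_y.
apply: (etrans (derive_fproj dZ Dp)).
have e : mxderive dz3 (fvariation H i j) (t, p) = fdconnection H i j (t, p) +
    (fvariation H i j (t, p) *m fconnection H i j (t, p) -
     fconnection H i j (t, p) *m fvariation H i j (t, p)).
  exact (derive_dz_variation oD (1 / 2) (- 'i%C / 2) dir_x dir_y dir_t sF pF Dp).
apply: (etrans (f_equal (fun M => c *: M) e)).
rewrite K0 add0r fproj_affine.
move: (fvariation H i j (t, p)) (fconnection H i j (t, p)) => Th A.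
rewrite mulmxDl mulmxDr -!scalemxAl -!scalemxAr mul1mx mulmx1 scalerBr.
by rewrite opprD addrACA subrr add0r.
Qed.

Lemma derive_dzb_connection0 : mxderive dzb3 (fconnection H i j) (t, p) = 0.
Proof.
have [_ ip jp] := Dp; have [ix _] := chart_ptK ip.
apply: (etrans (derive_dzb_fconnection bdom_open H_harmonic Dp)).
have e := higgs_curvature0 jp ix.
by apply: (etrans (f_equal (fun M => _ *: (M - _)) e)); rewrite subrr scaler0.
Qed.

End Chart.
End EigenLine.

Lemma open_neq0 (R : realType) (V : normedModType R) (D : set V) (f : V -> R[i]) :
  open D -> smooth D f -> open [set x | D x /\ f x != 0].
Proof.
move=> oD sf; have [C1 C2] := sf 0%N.
have Cu := CkN oD (CkD oD (CkM oD C1 C1) (CkM oD C2 C2)).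
have -> : [set x | D x /\ f x != 0] =
    [set x | D x /\ - (Re (f x) * Re (f x) + Im (f x) * Im (f x)) < 0].
  apply/seteqP; split=> x [Dx h]; split=> //=.
    by rewrite oppr_lt0 lt0r -!expr2 complex_sqr_neq0// addr_ge0// sqr_ge0.
  by apply: contraTneq h => ->; rewrite /= !mulr0 addr0 oppr0 ltxx.
exact: open_lt_level oD Cu.
Qed.

Lemma col_mxE (R : nmodType) m n (A : 'M[R]_(m, n)) i j k : col j A i k = A i j.
Proof. by rewrite mxE. Qed.

Lemma scale_col_eq0 (F : fieldType) n (A : 'M[F]_n) j (c : F) : A j j != 0 ->
  c *: col j A = 0 -> c = 0.
Proof.
move=> Ajj /matrixP/(_ j 0); rewrite !mxE => /eqP.
by rewrite mulf_eq0 (negPf Ajj) orbF => /eqP.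
Qed.

Lemma scalerAC (R : comNzRingType) (V : lmodType R) (a b : R) (v : V) :
  a *: (b *: v) = (b * a) *: v.
Proof. by rewrite scalerA mulrC. Qed.

(** [B] commutes with the projection [Pj], so it maps the image of [Pj] to itself; the identity
    expresses this through the frame in which the projection is [Pa]. *)
Lemma intertwine_range (R : pzRingType) n (Pj Pa B g h : 'M[R]_n) (e : 'cV[R]_n) :
  g *m h = 1%:M -> g *m Pa = Pj *m g -> Pj *m B = B *m Pj ->
  B *m (g *m (Pa *m e)) = g *m (Pa *m (h *m (B *m (g *m e)))).
Proof.
by move=> gh gP PB; rewrite !mulmxA gP -(mulmxA Pj g h) gh mulmx1 PB -(mulmxA B g Pa) gP mulmxA.
Qed.

(** * The eigenline as an invariant holomorphic line subbundle *)

Section LineBundle.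
Variables (R : realType) (X : riemann_surface R) (E : bundle X 2).
Variables (phi : idx X -> bidx E -> X -> 'M[R[i]]_2) (H : R -> bidx E -> X -> 'M[R[i]]_2).
Variable m : bidx E -> X -> 'M[R[i]]_1.
Hypothesis E_holo : holo_bundle E.
Hypothesis H_harmonic : forall t : R, 0 < t ->
  harmonic_metric (fun i j x => t%:C *: phi i j x) (H t).
Hypothesis H_det : forall (t : R) (j : bidx E) (x : X), 0 < t -> bdom j x ->
  (\det (H t j x))%:M = m j x.
Hypothesis H_smooth : smooth_family H.
Variables t g : R.
Hypotheses (t_gt0 : 0 < t) (g_gt1 : 1 < g).
Hypothesis rigid : forall i j x, dom i x -> bdom j x ->
  [/\ Gamma H t j x *m Gamma H t j x = (g%:C ^+ 2)%:M,
      fdconnection H i j (t, pt_chart i x) = 0 &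
      Gamma H t j x *m phi i j x = phi i j x *m Gamma H t j x].
Local Notation C := R[i].
Local Notation plane2 := (R * R)%type.
Local Notation T := (R * (R * R))%type.
Local Notation P := (eproj H t g).

Let bdom_open (j : bidx E) : open (bdom j).
Proof. by have [Eo _ _ _ _] := E_holo; exact: Eo. Qed.

(** The projection is smooth with vanishing dzbar derivative in every chart, so the Cauchy-Riemann
    criterion applies entry by entry. *)
Lemma eproj_holo (j : bidx E) : holo_mx_on (bdom j) (P j).
Proof.
move=> a b i x jx ix.
have oD := @family_dom_open R X E bdom_open i j.
have Dp := family_dom_pt t_gt0 ix jx.
have sf := smooth_slice t (smooth_fproj E_holo H_harmonic H_smooth t g i j a b).
have fE : (fun p => P j (Defs.inv i (plane p)) a b) = (fun p => fproj H t g i j (t, p) a b).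
  by apply/funext => p; rewrite -(fprojE H t g i j p).
apply: (@dzbar0_derivable R [set p | family_dom i j (t, p)]).
- exact (@open_slice R _ t oD).
- by rewrite fE.
- exact: Dp.
rewrite -(plane_ReIm (crd i x)).
apply: (etrans (dzbar_slice (F := fun q => fproj H t g i j q a b) oD _ Dp)).
  by move=> p _; rewrite -(fprojE H t g i j p).
rewrite -[LHS](mxderiveE dzb3 (fproj H t g i j)).
by rewrite (derive_dzb_fproj E_holo H_harmonic H_smooth rigid Dp) mxE.
Qed.

(* The frame with index (k, b) is the b-th column of the projection in the frame k
   of E; its domain is where the (b, b) entry does not vanish. *)
Definition eigenline : bundle X 1 := Bundle
  (fun a : bidx E * 'I_2 => [set x | bdom a.1 x /\ P a.1 x a.2 a.2 != 0])
  (fun a b x => (((trans a.1 b.1 x *m col b.2 (P b.1 x)) a.2 0) / P a.1 x a.2 a.2)%:M).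

Definition eigenline_incl (j : bidx E) (a : bidx eigenline) (x : X) : 'cV[C]_2 :=
  trans j a.1 x *m col a.2 (P a.1 x).

Definition eigenline_metric (a : bidx eigenline) (x : X) : 'M[C]_1 :=
  adjmx (col a.2 (P a.1 x)) *m H t a.1 x *m col a.2 (P a.1 x).

Local Notation sec a x := (col a.2 (P a.1 x)).
Local Notation coef a b x :=
  ((trans a.1 b.1 x *m col b.2 (P b.1 x)) a.2 0 / P a.1 x a.2 a.2).

(** The transported column of one projection lies in the image of the other, a line spanned by the
    column [sec a x]; rank one gives the factor. *)
Lemma trans_sec (a b : bidx eigenline) x : bdom a x -> bdom b x ->
  trans a.1 b.1 x *m sec b x = coef a b x *: sec a x.
Proof.
move=> [ax pa] [bx pb].
have e : trans a.1 b.1 x *m sec b x = P a.1 x *m (trans a.1 b.1 x *m delta_mx b.2 0).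
  by rewrite colE mulmxA (eproj_trans E_holo H_harmonic H_smooth g t_gt0 ax bx) mulmxA.
have d := eproj_det E_holo H_harmonic H_det H_smooth t_gt0 g_gt1 rigid ax.
by rewrite {1}e (det0_range _ d pa) -e.
Qed.

Lemma sec_neq0 (a : bidx eigenline) x (c : C) : bdom a x -> c *: sec a x = 0 -> c = 0.
Proof.
by move=> [_ pa]; exact: scale_col_eq0.
Qed.

Lemma trans_sec_comp (j k : bidx E) (a : bidx eigenline) x : bdom j x -> bdom k x ->
  bdom a x -> trans j k x *m (trans k a.1 x *m sec a x) = trans j a.1 x *m sec a x.
Proof.
move=> jx kx [ax _]; have [_ _ _ _ tM] := E_holo.
by rewrite mulmxA tM.
Qed.

Lemma eigenline_open (a : bidx eigenline) : open (bdom a).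
Proof.
rewrite openE => x [ax pa]; have [i ix] := dom_cover x.
have oD := @family_dom_open R X E bdom_open i a.1.
have sf := smooth_fproj E_holo H_harmonic H_smooth t g i a.1 a.2 a.2.
have oD' := @open_slice R _ t (open_neq0 oD sf).
have Dp := family_dom_pt t_gt0 ix ax.
have pE y : dom i y -> fproj H t g i a.1 (t, pt_chart i y) a.2 a.2 = P a.1 y a.2 a.2.
  by move=> iy; rewrite -(fprojE H t g i a.1) (pt_chartK iy).
have n : \forall p \near pt_chart i x, family_dom i a.1 (t, p) /\
    fproj H t g i a.1 (t, p) a.2 a.2 != 0.
  apply: open_nbhs_nbhs; split; first exact: oD'.
  exact (conj Dp (eq_ind _ (fun z => z != 0) pa _ (esym (pE x ix)))).
have n1 : \forall y \near x, family_dom i a.1 (t, pt_chart i y) /\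
    fproj H t g i a.1 (t, pt_chart i y) a.2 a.2 != 0.
  exact: (pt_chart_continuous ix n).
apply: filterS2 n1 (near_chart E_holo ix ax) => y [_ h] [iy ay].
exact (conj ay (eq_ind _ (fun z => z != 0) h _ (pE y iy))).
Qed.

Lemma eigenline_holo : holo_bundle eigenline.
Proof.
have [_ Ec Eh E1 EM] := E_holo; split.
- exact: eigenline_open.
- move=> x; have [j jx] := Ec x.
  (* The trace is 1, so one of the two diagonal entries is nonzero and the frames cover the
     surface. *)
  have := eproj_trace E_holo H_harmonic H_det H_smooth g t_gt0 jx; rewrite mxtrace2.
  have [p0|p0] := eqVneq (P j x 0 0) 0; last by exists (j, 0).
  rewrite p0 add0r => p1; exists (j, 1); split=> //=.
  by rewrite p1 oner_neq0.
- move=> a b e f; rewrite (ord1 e) (ord1 f).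
  have -> : (fun x => trans a b x 0 0) = (fun x => coef a b x).
    by apply/funext => x; rewrite mxE.
  have sub1 : bdom a `&` bdom b `<=` bdom a.1 `&` bdom b.1 by move=> x [[ax _] [bx _]].
  have sub2 : bdom a `&` bdom b `<=` bdom b.1 by move=> x [_ [bx _]].
  have sub3 : bdom a `&` bdom b `<=` bdom a.1 by move=> x [[ax _] _].
  apply: holo_onM.
    apply: (holo_mx_onM (A := trans a.1 b.1) (B := fun x => sec b x)).
      move=> c d; exact (holo_on_sub sub1 (Eh _ _ c d)).
    move=> c d; rewrite (_ : (fun x => _) = fun x => P b.1 x c b.2).
      exact (holo_on_sub sub2 (@eproj_holo _ c _)).
    by apply/funext => x; rewrite col_mxE.
  apply: holo_onV; first by move=> x [[_ pa] _].
  exact (holo_on_sub sub3 (@eproj_holo _ _ _)).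
- move=> a x [ax pa]; congr (_%:M).
  by rewrite E1// mul1mx col_mxE divff.
- move=> a b d x ax bx dx; rewrite -scalar_mxM; congr (_%:M).
  (* The cocycle identity is checked on the spanning section [sec a x] and its nonvanishing is then
     cancelled out. *)
  have h : trans a.1 d.1 x *m sec d x = (coef a b x * coef b d x) *: sec a x.
    apply: (etrans (esym (trans_sec_comp (proj1 ax) (proj1 bx) dx))).
    apply: (etrans (f_equal (mulmx (trans a.1 b.1 x)) (trans_sec bx dx))).
    apply: (etrans (esym (scalemxAr _ _ _))).
    apply: (etrans (f_equal (fun v => coef b d x *: v) (trans_sec ax bx))).
    exact (scalerAC _ _ _).
  apply: subr0_eq; apply: (sec_neq0 ax); rewrite scalerBl -h.
  by apply/eqP; rewrite subr_eq0; apply/eqP; exact (trans_sec ax dx).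
Qed.

Lemma eigenline_subbundle : line_subbundle eigenline_incl.
Proof.
have [_ Ec Eh E1 EM] := E_holo; split; first exact: eigenline_holo.
- move=> j a.
  have sub1 : bdom j `&` bdom a `<=` bdom j `&` bdom a.1 by move=> x [jx [ax _]].
  have sub2 : bdom j `&` bdom a `<=` bdom a.1 by move=> x [_ [ax _]].
  apply: (holo_mx_onM (A := trans j a.1) (B := fun x => sec a x)).
    move=> c d; exact (holo_on_sub sub1 (Eh _ _ c d)).
  move=> c d; rewrite (_ : (fun x => _) = fun x => P a.1 x c a.2).
    exact (holo_on_sub sub2 (@eproj_holo _ c _)).
  by apply/funext => x; rewrite col_mxE.
- move=> j a x jx ax; apply/eqP => e0.
  have e1 : 1 *: sec a x = 0.
    rewrite scale1r -[LHS]mul1mx -(trans_unit E_holo (proj1 ax) jx) -mulmxA.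
    by rewrite -/(eigenline_incl j a x) e0 mulmx0.
  by have /eqP := sec_neq0 ax e1; rewrite oner_eq0.
move=> j k a b x jx kx ax bx; rewrite /eigenline_incl (trans_sec_comp jx kx ax).
apply: (etrans (esym (trans_sec_comp jx (proj1 bx) ax))).
apply: (etrans (f_equal (mulmx (trans j b.1 x)) (trans_sec bx ax))).
by rewrite mul_mx_scalar -scalemxAr.
Qed.

(** The projection commutes with the Higgs field, whose value on the spanning vector is therefore
    again in the image, a line. *)
Lemma eigenline_invariant : higgs_invariant phi eigenline_incl.
Proof.
move=> i j a x ix jx [ax pa].
have c0 := eproj_trans E_holo H_harmonic H_smooth g t_gt0 jx ax.
have c1 := eproj_higgs rigid jx ix.
have u1 := trans_unit E_holo jx ax.
have d := eproj_det E_holo H_harmonic H_det H_smooth t_gt0 g_gt1 rigid ax.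
pose v := trans a.1 j x *m (phi i j x *m (trans j a.1 x *m delta_mx a.2 0)) : 'cV[C]_2.
exists ((P a.1 x *m v) a.2 0 / P a.1 x a.2 a.2).
apply: (etrans (f_equal (fun w => phi i j x *m (trans j a.1 x *m w)) (colE a.2 (P a.1 x)))).
apply: (etrans (intertwine_range (delta_mx a.2 0) u1 c0 c1)).
apply: (etrans (f_equal (mulmx (trans j a.1 x)) (det0_range v d pa))).
exact (esym (scalemxAr _ _ _)).
Qed.

End LineBundle.

(** The product rule for v^* F v with dz v^* = 0, dz F = F A and dz v = w - A v: the two terms
    containing [A] cancel. *)
Lemma gram_leibniz (K : comPzRingType) (vs : 'M[K]_(1, 2)) (F A : 'M[K]_2)
  (v w : 'cV[K]_2) (c : K) : w = c *: v ->
  (0 *m F + vs *m (F *m A)) *m v + (vs *m F) *m (w - A *m v) = c *: (vs *m F *m v).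
Proof.
move=> ->; rewrite mul0mx add0r mulmxBr !mulmxA addrC subrK.
by rewrite -scalemxAr.
Qed.

(** * Flatness of the induced metric on the eigenline *)

Section DegreeZero.
Variables (R : realType) (X : riemann_surface R) (E : bundle X 2).
Variables (phi : idx X -> bidx E -> X -> 'M[R[i]]_2) (H : R -> bidx E -> X -> 'M[R[i]]_2).
Variable m : bidx E -> X -> 'M[R[i]]_1.
Hypothesis E_holo : holo_bundle E.
Hypothesis H_harmonic : forall t : R, 0 < t ->
  harmonic_metric (fun i j x => t%:C *: phi i j x) (H t).
Hypothesis H_det : forall (t : R) (j : bidx E) (x : X), 0 < t -> bdom j x ->
  (\det (H t j x))%:M = m j x.
Hypothesis H_smooth : smooth_family H.
Variables t g : R.
Hypotheses (t_gt0 : 0 < t) (g_gt1 : 1 < g).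
Hypothesis rigid : forall i j x, dom i x -> bdom j x ->
  [/\ Gamma H t j x *m Gamma H t j x = (g%:C ^+ 2)%:M,
      fdconnection H i j (t, pt_chart i x) = 0 &
      Gamma H t j x *m phi i j x = phi i j x *m Gamma H t j x].
Local Notation C := R[i].
Local Notation plane2 := (R * R)%type.
Local Notation T := (R * (R * R))%type.
Local Notation P := (eproj H t g).
Local Notation L := (eigenline H t g).
Local Notation HL := (@eigenline_metric R X E H t g).

Let bdom_open (j : bidx E) : open (bdom j).
Proof. by have [Eo _ _ _ _] := E_holo; exact: Eo. Qed.

Section Chart.
Variables (i : idx X) (j : bidx E) (b : 'I_2).
Local Notation Dom := (family_dom i j).
Local Notation F := (metric_family H i j).
Local Notation Q := (fproj H t g i j).
Local Notation A := (fconnection H i j).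
Let oD : open Dom := @family_dom_open R X E bdom_open i j.
Let sF : smooth_mx Dom F.
Proof. exact (family_smooth H_smooth i j). Qed.
Let pF q : Dom q -> posdef (F q).
Proof. exact: (family_posdef H_harmonic). Qed.
Let sQ : smooth_mx Dom Q := smooth_fproj E_holo H_harmonic H_smooth t g i j.
Let sA : smooth_mx Dom A.
Proof. exact (smooth_connection oD (1 / 2) (- 'i%C / 2) dir_x dir_y sF pF). Qed.

Let v (q : T) : 'cV[C]_2 := col b (Q q).
Definition line_gram (q : T) : 'M[C]_1 := adjmx (v q) *m F q *m v q.

Let sv : smooth_mx Dom v.
Proof. by move=> k l; apply: (smooth_ext oD _ (sQ k b)) => q _; rewrite /v col_mxE. Qed.
Let sav : smooth_mx Dom (fun q => adjmx (v q)).
Proof. exact (smooth_mx_adj oD sv). Qed.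

Lemma smooth_line_gram : smooth_mx Dom line_gram.
Proof. exact (smooth_mxM oD (smooth_mxM oD sav sF) sv). Qed.

Lemma line_gramE p : HL (j, b) (chart_pt i p) = line_gram (t, p).
Proof. by rewrite /eigenline_metric /= (fprojE H t g i j p). Qed.

Let dv d q : mxderive d v q = col b (mxderive d Q q).
Proof.
apply/matrixP => k l; rewrite col_mxE !mxderiveE; congr (d _ q).
by apply/funext => y; rewrite /v col_mxE.
Qed.

(** The connection form of the induced metric: by rank one, column [b] of P A is a multiple of
    column [b] of P, and row [b] gives the factor. *)
Let form (q : T) : C := (Q q *m A q) b b / Q q b b.

(** The spanning column is holomorphic, so its adjoint is killed by dz. Its own derivative is column
    [b] of [P, A], and the part - A v cancels against the derivative of the metric. *)
Lemma derive_dz_line_gram p : Dom (t, p) -> Q (t, p) b b != 0 ->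
  mxderive dz3 line_gram (t, p) = form (t, p) *: line_gram (t, p).
Proof.
move=> Dp Qb.
have dZ := lin_derive_derivation oD (1 / 2) dir_x (- 'i%C / 2) dir_y.
have e1 : mxderive dz3 v (t, p) = col b (Q (t, p) *m A (t, p)) - A (t, p) *m v (t, p).
  rewrite dv (derive_dz_fproj E_holo H_harmonic H_smooth rigid Dp).
  by rewrite /v !colE mulmxBl mulmxA.
have e2 : mxderive dz3 (fun q => adjmx (v q)) (t, p) = 0.
  apply: (etrans (mxderive_adj oD (1 / 2) dir_x (- 'i%C / 2) dir_y sv Dp)).
  apply: (etrans (f_equal (@adjmx R 2 1) (dv dzb3 (t, p)))).
  rewrite (derive_dzb_fproj E_holo H_harmonic H_smooth rigid Dp).
  by apply/matrixP => k l; rewrite adjmxE !mxE (rmorph0 (@conjc R)).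
have e3 : mxderive dz3 F (t, p) = F (t, p) *m A (t, p).
  rewrite /fconnection /connection mulKVmx; first by [].
  exact: (posdef_unitmx (pF Dp)).
have d0 : \det (Q (t, p)) = 0.
  rewrite -(fprojE H t g i j p); have [_ _ jp] := Dp.
  exact (eproj_det E_holo H_harmonic H_det H_smooth t_gt0 g_gt1 rigid jp).
have e4 : col b (Q (t, p) *m A (t, p)) = form (t, p) *: v (t, p).
  rewrite colE -mulmxA (det0_range _ d0 Qb); congr (_ *: _).
  by rewrite /form mulmxA -colE col_mxE.
apply: (etrans (mxderiveM oD dZ (smooth_mxM oD sav sF) sv Dp)).
apply: (etrans (f_equal2 (fun U W => U *m v (t, p) + (adjmx (v (t, p)) *m F (t, p)) *m W)
  (mxderiveM oD dZ sav sF Dp) e1)).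
apply: (etrans (f_equal2 (fun U W => (U *m F (t, p) + adjmx (v (t, p)) *m W) *m v (t, p) +
   (adjmx (v (t, p)) *m F (t, p)) *m (col b (Q (t, p) *m A (t, p)) - A (t, p) *m v (t, p)))
   e2 e3)).
exact: gram_leibniz e4.
Qed.

Let D' : set T := [set q | Dom q /\ Q q b b != 0].
Let oD' : open D'.
Proof. exact (open_neq0 oD (sQ b b)). Qed.
Let sD' : D' `<=` Dom.
Proof. by move=> q []. Qed.

Let sN : smooth D' (fun q => (Q q *m A q) b b).
Proof. exact (smooth_sub sD' (smooth_mxM oD sQ sA b b)). Qed.
Let sQb : smooth D' (fun q => Q q b b).
Proof. exact (smooth_sub sD' (sQ b b)). Qed.
Let sform : smooth D' form.
Proof. by apply: (smoothM oD' sN); apply: (smoothV oD' _ sQb) => q []. Qed.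

(** dzbar kills both P and the connection form of [E], hence numerator and denominator of [form];
    this is the flatness of the line. *)
Lemma derive_dzb_form p : D' (t, p) -> dzb3 form (t, p) = 0.
Proof.
move=> Dp'; have [Dp Qb] := Dp'.
(* The quotient [form] is smooth only where its denominator is nonzero, the matrices on the whole
   chart domain; each product rule is used on its own domain. *)
have dB' := lin_derive_derivation oD' (conjc (1 / 2)) dir_x (conjc (- 'i%C / 2)) dir_y.
have dB := lin_derive_derivation oD (conjc (1 / 2)) dir_x (conjc (- 'i%C / 2)) dir_y.
have eQ := derive_dzb_fproj E_holo H_harmonic H_smooth rigid Dp.
have eA := derive_dzb_connection0 E_holo H_harmonic H_det H_smooth t_gt0 g_gt1 rigid Dp.
have e1 : dzb3 (fun q => Q q b b) (t, p) = 0.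
  apply: (etrans (esym (mxderiveE dzb3 Q (t, p) b b))).
  by rewrite eQ mxE.
have e2 : dzb3 (fun q => (Q q *m A q) b b) (t, p) = 0.
  apply: (etrans (esym (mxderiveE dzb3 (fun q => Q q *m A q) (t, p) b b))).
  have e : mxderive dzb3 (fun q => Q q *m A q) (t, p) = 0.
    apply: (etrans (mxderiveM oD dB sQ sA Dp)).
    apply: (etrans (f_equal2 (fun U W => U *m A (t, p) + Q (t, p) *m W) eQ eA)).
    by rewrite mul0mx mulmx0 addr0.
  by rewrite e mxE.
have e3 : dzb3 (fun q => form q * Q q b b) (t, p) = 0.
  apply: (etrans _ e2); apply: (derivation_ext dB') => // q [_ Qq].
  by rewrite /form divfK.
have e4 := etrans (esym (derivationM dB' sform sQb Dp')) e3.
have e5 := etrans (f_equal (fun z => dzb3 form (t, p) * Q (t, p) b b + form (t, p) * z) (esym e1)) e4.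
by move: e5 => /eqP; rewrite mulr0 addr0 mulf_eq0 (negPf Qb) orbF => /eqP.
Qed.

Lemma line_gram_posdef p : D' (t, p) -> line_gram (t, p) \in unitmx ->
  invmx (line_gram (t, p)) *m mxderive dz3 line_gram (t, p) = (form (t, p))%:M.
Proof.
move=> [Dp Qb] u; rewrite (derive_dz_line_gram Dp Qb) -scalemxAr mulVmx//.
by rewrite scalemx1.
Qed.

Lemma line_curvature0 p : D' (t, p) ->
  (forall p, D' (t, p) -> line_gram (t, p) \in unitmx) ->
  chern_curvature i (HL (j, b)) (chart_pt i p) = 0.
Proof.
move=> Dp' u; rewrite /chern_curvature.
have h q : D' (t, q) -> invmx (HL (j, b) (chart_pt i q)) *m dz_mx i (HL (j, b)) (chart_pt i q) =
    (fun q' => (form q')%:M : 'M[C]_1) (t, q).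
  move=> Dq; rewrite line_gramE.
  rewrite (dz_mx_slice oD (@subset_refl _ _) (F := line_gram) _ (sD' Dq)).
    exact: line_gram_posdef Dq (u _ Dq).
  by move=> p' _; exact: line_gramE.
apply: (etrans (f_equal -%R (dzbar_mx_slice
  (A := fun y => invmx (HL (j, b) y) *m dz_mx i (HL (j, b)) y)
  (F := fun q => (form q)%:M) oD' sD' h Dp'))).
apply/eqP; rewrite oppr_eq0; apply/eqP/matrixP => k l; rewrite mxderiveE (ord1 k) (ord1 l).
rewrite [RHS]mxE; apply: (etrans _ (derive_dzb_form Dp')).
apply: (f_equal (fun f => dzb3 f (t, p))); apply/funext => q.
by rewrite mxE.
Qed.

End Chart.

Lemma eigenline_metric_posdef (a : bidx L) x : bdom a x -> posdef (HL a x).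
Proof.
move=> ax; have [[_ pH _] _] := H_harmonic t_gt0; have [a1x _] := ax.
have [hH pHx] := pH _ _ a1x.
split; first by rewrite /eigenline_metric !adjmxM adjmxK hH mulmxA.
move=> u u0.
have -> : hform (HL a x) u u = hform (H t a.1 x) (col a.2 (P a.1 x) *m u) (col a.2 (P a.1 x) *m u).
  by rewrite /hform /eigenline_metric adjmxM !mulmxA.
apply: pHx; apply/eqP => e; move/eqP: u0; apply.
have u1 : u = (u 0 0)%:M by apply/matrixP => k l; rewrite (ord1 k) (ord1 l) mxE.
rewrite u1 mul_mx_scalar in e.
by rewrite u1 (sec_neq0 ax e); apply/matrixP => k l; rewrite !mxE mul0rn.
Qed.

Lemma eigenline_metric_trans (a b : bidx L) x : bdom a x -> bdom b x ->
  HL b x = adjmx (trans a b x) *m HL a x *m trans a b x.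
Proof.
move=> ax bx; have [[_ _ tr] _] := H_harmonic t_gt0.
have e : trans a.1 b.1 x *m col b.2 (P b.1 x) = col a.2 (P a.1 x) *m trans a b x.
  by rewrite mul_mx_scalar; exact (trans_sec E_holo H_harmonic H_det H_smooth t_gt0 g_gt1 rigid ax bx).
move: e; rewrite /eigenline_metric (tr a.1 b.1 x (proj1 ax) (proj1 bx)).
move: (trans a b x) (trans a.1 b.1 x) (col a.2 (P a.1 x)) (col b.2 (P b.1 x)) => c h u w e.
rewrite [adjmx w *m _]mulmxA [adjmx w *m _]mulmxA -adjmxM -!mulmxA e adjmxM.
by rewrite !mulmxA.
Qed.

Lemma eigenline_hermitian : hermitian_metric HL.
Proof.
split.
- case=> j b k l i.
  have s := smooth_slice t (@smooth_line_gram i j b k l).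
  have e : (fun p => HL (j, b) (chart_pt i p) k l) = (fun p => line_gram i j b (t, p) k l).
    by apply/funext => p; exact (f_equal (fun M : 'M[C]_1 => M k l) (line_gramE i j b p)).
  rewrite -e in s; apply: (smooth_sub _ s) => p [ip [jp _]].
  exact (And3 t_gt0 ip jp).
- exact: eigenline_metric_posdef.
- exact: eigenline_metric_trans.
Qed.

Lemma eigenline_flat i (a : bidx L) x : dom i x -> bdom a x ->
  chern_curvature i (HL a) x = 0.
Proof.
case: a => j b ix ax; have [jx pb] := ax; rewrite /= in jx pb.
have Dp := family_dom_pt t_gt0 ix jx.
have eQ : fproj H t g i j (t, pt_chart i x) b b = P j x b b.
  by rewrite -(fprojE H t g i j) (pt_chartK ix).
have Dp' := conj Dp (eq_ind _ (fun z => z != 0) pb _ (esym eQ)).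
rewrite -(pt_chartK ix); apply: (line_curvature0 Dp') => p [[_ ip jp] qb].
rewrite -line_gramE; apply: posdef_unitmx; apply: eigenline_metric_posdef.
have e := f_equal (fun M : 'M[C]_2 => M b b) (fprojE H t g i j p).
exact (conj jp (eq_ind _ (fun z => z != 0) qb _ (esym e))).
Qed.

End DegreeZero.

(** Every chart integrand is zero, but [has_integral] asserts the existence of a partition of unity,
    so one has to be supplied. *)
Lemma has_integral0 (R : realType) (X : riemann_surface R) n (c : 'I_n -> idx X)
  (rho : 'I_n -> X -> R) : partition_of_unity c rho ->
  has_integral (fun (_ : idx X) (_ : X) => 0 : R[i]) 0.
Proof.
move=> pu; exists n, c, rho; split=> //; rewrite big1// => k _.
have z x : (rho k x)%:C * (- 2 * 'i%C * 0) = 0 :> R[i] by rewrite !mulr0.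
rewrite /chart_integral; apply: (f_equal2 (@Complex R)).
  by rewrite /Rintegral integral0_eq// => p _; rewrite z.
by rewrite /Rintegral integral0_eq// => p _; rewrite z.
Qed.

Theorem proposition1p2 (R : realType) (X : riemann_surface R) (g : nat)
  (X_compact : compact [set: X]) (X_genus : has_genus X g) (g_ge2 : (2 <= g)%N)
  (E : bundle X 2) (phi : idx X -> bidx E -> X -> 'M[R[i]]_2)
  (E_higgs : SL_higgs_bundle phi) (E_degree : has_degree E 0)
  (E_stable : stable phi)
  (m : bidx (det_bundle E) -> X -> 'M[R[i]]_1)
  (m_metric : hermitian_metric m) (m_flat : flat_metric m)
  (H : R -> bidx E -> X -> 'M[R[i]]_2)
  (H_harmonic : forall t : R, 0 < t ->
     harmonic_metric (fun i j x => t%:C *: phi i j x) (H t))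
  (H_det : forall (t : R) (j : bidx E) (x : X), 0 < t -> bdom j x ->
     (\det (H t j x))%:M = m j x)
  (H_smooth : smooth_family H) :
  forall t : R, 0 < t -> forall (x : X) (j : bidx E), bdom j x ->
    (op_norm (H t j x) (Gamma H t j x) <= 1)%E.
Proof.
have [E_holo _ _ _] := E_higgs.
have H_det' : forall (t : R) (j : bidx E) (x : X), 0 < t -> bdom j x ->
  (\det (H t j x))%:M = (m : bidx E -> X -> 'M[R[i]]_1) j x by exact H_det.
move=> t t_gt0 x j jx.
have [[_ pH _] _] := H_harmonic t t_gt0.
apply: (op_norm_tracefree_le1 (pH _ _ jx)
  (Gamma_selfadjoint E_holo H_harmonic H_smooth t_gt0 jx)
  (Gamma_trace E_holo H_harmonic H_det' H_smooth t_gt0 jx)).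
(* If the bound fails at one point, the rigid case occurs and the eigenline becomes a destabilizing
   subbundle. *)
rewrite leNgt; apply/negP => gt1.
have gt1' : 1 < global_energy H E_holo t x.
  by rewrite (global_energyE E_holo H_harmonic H_smooth t_gt0 jx).
have [a a_gt1 rigid] := rigidity H_harmonic H_det' H_smooth t_gt0 X_compact gt1'.
have sub := eigenline_subbundle E_holo H_harmonic H_det' H_smooth t_gt0 a_gt1 rigid.
have invt := eigenline_invariant E_holo H_harmonic H_det' H_smooth t_gt0 a_gt1 rigid.
have deg : has_degree (eigenline H t a) 0.
  (* The partition of unity that witnesses the degree of [E] is reused for the eigenline. *)
  have [_ [_ [_ [_ _ [n [c [rho [pu _]]]] _]]]] := E_degree.
  exists (@eigenline_metric R X E H t a), (fun _ _ => 0), 0; split.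
  - exact: (eigenline_hermitian E_holo H_harmonic H_det' H_smooth t_gt0 a_gt1 rigid).
  - move=> i k y iy ky.
    rewrite (eigenline_flat E_holo H_harmonic H_det' H_smooth t_gt0 a_gt1 rigid iy ky).
    by rewrite mxtrace0.
  - exact: has_integral0 pu.
  - by rewrite mulr0.
by have := E_stable _ _ sub invt _ deg; rewrite ltxx.
Qed.
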